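(* Let $u\in\mathbb{R}^n$ and let $f\in\mathcal{F}(\mathcal{K}^n_I)$. Then for every measurable function $g:\mathbb{R}^n\to[0,\infty)$ and every measurable, non-increasing function $\Omega:(0,\infty)\to(0,\infty)$ such that $$f(x)g(y)\le\Omega^2(\langle x,y\rangle)\qquad\text{for all }x,y\in\mathbb{R}^n\text{ with }\langle x,y\rangle>0,$$ it holds that $$\Big(\int_{\mathbb{R}^n}f(x)\langle x,u\rangle^2dx\Big)\Big(\int_{\mathbb{R}^n}g(y)\langle y,u\rangle^2dy\Big)\le\Big(\int_{\mathbb{R}^n}\Omega(|z|^2)\langle z,u\rangle^2dz\Big)^2.$$
   Context: $\mathcal{K}^n_I$ is the set of isotropic convex bodies: origin-symmetric ($K=-K$) compact convex sets $K\subset\mathbb{R}^n$ with non-empty interior such that $\int_K\langle x,\theta\rangle^2dx=\frac1n\int_K|x|^2dx$ for every $\theta\in\mathbb{S}^{n-1}$. $\mathcal{F}(\mathcal{K}^n_I)$ is the set of measurable $f:\mathbb{R}^n\to[0,\infty)$ such that $\{f\ge r\}\in\mathcal{K}^n_I$ for almost every $r\in(0,\|f\|_\infty)$. Measurable means Borel measurable; $0\cdot\infty=0$. *)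

(* Defs.v *)
From HB Require Import structures.
From mathcomp Require Import all_boot all_order all_algebra.
From mathcomp Require Import all_classical all_reals all_analysis.
From mathcomp Require Import measurable_realfun.

Set Implicit Arguments.
Unset Strict Implicit.
Unset Printing Implicit Defensive.

Import Order.TTheory GRing.Theory Num.Theory.
Import numFieldNormedType.Exports.

Local Open Scope classical_set_scope.
Local Open Scope ring_scope.

(* Borel sigma-algebra. *)
HB.instance Definition _ (R : realType) (m n : nat) :=
  @isMeasurable.Build (sigma_display (@open 'M[R]_(m, n))) 'M[R]_(m, n)
    <<s @open 'M[R]_(m, n) >> (@sigma_algebra0 _ setT open)
    (@sigma_algebraC _ open) (@sigma_algebra_bigcup _ setT open).

Section borel_rV.
Context {R : realType}.

Lemma open_measurable_rV n (A : set 'rV[R]_n) : open A -> measurable A.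
Proof. exact: sub_sigma_algebra. Qed.

Lemma measurable_rV_coord n (i : 'I_n) :
  measurable_fun [set: 'rV[R]_n] (fun x : 'rV[R]_n => x 0 i).
Proof.
apply: (measurability (@RGenOpens.G R)).
  exact: RGenOpens.measurableE.
move=> _ [_ [a [b ->]] <-]; rewrite setTI.
apply: open_measurable_rV; apply: open_comp; last exact: interval_open.
by move=> x _; exact: coord_continuous.
Qed.

Lemma open_rV_bigcup n (A : set 'rV[R]_n) : open A ->
  A = \bigcup_(p in [set p : 'rV[rat]_n * nat |
         ball (map_mx ratr p.1 : 'rV[R]_n) p.2.+1%:R^-1 `<=` A])
      ball (map_mx ratr p.1 : 'rV[R]_n) p.2.+1%:R^-1.
Proof.
move=> oA; apply/seteqP; split=> [x Ax|x [p /= pA]]; last exact: pA.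
have /nbhs_ballP[_/posnumP[e] xeA] : nbhs x A by exact: open_nbhs_nbhs.
have [k ke] : exists k : nat, k.+1%:R^-1 + k.+1%:R^-1 <= e%:num :> R.
  have [k _ /(_ k (leqnn k))/= ke] := near_infty_natSinv_lt (e%:num / 2)%:pos.
  by exists k; rewrite [leRHS]splitr lerD// ltW.
have k0 : 0 < k.+1%:R^-1 :> R by rewrite invr_gt0.
have q_ i : exists q : rat, ball (ratr q : R) k.+1%:R^-1 (x 0 i).
  have /rat_in_itvoo[q] : x 0 i - k.+1%:R^-1 < x 0 i + k.+1%:R^-1.
    by rewrite ltrBlDr -addrA ltrDl addr_gt0.
  rewrite in_itv/= => /andP[q1 q2]; exists q.
  by rewrite -ball_normE /ball_/= ltr_norml ltrBrDr [- _ + _]addrC q1/= ltrBlDr addrC.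
pose q : 'rV[rat]_n := \row_i projT1 (cid (q_ i)).
have qx : ball (map_mx ratr q : 'rV[R]_n) k.+1%:R^-1 x.
  split=> // i j; rewrite !mxE (ord1 i); exact: (projT2 (cid (q_ j))).
exists (q, k) => //= y qy; apply: xeA.
apply: (@le_ball _ _ _ _ _ ke).
exact: ball_triangle (ball_sym qx) qy.
Qed.

Lemma measurable_fun_rV d (T : measurableType d) n (f : T -> 'rV[R]_n) :
  (forall i, measurable_fun [set: T] (fun t => f t 0 i)) ->
  measurable_fun [set: T] f.
Proof.
move=> mf; apply: (measurability (@open 'rV[R]_n)) => //.
move=> _ [A oA <-]; rewrite setTI (open_rV_bigcup oA) preimage_bigcup.
rewrite bigcup_mkcond; apply: countable_bigcupT_measurable => [|p]; first exact: countableP.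
case: ifP => // _.
rewrite (_ : _ @^-1` _ =
    \bigcap_(i in [set: 'I_n]) [set t | ball (ratr (p.1 0 i) : R) p.2.+1%:R^-1 (f t 0 i)]).
  apply: fin_bigcap_measurable => // i _.
  rewrite -[X in measurable X]setTI; apply: (mf i) => //.
  by apply: open_measurable; exact: ball_open.
apply/seteqP; split=> t /=.
  by move=> [_ tp] i _; have := tp 0 i; rewrite mxE.
move=> tp; split=> [|i j]; first by rewrite invr_gt0.
by rewrite (ord1 i) mxE; exact: tp.
Qed.

End borel_rV.

Section lebesgue_rV.
Context {R : realType}.

Definition cons_rV n (p : measurableTypeR R * 'rV[R]_n) : 'rV[R]_n.+1 :=
  row_mx (const_mx p.1 : 'rV[R]_1) p.2.

Lemma measurable_cons_rV n :
  measurable_fun [set: measurableTypeR R * 'rV[R]_n] (@cons_rV n).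
Proof.
apply: measurable_fun_rV => i.
rewrite (_ : (fun _ => _) = fun p : measurableTypeR R * 'rV[R]_n =>
    match fintype.split (i : 'I_(1 + n)) with inl _ => p.1 | inr j => p.2 0 j end).
  case: fintype.split => j; first exact: measurable_fst.
  exact: (measurableT_comp (measurable_rV_coord j) measurable_snd).
apply/funext => p; rewrite /cons_rV mxE.
by case: fintype.split => // j; rewrite mxE.
Qed.

Section cons_measure.
Variables (n : nat) (mu : {sigma_finite_measure set 'rV[R]_n -> \bar R}).

Definition cons_measure : set 'rV[R]_n.+1 -> \bar R :=
  pushforward (lebesgue_measure \x mu)%E (@cons_rV n).

Let mcons := @measurable_cons_rV n.

Let cons_measure0 : cons_measure set0 = 0%E. Proof. exact: measure0. Qed.

Let cons_measure_ge0 A : (0 <= cons_measure A)%E.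
Proof. exact: measure_ge0. Qed.

Let cons_measure_sigma_additive : semi_sigma_additive cons_measure.
Proof. exact: measure_semi_sigma_additive. Qed.

HB.instance Definition _ := isMeasure.Build _ _ _ cons_measure
  cons_measure0 cons_measure_ge0 cons_measure_sigma_additive.

Let cons_measure_sigma_finite : sigma_finite setT cons_measure.
Proof.
have /sigma_finiteP[F [FT ndF Foo]] := @sigma_finiteT _ _ R lebesgue_measure.
have /sigma_finiteP[G [GT ndG Goo]] := sigma_finiteT mu.
pose h (x : 'rV[R]_n.+1) : measurableTypeR R * 'rV[R]_n :=
  (x 0 0, \row_j x 0 (lift ord0 j)).
have mh : measurable_fun [set: 'rV[R]_n.+1] h.
  apply/measurable_fun_pairP; split; first exact: measurable_rV_coord.
  apply: measurable_fun_rV => i.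
  rewrite (_ : (fun _ => _) = fun x : 'rV[R]_n.+1 => x 0 (lift ord0 i)).
    exact: measurable_rV_coord.
  by apply/funext => x; rewrite /= mxE.
have hK : cancel (@cons_rV n) h.
  move=> [a x]; congr pair; rewrite /cons_rV/=.
    by rewrite mxE; case: splitP => // j _; rewrite mxE.
  apply/rowP => j; rewrite !mxE; case: splitP => k /=.
    by rewrite (ord1 k).
  by rewrite /bump add1n => -[] /val_inj ->.
exists (fun k => h @^-1` (F k `*` G k)).
  apply/seteqP; split=> // x _.
  have [i _ Fi] : (\bigcup_i F i) (h x).1 by rewrite -FT.
  have [j _ Gj] : (\bigcup_i G i) (h x).2 by rewrite -GT.
  exists (maxn i j) => //; split.
    by move: Fi; exact/subsetPset/ndF/leq_maxl.
  by move: Gj; exact/subsetPset/ndG/leq_maxr.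
move=> k; have [mF Fk] := Foo k; have [mG Gk] := Goo k; split.
  by rewrite -[X in measurable X]setTI; apply: mh => //; exact: measurableX.
rewrite /cons_measure /pushforward -comp_preimage (_ : h \o _ = id); last first.
  by apply/funext => x; exact: hK.
by rewrite preimage_id product_measure1E// lte_mul_pinfty// ge0_fin_numE.
Qed.

HB.instance Definition _ := Measure_isSigmaFinite.Build _ _ _ cons_measure
  cons_measure_sigma_finite.

End cons_measure.

Definition point_measure : set 'rV[R]_0 -> \bar R := dirac (0 : 'rV[R]_0).

HB.instance Definition _ := Measure.on point_measure.

Let point_measure_sigma_finite : sigma_finite setT point_measure.
Proof.
exists (fun=> setT); first by rewrite bigcup_const.
by move=> i; split => //; rewrite /point_measure diracT ltry.
Qed.

HB.instance Definition _ := Measure_isSigmaFinite.Build _ _ _ point_measure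
  point_measure_sigma_finite.

(* Lebesgue measure on R^n, as the n-fold product of Lebesgue measure on R. *)
Fixpoint lebesgue_rV n : {sigma_finite_measure set 'rV[R]_n -> \bar R} :=
  if n is k.+1 then cons_measure (lebesgue_rV k) else point_measure.

Lemma lebesgue_rV_box n (A : 'I_n -> set (measurableTypeR R)) :
  (forall i, measurable (A i)) ->
  lebesgue_rV n [set x : 'rV[R]_n | forall i, A i (x 0 i)] =
  (\prod_(i < n) lebesgue_measure (A i))%E.
Proof.
elim: n A => [|n IH] A mA.
  have -> : [set x : 'rV[R]_0 | forall i, A i (x 0 i)] = setT.
    by apply/seteqP; split=> // x _; case.
  by rewrite big_ord0 /= /point_measure diracT.
have mA' : measurable [set x : 'rV[R]_n | forall i, A (lift ord0 i) (x 0 i)].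
  have -> : [set x : 'rV[R]_n | forall i, A (lift ord0 i) (x 0 i)] =
      \bigcap_(i in [set: 'I_n])
        ((fun x : 'rV[R]_n => x 0 i) @^-1` A (lift ord0 i)).
    by apply/seteqP; split=> x /= Ax i => [_|]; [exact: Ax|exact: (Ax i I)].
  apply: fin_bigcap_measurable => // i _.
  by rewrite -[X in measurable X]setTI; exact: (measurable_rV_coord i measurableT (mA _)).
rewrite big_ord_recl -(IH (fun i => A (lift ord0 i)))// -product_measure1E//.
  rewrite /= /cons_measure /pushforward; congr (product_measure1 _ _ _).
  apply/seteqP; split=> -[a x] /=.
    move=> Aax; split=> [|i].
      by have := Aax ord0; rewrite /cons_rV mxE; case: splitP => // j _; rewrite mxE.
    have := Aax (lift ord0 i); rewrite /cons_rV mxE; case: splitP => k /=.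
      by rewrite (ord1 k).
    by rewrite /bump add1n => -[] /val_inj ->.
  move=> [Aa Ax] i; rewrite /cons_rV mxE; case: splitP => k ik; last first.
    by rewrite (_ : i = lift ord0 k) //; exact: val_inj.
  by rewrite mxE (_ : i = ord0)//; apply: val_inj; rewrite /= ik (ord1 k).
Qed.

End lebesgue_rV.
Arguments lebesgue_rV R n : clear implicits.

Section isotropic.
Context {R : realType} {n : nat}.
Implicit Types (x y : 'rV[R]_n) (K : set 'rV[R]_n) (f : 'rV[R]_n -> R).

Definition dotv x y : R := \sum_(i < n) x 0 i * y 0 i.

(* The library norm `|x| on 'rV is the sup norm, hence this one. *)
Definition enorm x : R := Num.sqrt (dotv x x).

Definition isotropic_convex_body K :=
  [/\ [set - x | x in K] = K,
      convex_set K,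
      compact K,
      K° !=set0 &
      forall theta, enorm theta = 1 ->
        (\int[lebesgue_rV R n]_(x in K) (dotv x theta ^+ 2)%:E =
         n%:R^-1%:E * \int[lebesgue_rV R n]_(x in K) (enorm x ^+ 2)%:E)%E].

(* 'N_+oo is the essential supremum of f; it may be +oo. *)
Definition isotropic_level_fun f :=
  [/\ measurable_fun [set: 'rV[R]_n] f,
      forall x, 0 <= f x &
      {ae @lebesgue_measure R, forall r,
        0 < r -> (r%:E < 'N[lebesgue_rV R n]_+oo[EFin \o f])%E ->
        isotropic_convex_body [set x | r <= f x]}].

End isotropic.

(* Main.v *)
(* The argument follows the inductive proofs of the functional Santalo
   inequality. By the layer-cake formula the truncations of [f] are even and
   isotropic, [int f <x, th>^2 = S |th|^2], so one may assume that [f] and [g]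
   are bounded with bounded support. A rotation makes [u] the first axis; write
   points as [(r, x)]. Evenness of [f] reduces the claim to the half-space
   [r > 0], where isotropy gives [int f r x_j = 0], and what remains is
     [(int f r^2) (int g r^2) <= (int_(r > 0) Om(r^2 + |x|^2) r^2)^2]
   for centered [f] and arbitrary [g]. This goes by induction on the number of
   coordinates of [x]. With none left it is Prekopa-Leindler in logarithmic
   variables. For the step, single out a coordinate [s] of [x] and choose a
   hyperplane [s = c r] which bisects the mass of [g r^2]. A shear moves it to
   [s = 0] and centers both halves of [g]; the contragredient shear, applied to
   [f], keeps the pairing. On each half the one-dimensional inequality
   integrates [s] out, and the induction hypothesis applies with the roles of
   [f] and [g] exchanged. The halves add up because the bisection makes the two
   moments of [g] equal, and because the shear can only increase
   [int f (max r 0)^2], by convexity and the centering of [f]. *)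

From HB Require Import structures.
Require Import Defs.
From mathcomp Require Import all_boot all_order all_algebra.
From mathcomp Require Import all_classical all_reals all_analysis.
From mathcomp Require Import measurable_realfun ess_sup_inf ring lra.

Import Order.TTheory GRing.Theory Num.Theory.
Import numFieldNormedType.Exports.

Set Implicit Arguments.
Unset Strict Implicit.
Unset Printing Implicit Defensive.

Local Open Scope classical_set_scope.
Local Open Scope ring_scope.

(** * Measure-preserving maps *)

Section measure_preserving.
Context {R : realType}.
Local Open Scope ereal_scope.

(** Why the bisection closes the induction: let [mu] be the common moment of the two halves of [g],
    [X1] and [X2] those of the halves of the sheared [f], and [J] half of the integral of [Om]. The
    two applications give [X1 * mu <= J^2] and [X2 * mu <= J^2], and their sum is
    [(X1 + X2) * (2 * mu) <= (2 * J)^2], with no constant lost. The shear on [g] fixes [r], so the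
    weight [r^2] of [g] is untouched. The contragredient shear on [f] then moves [r] by a linear
    form in the other coordinates; this is where the centering of [f] enters, as the vanishing of a
    first-order term. The halves of [g] are centered by construction, those of [f] are not, which
    forces the exchange of roles. In the step [Om] is replaced by [t |-> int_(z > 0) Om(t + z^2)],
    which may be infinite, so it takes extended values. All changes of variables are compositions of
    maps that act on one factor of a product, so slicing is enough to see that they preserve the
    measure. *)

Definition mpres d1 d2 (X : measurableType d1) (Y : measurableType d2)
    (mu : {measure set X -> \bar R}) (nu : {measure set Y -> \bar R}) (T : X -> Y) :=
  measurable_fun setT T /\ forall A, measurable A -> nu A = mu (T @^-1` A).

Lemma mpres_integral d1 d2 (X : measurableType d1) (Y : measurableType d2)
    (mu : {measure set X -> \bar R}) (nu : {measure set Y -> \bar R}) (T : X -> Y)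
    (f : Y -> \bar R) :
  mpres mu nu T -> measurable_fun setT f -> (forall y, 0 <= f y) ->
  \int[nu]_y f y = \int[mu]_x f (T x).
Proof.
move=> [mT nuT] mf f0.
rewrite (@eq_measure_integral _ _ _ _ (pushforward mu T)) => [|A mA _]; last exact: nuT.
by rewrite ge0_integral_pushforward// => y _; exact: f0.
Qed.

Lemma mpres_comp d1 d2 d3 (X : measurableType d1) (Y : measurableType d2)
    (Z : measurableType d3) (mu : {measure set X -> \bar R})
    (nu : {measure set Y -> \bar R}) (eta : {measure set Z -> \bar R}) S T :
  mpres mu nu T -> mpres nu eta S -> mpres mu eta (S \o T).
Proof.
move=> [mT nT] [mS nS]; split; first exact: measurableT_comp.
move=> A mA; rewrite nS//; apply: nT.
by rewrite -[X in measurable X]setTI; exact: mS.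
Qed.

Lemma mpres_id d1 (X : measurableType d1) (mu : {measure set X -> \bar R}) :
  mpres mu mu id.
Proof. by split; [exact: measurable_id|]. Qed.

Lemma mpres_inv d1 d2 (X : measurableType d1) (Y : measurableType d2)
    (mu : {measure set X -> \bar R}) (nu : {measure set Y -> \bar R}) T S :
  mpres mu nu T -> measurable_fun setT S -> cancel T S -> mpres nu mu S.
Proof.
move=> [mT nT] mS TK; split=> // A mA; rewrite nT; last first.
  by rewrite -[X in measurable X]setTI; exact: mS.
by rewrite -comp_preimage (_ : S \o T = id)//; exact/funext.
Qed.

Section fiber.
Context d d1 d2 (X : measurableType d) (Y : measurableType d1) (Z : measurableType d2).
Variables (mu : {sigma_finite_measure set X -> \bar R})
  (nu : {sigma_finite_measure set Y -> \bar R})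
  (eta : {sigma_finite_measure set Z -> \bar R}).

(** Slice by slice: the measure of a set is the integral of the measures of its sections, and each
    section is pulled back by a measure-preserving map. Shears, and through them rotations, are
    built from such fibred maps. *)
Lemma mpres_fiber1 (t : X -> Y -> Z) :
  measurable_fun setT (fun p : X * Y => (p.1, t p.1 p.2)) ->
  (forall x, mpres nu eta (t x)) ->
  mpres (mu \x nu) (mu \x eta) (fun p : X * Y => (p.1, t p.1 p.2)).
Proof.
move=> mT nt; split=> // A mA.
apply: eq_integral => x _ /=; rewrite (nt x).2; last exact: measurable_xsection.
by congr (nu _); apply/seteqP; split=> y; rewrite /xsection/= !inE.
Qed.

Lemma mpres_fiber2 (t : X -> Y -> Z) :
  measurable_fun setT (fun p : Y * X => (t p.2 p.1, p.2)) ->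
  (forall x, mpres nu eta (t x)) ->
  mpres (nu \x mu) (eta \x mu) (fun p : Y * X => (t p.2 p.1, p.2)).
Proof.
move=> mT nt; split=> // A mA.
have mTA : measurable ((fun p : Y * X => (t p.2 p.1, p.2)) @^-1` A).
  by rewrite -[X in measurable X]setTI; exact: mT.
(* Sections over the second factor compute the other iterated product; by uniqueness the two
   products agree. *)
have e21 d3 d4 (X1 : measurableType d3) (X2 : measurableType d4)
   (m1 : {sigma_finite_measure set X1 -> \bar R})
   (m2 : {sigma_finite_measure set X2 -> \bar R}) B : measurable B ->
   (m1 \x m2) B = (m1 \x^ m2) B.
  by move=> mB; apply: product_measure_unique => //= *; rewrite product_measure2E.
transitivity ((eta \x^ mu) A); first exact: e21.
transitivity ((nu \x^ mu) ((fun p : Y * X => (t p.2 p.1, p.2)) @^-1` A)); last exact/esym/e21.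
apply: eq_integral => x _ /=.
rewrite (nt x).2; last exact: measurable_ysection.
by congr (nu _); apply/seteqP; split=> y; rewrite /ysection/= !inE.
Qed.

End fiber.

(** Lebesgue measure is determined by its values on half-open intervals, and a translation keeps
    their length. *)
Lemma mpres_lebD (a : R) :
  mpres (@lebesgue_measure R) lebesgue_measure (fun x => (x + a)%R).
Proof.
have mT : measurable_fun setT (fun x : measurableTypeR R => (x + a)%R : measurableTypeR R).
  exact: measurable_funD.
split=> // A mA.
pose m := pushforward lebesgue_measure (fun x : measurableTypeR R => (x + a)%R : measurableTypeR R).
suff : lebesgue_measure A = m A by [].
apply: lebesgue_measure_unique => // _ [[b c] _ <-].
rewrite /= /pushforward (_ : _ @^-1` _ = `](b - a)%R, (c - a)%R]%classic); last first.
  by apply/seteqP; split=> x /=; rewrite !in_itv/= ltrBlDr lerBrDr.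
by rewrite !lebesgue_measure_itv/= !lte_fin ltrD2r; case: ifP => // _; rewrite -!EFinB; congr EFin; ring.
Qed.

Lemma mpres_lebN : mpres (@lebesgue_measure R) lebesgue_measure -%R.
Proof.
split; first exact: oppr_measurable.
by move=> A mA; exact/esym/(lebesgue_measureN mA).
Qed.
End measure_preserving.

(** * Row vectors: splitting off a coordinate, translations, the inner product *)

Section rV.
Context {R : realType}.

Definition uncons_rV n (x : 'rV[R]_n.+1) : measurableTypeR R * 'rV[R]_n :=
  (x 0 0, \row_j x 0 (lift ord0 j)).

Lemma cons_rV0 n (p : measurableTypeR R * 'rV[R]_n) : cons_rV p 0 0 = p.1.
Proof.
by rewrite /cons_rV mxE; case: splitP => // j _; rewrite mxE.
Qed.

Lemma cons_rVS n (p : measurableTypeR R * 'rV[R]_n) j :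
  cons_rV p 0 (lift ord0 j) = p.2 0 j.
Proof.
rewrite /cons_rV mxE; case: splitP => k /=; first by rewrite (ord1 k).
by rewrite /bump add1n => -[] /val_inj ->.
Qed.

Lemma cons_rVK n : cancel (@cons_rV R n) (@uncons_rV n).
Proof.
move=> [a x]; congr pair; first by rewrite cons_rV0.
by apply/rowP => j; rewrite mxE cons_rVS.
Qed.

Lemma uncons_rVK n : cancel (@uncons_rV n) (@cons_rV R n).
Proof.
move=> x; apply/rowP => j; have [k ->|->] := unliftP ord0 j.
  by rewrite cons_rVS mxE.
by rewrite cons_rV0.
Qed.

Lemma measurable_uncons_rV n : measurable_fun setT (@uncons_rV n).
Proof.
apply/measurable_fun_pairP; split; first exact: measurable_rV_coord.
apply: measurable_fun_rV => i.
rewrite (_ : (fun _ => _) = fun x : 'rV[R]_n.+1 => x 0 (lift ord0 i)).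
  exact: measurable_rV_coord.
by apply/funext => x; rewrite /= mxE.
Qed.

Lemma mpres_cons n :
  mpres (lebesgue_measure \x lebesgue_rV R n)%E (lebesgue_rV R n.+1) (@cons_rV R n).
Proof. by split; [exact: measurable_cons_rV|]. Qed.

Lemma mpres_uncons n :
  mpres (lebesgue_rV R n.+1) (lebesgue_measure \x lebesgue_rV R n)%E (@uncons_rV n).
Proof.
exact: mpres_inv (mpres_cons n) (@measurable_uncons_rV n) (@cons_rVK n).
Qed.

Lemma mpres_rVD n (a : 'rV[R]_n) : mpres (lebesgue_rV R n) (lebesgue_rV R n) (fun x => x + a).
Proof.
elim: n a => [|n IH] a.
  rewrite (_ : (fun x => _) = id); first exact: mpres_id.
  by apply/funext => x; apply/rowP => -[].
have [b [v ->]] : exists b v, a = cons_rV (b, v).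
  by exists (uncons_rV a).1, (uncons_rV a).2; rewrite -surjective_pairing uncons_rVK.
pose t1 (p : measurableTypeR R * 'rV[R]_n) : measurableTypeR R * 'rV[R]_n := (p.1, p.2 + v).
pose t2 (p : measurableTypeR R * 'rV[R]_n) : measurableTypeR R * 'rV[R]_n := (p.1 + b, p.2).
rewrite (_ : (fun x => _) = (@cons_rV R n) \o (t2 \o t1) \o (@uncons_rV n)).
  apply: mpres_comp (mpres_uncons n) _; apply: mpres_comp (mpres_cons n).
  have h2 : measurable_fun setT t2.
    apply/measurable_fun_pairP; split; last exact: measurable_snd.
    by apply: measurable_funD; [exact: measurable_fst|].
  have h1 : measurable_fun setT t1.
    apply/measurable_fun_pairP; split; [exact: measurable_fst|].
    exact: measurableT_comp (IH v).1 measurable_snd.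
  have m1 : mpres (lebesgue_measure \x lebesgue_rV R n)%E (lebesgue_measure \x lebesgue_rV R n)%E t1.
    by apply: (@mpres_fiber1 _ _ _ _ _ _ _ lebesgue_measure (lebesgue_rV R n) (lebesgue_rV R n)
      (fun _ y => y + v) h1) => _; exact: IH.
  apply: mpres_comp m1 _.
  by apply: (@mpres_fiber2 _ _ _ _ _ _ _ (lebesgue_rV R n) lebesgue_measure lebesgue_measure
    (fun _ y => y + b) h2) => _; exact: mpres_lebD.
apply/funext => x; rewrite -{1}(uncons_rVK x); apply/rowP => j /=.
rewrite mxE; have [k ->|->] := unliftP ord0 j; first by rewrite !cons_rVS /= !mxE.
by rewrite !cons_rV0.
Qed.

Lemma mpres_rVN n : mpres (lebesgue_rV R n) (lebesgue_rV R n) -%R.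
Proof.
elim: n => [|n IH].
  rewrite (_ : -%R = id); first exact: mpres_id.
  by apply/funext => x; apply/rowP => -[].
pose t1 (p : measurableTypeR R * 'rV[R]_n) : measurableTypeR R * 'rV[R]_n := (p.1, - p.2).
pose t2 (p : measurableTypeR R * 'rV[R]_n) : measurableTypeR R * 'rV[R]_n := (- p.1, p.2).
rewrite (_ : -%R = (@cons_rV R n) \o (t2 \o t1) \o (@uncons_rV n)).
  apply: mpres_comp (mpres_uncons n) _; apply: mpres_comp (mpres_cons n).
  have h2 : measurable_fun setT t2.
    apply/measurable_fun_pairP; split; last exact: measurable_snd.
    by apply: measurable_funN; exact: measurable_fst.
  have h1 : measurable_fun setT t1.
    by apply/measurable_fun_pairP; split; [exact: measurable_fst|apply: measurableT_comp IH.1 measurable_snd].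
  have m1 : mpres (lebesgue_measure \x lebesgue_rV R n)%E (lebesgue_measure \x lebesgue_rV R n)%E t1.
    by apply: (@mpres_fiber1 _ _ _ _ _ _ _ lebesgue_measure (lebesgue_rV R n) (lebesgue_rV R n)
      (fun _ y => - y) h1) => _; exact: IH.
  apply: mpres_comp m1 _.
  by apply: (@mpres_fiber2 _ _ _ _ _ _ _ (lebesgue_rV R n) lebesgue_measure lebesgue_measure
    (fun _ y => - y) h2) => _; exact: mpres_lebN.
apply/funext => x; rewrite -{1}(uncons_rVK x); apply/rowP => j /=.
rewrite mxE; have [k ->|->] := unliftP ord0 j; first by rewrite !cons_rVS /= !mxE.
by rewrite !cons_rV0.
Qed.

Lemma dotv_cons n (p q : measurableTypeR R * 'rV[R]_n) :
  dotv (cons_rV p) (cons_rV q) = p.1 * q.1 + dotv p.2 q.2.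
Proof.
rewrite /dotv big_ord_recl !cons_rV0; congr (_ + _).
by apply: eq_bigr => i _; rewrite !cons_rVS.
Qed.

Lemma dotvC n (x y : 'rV[R]_n) : dotv x y = dotv y x.
Proof. by apply: eq_bigr => i _; rewrite mulrC. Qed.

Lemma dotvDl n (x y z : 'rV[R]_n) : dotv (x + y) z = dotv x z + dotv y z.
Proof. by rewrite -big_split; apply: eq_bigr => i _; rewrite mxE mulrDl. Qed.

Lemma dotvZl n a (x y : 'rV[R]_n) : dotv (a *: x) y = a * dotv x y.
Proof. by rewrite mulr_sumr; apply: eq_bigr => i _; rewrite mxE mulrA. Qed.

Lemma dotvNl n (x y : 'rV[R]_n) : dotv (- x) y = - dotv x y.
Proof. by rewrite -scaleN1r dotvZl mulN1r. Qed.

Lemma dotvDr n (x y z : 'rV[R]_n) : dotv x (y + z) = dotv x y + dotv x z.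
Proof. by rewrite !(dotvC x) dotvDl. Qed.

Lemma dotvZr n a (x y : 'rV[R]_n) : dotv x (a *: y) = a * dotv x y.
Proof. by rewrite !(dotvC x) dotvZl. Qed.

Lemma dotvNr n (x y : 'rV[R]_n) : dotv x (- y) = - dotv x y.
Proof. by rewrite !(dotvC x) dotvNl. Qed.

Lemma dotv_ge0 n (x : 'rV[R]_n) : 0 <= dotv x x.
Proof. by apply: sumr_ge0 => i _; rewrite -expr2 sqr_ge0. Qed.

Lemma enorm_sqr n (x : 'rV[R]_n) : enorm x ^+ 2 = dotv x x.
Proof. by rewrite sqr_sqrtr// dotv_ge0. Qed.

Lemma measurable_dotv d (T : measurableType d) n (f g : T -> 'rV[R]_n) :
  measurable_fun setT f -> measurable_fun setT g ->
  measurable_fun setT (fun t => dotv (f t) (g t)).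
Proof.
move=> mf mg; apply: measurable_sum => i.
by apply: measurable_funM; apply: measurableT_comp (measurable_rV_coord i) _.
Qed.

Lemma dotv_bound n (x y : 'rV[R]_n) a b : 0 <= a -> 0 <= b ->
  (forall i, `|x 0 i| <= a) -> (forall i, `|y 0 i| <= b) ->
  `|dotv x y| <= n%:R * (a * b).
Proof.
move=> a0 b0 xa yb; apply: (le_trans (ler_norm_sum _ _ _)).
apply: (@le_trans _ _ (\sum_(i < n) a * b)).
  by apply: ler_sum => i _; rewrite normrM ler_pM.
by rewrite sumr_const card_ord mulr_natl.
Qed.

End rV.

(** * The Prekopa-Leindler inequality on the line *)

Section change_of_variables.
Context {R : realType}.
Local Open Scope ereal_scope.
Notation leb := (@lebesgue_measure R).

Lemma ge0_integral_mrestr d (T : measurableType d) (mu : {measure set T -> \bar R})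
    (D : set T) (mD : measurable D) (f : T -> \bar R) :
  measurable_fun setT f -> (forall x, 0 <= f x) ->
  \int[mrestr mu mD]_x f x = \int[mu]_(x in D) f x.
Proof.
move=> mf f0.
have mDC : measurable (~` D) by exact: measurableC.
rewrite -[X in integral _ X](setvU D) ge0_integral_setU//=; last 2 first.
- by rewrite setvU.
- by rewrite disj_set2E setICl.
rewrite [X in X + _](_ : _ = 0) ?add0e; last first.
  have -> : \int[mrestr mu mD]_(x in ~` D) f x = \int[mzero]_(x in ~` D) f x.
    apply: eq_measure_integral => A mA AD; rewrite /= /mrestr.
    by rewrite (_ : A `&` D = set0) ?measure0// -subset0 => x [/AD].
  exact: integral_measure_zero.
by apply: eq_measure_integral => A mA AD; rewrite /= /mrestr setIidl.
Qed.

Lemma lebesgue_layers (c : R) (y : \bar R) : (0 < c)%R -> 0 <= y ->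
  c%:E * leb [set t | ((0 < t)%R /\ (c * t)%:E < y)%E] = y.
Proof.
move=> c0; case: y => [y|_|//].
- rewrite lee_fin => y0.
  rewrite (_ : [set _ | _] = `]0%R, (y / c)%R[%classic).
    rewrite lebesgue_measure_itv/= lte_fin; case: ltP => [_|].
      by rewrite -EFinB -EFinM subr0 mulrC divfK// gt_eqF.
    rewrite ler_pdivrMr// mul0r mule0 => yc; congr EFin; apply/eqP.
    by rewrite eq_le yc y0.
  by apply/seteqP; split=> t /=; rewrite in_itv/= lte_fin ltr_pdivlMr// mulrC => /andP.
- rewrite (_ : [set _ | _] = `]0%R, +oo[%classic).
    by rewrite lebesgue_measure_itv/= ltry mulry gtr0_sg// mul1e.
  by apply/seteqP; split=> t /=; rewrite in_itv/= ltry andbT => // -[].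
Qed.

Lemma measurable_layers d (T : measurableType d) (c : R) (f : T -> \bar R) :
  measurable_fun setT f ->
  measurable [set p : T * measurableTypeR R | ((0 < p.2)%R /\ (c * p.2)%:E < f p.1)%E].
Proof.
move=> mf.
have m1 : measurable [set p : T * measurableTypeR R | (0 < p.2)%R].
  rewrite (_ : [set _ | _] = setT `&` snd @^-1` `]0%R, +oo[%classic).
    by apply: measurable_snd => //; exact: measurable_itv.
  by apply/seteqP; split=> p /=; rewrite in_itv/= andbT => // -[].
have m2 : measurable (setT `&` [set p : T * measurableTypeR R | (c * p.2)%:E < f p.1]).
  apply: measurable_lte => //.
    by apply/measurable_EFinP; apply: measurable_funM => //; exact: measurable_snd.
  exact: measurableT_comp mf measurable_fst.
by rewrite setTI in m2; exact: measurableI.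
Qed.

(** Both sides measure the region under the graph of [f], by columns and by rows. Heights are
    written [c * t], with a scale [c] adapted to each function, so that the layers of different
    functions can be compared at the same [t]. *)
Lemma layer_cake d (T : measurableType d) (mu : {sigma_finite_measure set T -> \bar R})
    (c : R) (f : T -> \bar R) : (0 < c)%R ->
  measurable_fun setT f -> (forall x, 0 <= f x) ->
  \int[mu]_x f x = c%:E * \int[leb]_t mu [set x | ((0 < t)%R /\ (c * t)%:E < f x)%E].
Proof.
move=> c0 mf f0.
pose E := [set p : T * measurableTypeR R | ((0 < p.2)%R /\ (c * p.2)%:E < f p.1)%E].
have mE : measurable E.
  exact: measurable_layers.
have hx x : leb (xsection E x) = c^-1%:E * f x.
  rewrite -(lebesgue_layers c0 (f0 x)) muleA -EFinM mulVf ?gt_eqF// mul1e.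
  by congr (leb _); apply/seteqP; split=> t; rewrite /xsection/= inE.
have ht t : mu (ysection E t) = mu [set x | ((0 < t)%R /\ (c * t)%:E < f x)%E].
  by congr (mu _); apply/seteqP; split=> x; rewrite /ysection/= inE.
transitivity (c%:E * (mu \x leb) E).
  rewrite (_ : (mu \x leb) E = \int[mu]_x (c^-1%:E * f x)); last first.
    by apply: eq_integral => x _; exact: hx.
  rewrite ge0_integralZl_EFin// ?invr_ge0 ?ltW// muleA -EFinM mulfV ?gt_eqF// mul1e.
  by [].
congr (_ * _); transitivity ((mu \x^ leb) E).
  by apply: product_measure_unique => //= *; rewrite product_measure2E.
by apply: eq_integral => t _; rewrite -ht.
Qed.

Section density.
Variable (w : R -> R).
Hypothesis mw : measurable_fun setT w.
Let D := [set q : measurableTypeR R * measurableTypeR R | (0 < q.2)%R /\ (1 * q.2)%:E < (w q.1)%:E].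
Let mD : measurable D.
Proof.
apply: (@measurable_layers _ _ 1 (EFin \o w)); exact/measurable_EFinP.
Qed.

(** The measure with density [w], realized as the projection of area restricted to the region under
    the graph of [w]; this way it inherits the measure axioms. *)
Definition density_measure : set (measurableTypeR R) -> \bar R :=
  pushforward (mrestr (leb \x leb) mD) fst.

Let density_measure0 : density_measure set0 = 0. Proof. exact: measure0. Qed.

Let density_measure_ge0 A : 0 <= density_measure A.
Proof. exact: measure_ge0. Qed.

Let density_measure_sigma_additive : semi_sigma_additive density_measure.
Proof. exact: measure_semi_sigma_additive. Qed.

HB.instance Definition _ := isMeasure.Build _ _ _ density_measure
  density_measure0 density_measure_ge0 density_measure_sigma_additive.

Lemma integral_density (g : R -> \bar R) : (forall x, 0 <= w x)%R ->
  measurable_fun setT g -> (forall x, 0 <= g x) ->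
  \int[density_measure]_x g x = \int[leb]_x (g x * (w x)%:E).
Proof.
move=> w0 mg g0.
have md : measurable_fun setT (fun q : measurableTypeR R * measurableTypeR R => g q.1).
  exact: measurableT_comp mg measurable_fst.
rewrite (@eq_measure_integral _ _ _ _ (pushforward (mrestr (leb \x leb) mD) fst))//.
rewrite ge0_integral_pushforward// preimage_setT ge0_integral_mrestr//=.
rewrite integral_mkcond (_ : _ \_ D = fun q => g q.1 * (\1_D q)%:E); last first.
  by apply/funext => q; rewrite patchE indicE; case: ifP; rewrite ?mule1 ?mule0.
have m1D : measurable_fun setT (fun q : measurableTypeR R * measurableTypeR R => (\1_D q : R)%:E).
  by apply/measurable_EFinP; exact: measurable_indic.
rewrite fubini_tonelli1//=; last 2 first.
- exact: emeasurable_funM.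
- by move=> q; rewrite mule_ge0// lee_fin.
apply: eq_integral => x _; rewrite /fubini_F/= ge0_integralZl//; last first.
  exact: (measurableT_comp m1D (pair1_measurable x)).
congr (_ * _); rewrite -[RHS](lebesgue_layers ltr01); last by rewrite lee_fin.
rewrite mul1e (eq_integral (fun t => (\1_(xsection D x) t)%:E)); last first.
  by move=> t _; rewrite !indicE mem_xsection.
rewrite integral_indic// ?setIT; last exact: measurable_xsection.
by congr (leb _); apply/seteqP; split=> t; rewrite /xsection/= inE.
Qed.
End density.
End change_of_variables.

Section subst.
Context {R : realType}.
Local Open Scope ereal_scope.
Notation leb := (@lebesgue_measure R).

Lemma integral_expR_itv (l a b : R) : (0 < l)%R -> (a < b)%R ->
  \int[leb]_(p in `]a, b]%classic) (l * expR (l * p))%:E = (expR (l * b) - expR (l * a))%:E.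
Proof.
move=> l0 ab.
have cF : continuous (fun p : R => expR (l * p)).
  move=> x; apply: continuous_comp; last exact: continuous_expR.
  by apply: cvgM; [exact: cvg_cst|exact: cvg_id].
have cf : continuous (fun p : R => (l * expR (l * p))%R).
  move=> x; apply: cvgM; first exact: cvg_cst.
  exact: cF.
have dF (x : R) : is_derive x 1%R (fun p : R => expR (l * p)) (l * expR (l * x))%R.
  have h : is_derive x 1%R (fun p : R => (l * p)%R) l.
    by have := @is_deriveZ _ _ _ id l x 1%R 1%R (is_derive_id x 1%R); rewrite scaler1.
  have := @is_derive1_comp _ expR (fun p : R => l * p)%R x (expR (l * x))%R l (is_derive_expR _) h.
  by rewrite mulrC.
rewrite integral_itv_obnd_cbnd; last first.
  by apply/measurable_EFinP; apply: measurable_funTS; exact: continuous_measurable_fun.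
rewrite (continuous_FTC2 ab (F := fun p => expR (l * p))) ?EFinB//.
- by apply: continuous_subspaceT.
- split => [x _||].
  + by have := dF x; case.
  + by apply: cvg_at_right_filter; exact: cF.
  + by apply: cvg_at_left_filter; exact: cF.
- move=> x _; rewrite derive1E; exact: derive_val.
Qed.

(** Both sides integrate [k (expR (l * p))] against a measure in [p]: the image of Lebesgue measure
    on the positive axis under [ln / l], and the measure with density [l * expR (l * p)]. By the
    fundamental theorem of calculus the two agree on half-open intervals, hence everywhere. The rate
    [l] will be 1 for the two factors and 1/2 for their geometric mean. *)
Lemma subst_expR (l : R) (k : R -> \bar R) : (0 < l)%R ->
  measurable_fun setT k -> (forall x, 0 <= k x) ->
  \int[leb]_(x in `]0%R, +oo[) k x = \int[leb]_p (k (expR (l * p)) * (l * expR (l * p))%:E).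
Proof.
move=> l0 mk k0.
pose w (p : R) := (l * expR (l * p))%R.
have me : measurable_fun setT (fun p : R => expR (l * p)).
  by apply: measurableT_comp => //; exact: measurable_funM.
have mw : measurable_fun setT w by exact: measurable_funM.
have w0 p : (0 <= w p)%R by rewrite mulr_ge0 ?expR_ge0// ltW.
have mpos : measurable (`]0%R, +oo[%classic : set (measurableTypeR R)) by exact: measurable_itv.
pose phi (s : measurableTypeR R) : measurableTypeR R := (l^-1 * ln s)%R.
have mphi : measurable_fun setT phi by apply: measurable_funM => //; exact: measurable_ln.
have mke : measurable_fun setT (fun p => k (expR (l * p))) by exact: measurableT_comp.
transitivity (\int[mrestr leb mpos]_s k (expR (l * phi s))).
  rewrite ge0_integral_mrestr//; last exact: (measurableT_comp mke mphi).
  apply: eq_integral => s; rewrite inE/= in_itv/= andbT => s0.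
  by rewrite /phi mulrA mulfV ?gt_eqF// mul1r lnK.
rewrite -(integral_density (w := w))//.
transitivity (\int[pushforward (mrestr leb mpos) phi]_p k (expR (l * p))).
  by rewrite ge0_integral_pushforward// => p _; exact: k0.
apply: eq_measure_integral => //= A mA _.
have mwE a b : (a < b)%R -> density_measure mw `]a, b]%classic =
    (expR (l * b) - expR (l * a))%:E.
  move=> ab; rewrite -integral_expR_itv//.
  have mI : measurable (`]a, b]%classic : set (measurableTypeR R)) by exact: measurable_itv.
  rewrite -[X in density_measure _ X]setIT -(integral_indic (density_measure mw))//.
  rewrite integral_density//=; last first.
    by apply/measurable_EFinP; exact: measurable_indic.
  rewrite [RHS]integral_mkcond; apply: eq_integral => x _.
  by rewrite !patchE indicE; case: ifP; rewrite ?mul1e ?mul0e.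
have pE a b : (a < b)%R -> pushforward (mrestr leb mpos) phi `]a, b]%classic =
    (expR (l * b) - expR (l * a))%:E.
  move=> ab; rewrite /pushforward /= /mrestr.
  rewrite (_ : _ `&` _ = `](expR (l * a)), (expR (l * b))]%classic).
    by rewrite lebesgue_measure_itv/= lte_fin ltr_expR ltr_pM2l// ab EFinB.
  apply/seteqP; split=> s /=; rewrite !in_itv/= andbT /phi.
    move=> [/andP[sa sb] s0]; rewrite -[s]lnK// ltr_expR ler_expR.
    by rewrite -ltr_pdivlMl// -ler_pdivrMl// sa.
  move=> /andP[sa sb]; have s0 : (0 < s)%R by rewrite (le_lt_trans _ sa)// expR_ge0.
  move: sa sb; rewrite -[s]lnK// ltr_expR ler_expR expRK.
  by rewrite ltr_pdivlMl// ler_pdivrMl// => -> ->; rewrite expR_gt0.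
refine (@measure_unique _ R (measurableTypeR R) (@ocitv R)
  (fun n => `](- n%:R)%R, n%:R]%classic) _ _ _ _ _ (density_measure mw) _ _ A mA) => //.
- exact: ocitvI.
- by move=> n; exact: is_ocitv.
- apply/seteqP; split=> // x _.
  exists (Num.bound `|x|) => //=; rewrite in_itv/=.
  have := archi_boundP (normr_ge0 x); rewrite ltr_norml => /andP[-> /ltW].
  by [].
- move=> _ [[a b] _ <-] /=; have [ab|ba] := ltP a b; first by rewrite mwE// -pE.
  by rewrite (_ : `]a, b]%classic = set0) ?measure0// set_itv_ge// bnd_simp -leNgt.
(* For [n = 0] the interval is empty, whereas [pE] asks for [a < b]. *)
- move=> [|n]; first rewrite (_ : `](- 0%:R)%R, 0%:R]%classic = set0) ?measure0//.
    by rewrite set_itv_ge// bnd_simp oppr0 ltxx.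
  apply: (@le_lt_trans _ _ (pushforward (mrestr leb mpos) phi `](- n.+1%:R)%R, n.+1%:R]%classic)).
    exact: lexx.
  by rewrite pE ?ltry// gtrN.
Unshelve. exact: mphi.
Qed.
End subst.

Section prekopa.
Context {R : realType}.
Local Open Scope ereal_scope.
Notation leb := (@lebesgue_measure R).

(** By inner regularity it suffices to bound a compact part of [X]. Its largest element [a] lies in
    [X], and apart from this single point the part lies below [a]. A limit [a -> sup X] is thus
    replaced by a choice of points of [X]. *)
Lemma lebesgue_le_below (X : set R) (c : \bar R) : measurable X -> 0 <= c ->
  (forall a, X a -> leb (X `&` `]-oo, a[%classic) <= c) -> leb X <= c.
Proof.
move=> mX c0 Xc; rewrite lebesgue_regularity_inner_sup//.
apply: ge_ereal_sup => _ [K [cK KX] <-].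
have [->|K0] := eqVneq K set0; first by rewrite measure0.
have [a [/set_mem Ka aK]] := compact_EVT_max (f := id) ((set0P _).1 K0) cK
  (continuous_subspaceT (fun x => cvg_id)).
apply: le_trans (Xc a (KX _ Ka)).
apply: (@le_trans _ _ (leb ((X `&` `]-oo, a[%classic) `|` [set a]))).
  apply: le_measure; rewrite ?inE.
  - exact: compact_measurable.
  - by apply: measurableU => //; exact: measurableI.
  - move=> x Kx; have := aK _ (mem_set Kx); rewrite le_eqVlt => /predU1P[->|xa]; [by right|left].
    by split; [exact: KX|rewrite /= in_itv].
apply: (le_trans (measureU2 _ _ _)) => //; first exact: measurableI.
by have /= -> := lebesgue_measure_set1 a; rewrite adde0.
Qed.

Lemma lebesgue_le_above (X : set R) (c : \bar R) : measurable X -> 0 <= c ->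
  (forall a, X a -> leb (X `&` `]a, +oo[%classic) <= c) -> leb X <= c.
Proof.
move=> mX c0 Xc; rewrite -(lebesgue_measureN mX); apply: lebesgue_le_below => //.
  by rewrite -[X in measurable X]setTI; exact: oppr_measurable.
move=> a Xa; apply: le_trans (Xc _ Xa).
rewrite -[leRHS]lebesgue_measureN; last exact: measurableI.
rewrite /pushforward preimage_setI (_ : -%R @^-1` `](- a)%R, +oo[%classic = `]-oo, a[%classic)//.
by apply/seteqP; split => x /=; rewrite !in_itv/= andbT ltrN2.
Qed.

(** Brunn-Minkowski on the line. For [a] in [X] and [b] in [Y], the part of [X] below [a] shifted by
    [b] and the part of [Y] above [b] shifted by [a] lie in [Z], on opposite sides of [a + b]. The
    two preceding lemmas then remove the cuts. A measurable superset [Z] of the sumset avoids the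
    question whether the sumset is measurable. *)
Lemma lebesgue_minkowski (X Y Z : set R) : measurable X -> measurable Y ->
  measurable Z -> X !=set0 -> Y !=set0 ->
  (forall x y, X x -> Y y -> Z (x + y)%R) -> leb X + leb Y <= leb Z.
Proof.
move=> mX mY mZ X0 Y0 XYZ.
have [->|Zoo] := eqVneq (leb Z) +oo; first by rewrite leey.
have Zfin : leb Z \is a fin_num by rewrite ge0_fin_numE// ltey.
have key a b : X a -> Y b ->
    leb (X `&` `]-oo, a[%classic) + leb (Y `&` `]b, +oo[%classic) <= leb Z.
  move=> Xa Yb.
  set U := X `&` _; set V := Y `&` _.
  have mU : measurable U by exact: measurableI.
  have mV : measurable V by exact: measurableI.
  have [mD1 D1] := mpres_lebD (- b)%R; have [mD2 D2] := mpres_lebD (- a)%R.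
  rewrite (D1 U)// (D2 V)//.
  have mU' : measurable ((fun x => x - b)%R @^-1` U).
    by rewrite -[X in measurable X]setTI; exact: mD1.
  have mV' : measurable ((fun x => x - a)%R @^-1` V).
    by rewrite -[X in measurable X]setTI; exact: mD2.
  rewrite -measureU//; last first.
    rewrite -subset0 => x [] [_ /=]; rewrite in_itv/= => xa [_ /=]; rewrite in_itv/= andbT => xb.
    by lra.
  apply: le_measure; rewrite ?inE//; first exact: measurableU.
  move=> x [[Ux _]|[Vx _]].
    by have := XYZ _ _ Ux Yb; rewrite subrK.
  by have := XYZ _ _ Xa Vx; rewrite addrC subrK.
have leZ (A : set R) : measurable A -> leb A <= leb Z -> leb A \is a fin_num.
  by move=> mA AZ; rewrite ge0_fin_numE// (le_lt_trans AZ)// ltey.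
have YZ b : Y b -> leb X <= leb Z - leb (Y `&` `]b, +oo[%classic).
  move=> Yb; have [a0 Xa0] := X0.
  have fY : leb (Y `&` `]b, +oo[%classic) \is a fin_num.
    by apply: leZ; [exact: measurableI|apply: le_trans (key _ _ Xa0 Yb); rewrite leeDr].
  apply: lebesgue_le_below => // [|a Xa].
    by rewrite sube_ge0 ?fY// (le_trans _ (key _ _ Xa0 Yb))// leeDr.
  by rewrite leeBrDr// key.
have [b0 Yb0] := Y0.
have XZ : leb X <= leb Z.
  by apply: le_trans (YZ _ Yb0) _; rewrite -[leRHS]adde0 leeD2l// oppe_le0.
have fX : leb X \is a fin_num by exact: leZ.
rewrite addeC -leeBrDr//; apply: lebesgue_le_above => // [|b Yb].
  by rewrite sube_ge0 ?fX.
have fY : leb (Y `&` `]b, +oo[%classic) \is a fin_num.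
  have [a0 Xa0] := X0.
  by apply: leZ; [exact: measurableI|apply: le_trans (key _ _ Xa0 Yb); rewrite leeDr].
by rewrite leeBrDr// addeC -leeBrDr// YZ.
Qed.

Lemma measurable_layers_measure d (T : measurableType d)
    (mu : {sigma_finite_measure set T -> \bar R}) (c : R) (f : T -> \bar R) :
  measurable_fun setT f ->
  measurable_fun setT (fun t : R => mu [set x | ((0 < t)%R /\ (c * t)%:E < f x)%E]).
Proof.
move=> mf; have := measurable_fun_ysection mu (measurable_layers c mf).
apply: eq_measurable_fun => t _; congr (mu _).
by apply/seteqP; split=> x; rewrite /ysection/= inE.
Qed.

(* Prekopa-Leindler on the line: compare the layers of A, B and H at the
   proportional heights t sup A, t sup B and t sqrt (sup A * sup B). *)
Lemma prekopa_additive (A B : R -> R) (H : R -> \bar R) (M : R) :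
  measurable_fun setT A -> measurable_fun setT B -> measurable_fun setT H ->
  (forall x, 0 <= A x <= M)%R -> (forall x, 0 <= B x <= M)%R -> (forall x, 0 <= H x) ->
  (forall x y, (A x * B y)%:E <= H (x + y)%R ^+ 2) ->
  4%:R%:E * (\int[leb]_x (A x)%:E * \int[leb]_x (B x)%:E) <= (\int[leb]_x H x) ^+ 2.
Proof.
move=> mA mB mH A0 B0 H0 ABH.
pose a := sup (range A); pose b := sup (range B).
have hsup (F : R -> R) : (forall x, 0 <= F x <= M)%R ->
    (forall x, F x <= sup (range F))%R /\
    (forall y, y < sup (range F) -> exists x, y < F x)%R.
  move=> F0; have hs : has_sup (range F).
    split; first by exists (F 0%R); exists 0%R.
    by exists M => _ [x _ <-]; case/andP: (F0 x).
  split=> [x|y yF]; first by apply: sup_upper_bound => //; exists x.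
  by have [_ [x _ <-] yx] := sup_gt hs.1 yF; exists x.
have [Aa aA] := hsup A A0; have [Bb bB] := hsup B B0.
have fin0 (F : R -> R) : (forall x, 0 <= F x)%R -> (forall x, F x <= 0)%R ->
    \int[leb]_x (F x)%:E = 0.
  move=> F0 F1; rewrite (eq_integral (cst 0)) ?integral0// => x _.
  by congr EFin; apply/eqP; rewrite eq_le F0 F1.
have HH0 : 0 <= \int[leb]_x H x by exact: integral_ge0.
have A0' x : (0 <= A x)%R by have /andP[] := A0 x.
have B0' x : (0 <= B x)%R by have /andP[] := B0 x.
have [a0|a0] := leP a 0%R.
  rewrite (fin0 A) ?mul0e ?mule0 ?expe_ge0// => x; first exact: le_trans (Aa x) a0.
have [b0|b0] := leP b 0%R.
  rewrite (fin0 B) ?mule0 ?expe_ge0// => x; first exact: le_trans (Bb x) b0.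
have mAE : measurable_fun setT (EFin \o A) by exact/measurable_EFinP.
have mBE : measurable_fun setT (EFin \o B) by exact/measurable_EFinP.
pose c := Num.sqrt (a * b).
have c0 : (0 < c)%R by rewrite sqrtr_gt0 mulr_gt0.
have cc : (c * c = a * b)%R by rewrite -expr2 sqr_sqrtr// ltW// mulr_gt0.
rewrite (layer_cake leb a0 mAE)//.
rewrite (layer_cake leb b0 mBE)//.
rewrite (layer_cake leb c0 mH H0).
set P := \int[leb]_t _; set Q := \int[leb]_t _; set W := \int[leb]_t _.
have PQW : P + Q <= W.
  rewrite -ge0_integralD//; try exact: measurable_layers_measure.
  apply: ge0_le_integral => //; try exact: measurable_layers_measure.
  - by move=> t _; rewrite adde_ge0.
  - by apply: emeasurable_funD; exact: measurable_layers_measure.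
  move=> t _.
  (* Minkowski's inequality asks for nonempty sets. For [t] outside []0, 1[] the layers of [A] and
     [B] are empty and the left side is 0; for [t] inside, [a * t < a] and [b * t < b] make them
     nonempty. *)
  have empty (F : R -> R) (k : R) : (forall x, F x <= k)%R -> (0 < k)%R ->
      ((t <= 0) || (1 <= t))%R ->
      leb [set x | ((0 < t)%R /\ (k * t)%:E < (EFin \o F) x)%E] = 0.
    move=> Fk k0 t01; rewrite (_ : [set _ | _] = set0) ?measure0// -subset0 => x [].
    case/orP: t01 => t1 t0; first by move: (lt_le_trans t0 t1); rewrite ltxx.
    rewrite lte_fin => ktF; have : (k < k)%R.
      by apply: le_lt_trans (lt_le_trans ktF (Fk x)); rewrite ler_peMr// ltW.
    by rewrite ltxx.
  have [t01|] := boolP ((t <= 0) || (1 <= t))%R.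
    rewrite [X in X + _ <= _](_ : _ = 0); last exact: empty Aa a0 t01.
    by rewrite add0e [X in X <= _](_ : _ = 0); last exact: empty Bb b0 t01.
  rewrite negb_or -!ltNge => /andP[t0 t1].
  have mlayer (F : R -> \bar R) (k : R) : measurable_fun setT F ->
      measurable [set x | ((0 < t)%R /\ (k * t)%:E < F x)%E].
    move=> mF; have := measurable_ysection t (measurable_layers k mF).
    by congr measurable; apply/seteqP; split=> x; rewrite /ysection/= inE.
  apply: lebesgue_minkowski; try exact: mlayer.
  - by have [|x xt] := aA (a * t)%R; [rewrite gtr_pMr|exists x].
  - by have [|x xt] := bB (b * t)%R; [rewrite gtr_pMr|exists x].
  move=> x y [_ /= xt] [_ /= yt]; split => //.
  rewrite !lte_fin in xt yt.
  have ct0 : (0 <= c * t)%R by rewrite mulr_ge0// ltW.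
  (* If [H (x + y) <= c * t], then [A x * B y <= c^2 * t^2 = (a * t) * (b * t)], against the choice
     of [x] and [y]. *)
  rewrite ltNge; apply/negP => Hct.
  have : (A x * B y)%:E <= ((c * t) ^+ 2)%:E.
    by rewrite EFin_expe (le_trans (ABH x y))// !expe2 lee_pmul.
  rewrite lee_fin leNgt => /negP; apply.
  have -> : ((c * t) ^+ 2 = (a * t) * (b * t))%R.
    by rewrite exprMn expr2 cc; ring.
  by rewrite ltr_pM// ltW// mulr_gt0.
have P0 : 0 <= P by apply: integral_ge0.
have Q0 : 0 <= Q by apply: integral_ge0.
clearbody P Q W.
have [W_oo|Woo] := eqVneq W +oo.
  by rewrite W_oo mulry gtr0_sg// mul1e expe2 mulyy leey.
have W0 : 0 <= W by apply: le_trans PQW; exact: adde_ge0.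
have Wlt : W < +oo by rewrite ltey.
have Wf : W \is a fin_num by rewrite ge0_fin_numE.
have Pf : P \is a fin_num.
  by rewrite ge0_fin_numE// (le_lt_trans _ Wlt)// (le_trans _ PQW)// leeDl.
have Qf : Q \is a fin_num.
  by rewrite ge0_fin_numE// (le_lt_trans _ Wlt)// (le_trans _ PQW)// leeDr.
move: P0 Q0 PQW; rewrite -(fineK Pf) -(fineK Qf) -(fineK Wf).
rewrite -!EFinM -EFinD -EFin_expe !lee_fin exprMn [(c ^+ 2)%R]expr2 cc => P0 Q0 PQW.
(* From [P + Q <= W] the arithmetic-geometric mean inequality gives [4 * P * Q <= W ^ 2]; the scales
   match because [c ^ 2 = a * b]. *)
have := sqr_ge0 (fine P - fine Q); have ab0 : (0 < a * b)%R by exact: mulr_gt0.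
rewrite (_ : 4%:R * _ = (a * b) * (4%:R * fine P * fine Q))%R; last by ring.
rewrite ler_pM2l// => PQ; nra.
Qed.

(* Prekopa-Leindler in the variables s = exp p, t = exp q, which turn the
   geometric mean into the arithmetic one. *)
Lemma prekopa_geometric (a b : R -> R) (h : R -> \bar R) (M : R) :
  measurable_fun setT a -> measurable_fun setT b -> measurable_fun setT h ->
  (forall s, 0 <= a s <= M)%R -> (forall s, 0 <= b s <= M)%R ->
  (forall s, a s != 0 -> s <= M)%R -> (forall s, b s != 0 -> s <= M)%R ->
  (forall z, 0 <= h z) ->
  (forall s t, (0 < s)%R -> (0 < t)%R -> (a s * b t)%:E <= h (Num.sqrt (s * t)) ^+ 2) ->
  \int[leb]_(s in `]0%R, +oo[) (a s)%:E * \int[leb]_(t in `]0%R, +oo[) (b t)%:E <=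
  (\int[leb]_(z in `]0%R, +oo[) h z) ^+ 2.
Proof.
move=> ma mb mh a0 b0 aM bM h0 abh.
have M0 : (0 <= M)%R by have /andP[] := a0 0%R; exact: le_trans.
have me (l : R) : measurable_fun setT (fun p : R => expR (l * p)).
  by apply: measurableT_comp => //; exact: measurable_funM.
have mae (c : R -> R) : measurable_fun setT c ->
    measurable_fun setT (fun p : R => c (expR (1 * p)) * (1 * expR (1 * p)))%R.
  move=> mc; apply: measurable_funM; last exact: measurable_funM.
  exact: (measurableT_comp mc (me 1%R)).
(* The Jacobian [expR p] is unbounded, but [c (expR p)] vanishes once [expR p > M], which keeps the
   transformed functions bounded. *)
have ae (c : R -> R) : (forall s, 0 <= c s <= M)%R -> (forall s, c s != 0 -> s <= M)%R ->
    (forall p, 0 <= c (expR (1 * p)) * (1 * expR (1 * p)) <= M * M)%R.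
  move=> c0 cM p; rewrite !mul1r; have /andP[cp0 cpM] := c0 (expR p).
  rewrite mulr_ge0 ?expR_ge0//=.
  have [->|/cM pM] := eqVneq (c (expR p)) 0%R; first by rewrite mul0r mulr_ge0.
  by rewrite ler_pM// expR_ge0.
rewrite (subst_expR ltr01)//; [|exact/measurable_EFinP|by move=> x; rewrite lee_fin; case/andP: (a0 x)].
rewrite (subst_expR ltr01)//; [|exact/measurable_EFinP|by move=> x; rewrite lee_fin; case/andP: (b0 x)].
have l2 : (0 < 2^-1 :> R)%R by [].
rewrite (subst_expR l2 mh h0).
pose e2 (w : R) : R := expR (2^-1 * w).
have me2 : measurable_fun setT e2 by exact: me.
pose G w := h (e2 w) * (e2 w)%:E.
have mG : measurable_fun setT G.
  apply: emeasurable_funM; first exact: (measurableT_comp mh me2).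
  exact/measurable_EFinP.
have G0 w : 0 <= G w by rewrite mule_ge0// lee_fin expR_ge0.
rewrite (_ : integral _ _ (fun p => h _ * _) = 2^-1%:E * \int[leb]_w G w); last first.
  rewrite -ge0_integralZl//; apply: eq_integral => w _.
  by rewrite /G muleCA -EFinM.
have := @prekopa_additive _ _ G (M * M) (mae a ma) (mae b mb) mG (ae a a0 aM) (ae b b0 bM) G0.
have key x y : (a (expR (1 * x)) * (1 * expR (1 * x)) *
    (b (expR (1 * y)) * (1 * expR (1 * y))))%:E <= G (x + y)%R ^+ 2.
  have e0 : (0 <= expR x * expR y)%R by rewrite mulr_ge0// expR_ge0.
  have e2E : (Num.sqrt (expR x * expR y) = e2 (x + y))%R.
    rewrite -expRD /e2 -[RHS]ger0_norm ?expR_ge0// -sqrtr_sqr; congr Num.sqrt.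
    by rewrite -expRM_natl mulrA mulfV// mul1r.
  have := abh _ _ (expR_gt0 x) (expR_gt0 y); rewrite e2E => ab.
  rewrite /G !mul1r expe2 muleACA -!expe2 -EFin_expe -e2E sqr_sqrtr// e2E.
  rewrite [X in X%:E](_ : _ = a (expR x) * b (expR y) * (expR x * expR y))%R; last by ring.
  by rewrite EFinM lee_wpmul2r// lee_fin.
move=> /(_ key).
set IA := integral _ _ _; set IB := integral _ _ _; set IG := integral _ _ _ => IAB.
rewrite expe2 muleACA -EFinM -expe2.
(* For [z = expR (w / 2)] one has [dz = z dw / 2]; the square of this 1/2 cancels the 4 of
   [prekopa_additive]. *)
rewrite (_ : 2^-1 * 2^-1 = 4^-1)%R; last by field.
have := @lee_wpmul2l _ (4^-1)%:E _ _ _ IAB.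
rewrite muleA -EFinM mulVf// mul1e; apply.
by rewrite lee_fin.
Qed.
End prekopa.

(** * The half-space inequality *)

Section spaces.
Context {R : realType}.
Notation leb := (@lebesgue_measure R).

Notation P m := (measurableTypeR R * 'rV[R]_m)%type.
Notation Q m := (measurableTypeR R * (measurableTypeR R * 'rV[R]_m))%type.

Lemma product_sigma_finite d1 d2 (T1 : measurableType d1) (T2 : measurableType d2)
    (m1 : {sigma_finite_measure set T1 -> \bar R})
    (m2 : {sigma_finite_measure set T2 -> \bar R}) : sigma_finite setT (m1 \x m2)%E.
Proof.
have /sigma_finiteP[F [TF ndF Foo]] := sigma_finiteT m1.
have /sigma_finiteP[G [TG ndG Goo]] := sigma_finiteT m2.
exists (fun n => F n `*` G n).
  apply/seteqP; split=> // -[x y] _.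
  have [i _ Fi] : (\bigcup_i F i) x by rewrite -TF.
  have [j _ Gj] : (\bigcup_i G i) y by rewrite -TG.
  exists (maxn i j) => //; split.
    by move: Fi; exact/subsetPset/ndF/leq_maxl.
  by move: Gj; exact/subsetPset/ndG/leq_maxr.
move=> k; have [mF Fk] := Foo k; have [mG Gk] := Goo k.
split; first exact: measurableX.
by rewrite product_measure1E// lte_mul_pinfty// ge0_fin_numE.
Qed.

(** Named, so that the sigma-finite structure declared next is found when the product is itself a
    factor. *)
Definition muP m : set (P m) -> \bar R := (leb \x lebesgue_rV R m)%E.
Arguments muP m _ : clear implicits.
HB.instance Definition _ m := Measure.on (muP m).
HB.instance Definition _ m := Measure_isSigmaFinite.Build _ _ _ (muP m)
  (product_sigma_finite leb (lebesgue_rV R m)).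

Definition muQ m : set (Q m) -> \bar R := (leb \x muP m)%E.
Arguments muQ m _ : clear implicits.
HB.instance Definition _ m := Measure.on (muQ m).
HB.instance Definition _ m := Measure_isSigmaFinite.Build _ _ _ (muQ m)
  (product_sigma_finite leb (muP m)).

Lemma tonelliP m (K : P m -> \bar R) : measurable_fun setT K -> (forall p, (0 <= K p)%E) ->
  (\int[muP m]_p K p = \int[leb]_r \int[lebesgue_rV R m]_x K (r, x))%E.
Proof. by move=> mK K0; rewrite fubini_tonelli1. Qed.

Lemma measurable_slab m :
  measurable_fun setT (fun t : P m * measurableTypeR R => (t.1.1, (t.2, t.1.2)) : Q m).
Proof.
apply/measurable_fun_pairP; split; first exact: measurableT_comp measurable_fst measurable_fst.
apply/measurable_fun_pairP; split; first exact: measurable_snd.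
exact: measurableT_comp measurable_snd measurable_fst.
Qed.

Lemma measurable_slice m d (T : measurableType d) (K : Q m -> T) (p : P m) :
  measurable_fun setT K -> measurable_fun setT (fun s : measurableTypeR R => K (p.1, (s, p.2))).
Proof.
move=> mK.
exact: (measurableT_comp mK (measurableT_comp (@measurable_slab m) (pair1_measurable p))).
Qed.

Lemma measurable_slice_integral m (K : Q m -> \bar R) :
  measurable_fun setT K -> (forall q, (0 <= K q)%E) ->
  measurable_fun setT (fun p : P m => \int[leb]_s K (p.1, (s, p.2)))%E.
Proof.
move=> mK K0.
exact: (measurable_fun_fubini_tonelli_F (m2 := leb) _
  (measurableT_comp mK (@measurable_slab m)) (fun t => K0 _)).
Qed.

(** The middle coordinate [s] is integrated innermost, since it is the one that the induction
    eliminates. *)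
Lemma tonelliQ m (K : Q m -> \bar R) : measurable_fun setT K -> (forall q, (0 <= K q)%E) ->
  (\int[muQ m]_q K q = \int[muP m]_p \int[leb]_s K (p.1, (s, p.2)))%E.
Proof.
move=> mK K0; rewrite /muQ fubini_tonelli1//.
transitivity (\int[leb]_r \int[lebesgue_rV R m]_x \int[leb]_s K (r, (s, x)))%E; last first.
  apply/esym.
  apply: (@tonelliP m (fun p => \int[leb]_s K (p.1, (s, p.2)))%E).
    exact: measurable_slice_integral.
  by move=> p; exact: integral_ge0.
apply: eq_integral => r _; rewrite /fubini_F/= fubini_tonelli2//.
exact: (measurableT_comp mK (pair1_measurable r)).
Qed.

Lemma tonelliP0 (K : P 0 -> \bar R) : measurable_fun setT K -> (forall p, (0 <= K p)%E) ->
  (\int[muP 0]_p K p = \int[leb]_r K (r, (0%R : 'rV[R]_0)))%E.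
Proof.
move=> mK K0; rewrite tonelliP//; apply: eq_integral => r _.
rewrite /= integral_dirac// ?diracT ?mul1e//.
exact: (measurableT_comp mK (pair1_measurable r)).
Qed.

Definition consQ m (q : Q m) : P m.+1 := (q.1, cons_rV q.2).

Lemma mpres_consQ m : mpres (muQ m) (muP m.+1) (@consQ m).
Proof.
apply: (@mpres_fiber1 _ _ _ _ _ _ _ leb (muP m) (lebesgue_rV R m.+1) (fun _ => @cons_rV R m)).
  apply/measurable_fun_pairP; split; first exact: measurable_fst.
  exact: measurableT_comp (@measurable_cons_rV R m) measurable_snd.
by move=> _; exact: mpres_cons.
Qed.

Definition reflQ m (q : Q m) : Q m := (q.1, (- q.2.1, q.2.2)).

Lemma measurable_Q3 m d (T : measurableType d) (a b : T -> R) (c : T -> 'rV[R]_m) :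
  measurable_fun setT a -> measurable_fun setT b -> measurable_fun setT c ->
  measurable_fun setT (fun t => (a t, (b t, c t)) : Q m).
Proof.
move=> ma mb mc; apply/measurable_fun_pairP; split => //.
exact/measurable_fun_pairP.
Qed.

Lemma measurableQ1 m : measurable_fun setT (fun q : Q m => q.1 : R).
Proof. exact: measurable_fst. Qed.

Lemma measurableQ2 m : measurable_fun setT (fun q : Q m => q.2.1 : R).
Proof. exact: measurableT_comp measurable_fst measurable_snd. Qed.

Lemma measurableQ3 m : measurable_fun setT (fun q : Q m => q.2.2).
Proof. exact: measurableT_comp measurable_snd measurable_snd. Qed.

Lemma measurableQ3j m j : measurable_fun setT (fun q : Q m => q.2.2 0 j : R).
Proof. exact: measurableT_comp (measurable_rV_coord j) (@measurableQ3 m). Qed.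

Lemma measurable_rVD m d (T : measurableType d) (a b : T -> 'rV[R]_m) :
  measurable_fun setT a -> measurable_fun setT b ->
  measurable_fun setT (fun t => a t + b t).
Proof.
move=> ma mb; apply: measurable_fun_rV => i.
rewrite (_ : (fun _ => _) = fun t => a t 0 i + b t 0 i); last first.
  by apply/funext => t; rewrite mxE.
by apply: measurable_funD; exact: measurableT_comp (measurable_rV_coord i) _.
Qed.

Lemma measurable_rVZ m d (T : measurableType d) (a : T -> R) (b : 'rV[R]_m) :
  measurable_fun setT a -> measurable_fun setT (fun t => a t *: b).
Proof.
move=> ma; apply: measurable_fun_rV => i.
rewrite (_ : (fun _ => _) = fun t => a t * b 0 i); last first.
  by apply/funext => t; rewrite mxE.
exact: measurable_funM.
Qed.

Lemma mpres_reflQ m : mpres (muQ m) (muQ m) (@reflQ m).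
Proof.
pose t (p : P m) : P m := (- p.1, p.2).
have mt : measurable_fun setT t.
  apply/measurable_fun_pairP; split; last exact: measurable_snd.
  by apply: measurable_funN; exact: measurable_fst.
apply: (@mpres_fiber1 _ _ _ _ _ _ _ leb (muP m) (muP m) (fun _ => t)).
  apply: measurable_Q3; [exact: measurableQ1| |exact: measurableQ3].
  by apply: measurable_funN; exact: measurableQ2.
move=> _.
apply: (@mpres_fiber2 _ _ _ _ _ _ _ (lebesgue_rV R m) leb leb (fun _ => -%R)) => // _.
exact: mpres_lebN.
Qed.

(* [shearT] and [shearU] are mutually contragredient, see [bilQ_shear]. *)
Definition shearT m c (al v : 'rV[R]_m) (q : Q m) : Q m :=
  (q.1, (q.2.1 + c * q.1, q.2.2 + (q.1 *: al + q.2.1 *: v))).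

Definition shearU m c (al v : 'rV[R]_m) (q : Q m) : Q m :=
  (q.1 - (dotv al q.2.2 + c * (q.2.1 - dotv v q.2.2)),
   (q.2.1 - dotv v q.2.2, q.2.2)).

Definition bilP m (p q : P m) : R := p.1 * q.1 + dotv p.2 q.2.
Definition bilQ m (p q : Q m) : R := p.1 * q.1 + (p.2.1 * q.2.1 + dotv p.2.2 q.2.2).

Lemma bilP_consQ m (p q : Q m) : bilP (consQ p) (consQ q) = bilQ p q.
Proof. by rewrite /bilP dotv_cons. Qed.

Lemma bilQ_shear m c al v (p q : Q m) :
  bilQ (shearU c al v p) (shearT c al v q) = bilQ p q.
Proof.
case: p => r [s x]; case: q => a [b y]; rewrite /bilQ/= !dotvDr !dotvZr.
by rewrite !(dotvC al) !(dotvC v); ring.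
Qed.

Lemma bilQ_refl m (p q : Q m) : bilQ (reflQ p) (reflQ q) = bilQ p q.
Proof. by rewrite /bilQ/= mulrNN. Qed.

(** A translation of [x] on the fibres over [(r, s)], followed by a translation of [s] on the fibres
    over [(r, x)]. The order matters: [x] moves by a multiple of the old [s]. *)
Lemma mpres_shearT m c al v : mpres (muQ m) (muQ m) (@shearT m c al v).
Proof.
pose t1 (r : measurableTypeR R) (p : P m) : P m := (p.1, p.2 + (r *: al + p.1 *: v)).
pose t2 (r : measurableTypeR R) (p : P m) : P m := (p.1 + c * r, p.2).
have mp1 : measurable_fun setT (fun p : P m => p.1 : R) by exact: measurable_fst.
have mp2 : measurable_fun setT (fun p : P m => p.2) by exact: measurable_snd.
have m1 r : measurable_fun setT (t1 r).
  apply/measurable_fun_pairP; split => //; apply: measurable_rVD => //.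
  by apply: measurable_rVD; apply: measurable_rVZ.
have m2 r : measurable_fun setT (t2 r).
  by apply/measurable_fun_pairP; split => //; apply: measurable_funD.
apply: (@mpres_fiber1 _ _ _ _ _ _ _ leb (muP m) (muP m) (fun r p => t2 r (t1 r p))).
  apply: measurable_Q3; first exact: measurableQ1.
    apply: measurable_funD; first exact: measurableQ2.
    by apply: measurable_funM => //; exact: measurableQ1.
  apply: measurable_rVD; first exact: measurableQ3.
  by apply: measurable_rVD; apply: measurable_rVZ; [exact: measurableQ1|exact: measurableQ2].
move=> r.
apply: (@mpres_comp _ _ _ _ _ _ _ _ (muP m) _ (t2 r) (t1 r)).
  apply: (@mpres_fiber1 _ _ _ _ _ _ _ leb (lebesgue_rV R m) (lebesgue_rV R m)
    (fun s x => x + (r *: al + s *: v)) (m1 r)).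
  by move=> s; exact: mpres_rVD.
apply: (@mpres_fiber2 _ _ _ _ _ _ _ (lebesgue_rV R m) leb leb (fun _ s => s + c * r) (m2 r)).
by move=> s; exact: mpres_lebD.
Qed.

(** Here [s] is translated first, because the shift of [r] involves the new [s]. *)
Lemma mpres_shearU m c al v : mpres (muQ m) (muQ m) (@shearU m c al v).
Proof.
pose t1 (p : P m) : P m := (p.1 - dotv v p.2, p.2).
pose T1 (q : Q m) : Q m := (q.1, t1 q.2).
pose T2 (q : Q m) : Q m := (q.1 - (dotv al q.2.2 + c * q.2.1), q.2).
have mp1 : measurable_fun setT (fun p : P m => p.1 : R) by exact: measurable_fst.
have mp2 : measurable_fun setT (fun p : P m => p.2) by exact: measurable_snd.
have m1 : measurable_fun setT t1.
  apply/measurable_fun_pairP; split => //; apply: measurable_funB => //.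
  exact: measurable_dotv.
apply: (@mpres_comp _ _ _ _ _ _ _ _ (muQ m) _ T2 T1).
  apply: (@mpres_fiber1 _ _ _ _ _ _ _ leb (muP m) (muP m) (fun _ => t1)).
    apply/measurable_fun_pairP; split; first exact: measurableQ1.
    exact: measurableT_comp m1 measurable_snd.
  move=> _.
  apply: (@mpres_fiber2 _ _ _ _ _ _ _ (lebesgue_rV R m) leb leb (fun x s => s - dotv v x) m1).
  by move=> s; exact: mpres_lebD.
apply: (@mpres_fiber2 _ _ _ _ _ _ _ (muP m) leb leb (fun e r => r - (dotv al e.2 + c * e.1))).
  apply/measurable_fun_pairP; split; last exact: measurable_snd.
  apply: measurable_funB; first exact: measurableQ1.
  apply: measurable_funD; first by apply: measurable_dotv => //; exact: measurableQ3.
  by apply: measurable_funM => //; exact: measurableQ2.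
by move=> e; exact: mpres_lebD.
Qed.

End spaces.
Arguments muP {R} m _.
Arguments muQ {R} m _.

(** * Marginals, and the statement proved by induction *)

Section marginals.
Context {R : realType}.
Notation leb := (@lebesgue_measure R).
Notation P m := (measurableTypeR R * 'rV[R]_m)%type.
Notation Q m := (measurableTypeR R * (measurableTypeR R * 'rV[R]_m))%type.

(* A point is a pair [(r, x)], or a triple [(r, (s, x))] when the coordinate [s]
   is about to be integrated out; [r] is the coordinate along [u], and only
   the half-space [r > 0] carries mass. *)
Definition niceP m (f : P m -> R) := [/\ measurable_fun setT f, forall p, 0 <= f p &
  exists B, forall p, f p <= B /\
    (f p != 0 -> 0 < p.1 <= B /\ forall i, `|p.2 0 i| <= B)].

Definition niceQ m (f : Q m -> R) := [/\ measurable_fun setT f, forall p, 0 <= f p &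
  exists B, forall q, f q <= B /\
    (f q != 0 -> [/\ 0 < q.1 <= B, `|q.2.1| <= B & forall i, `|q.2.2 0 i| <= B])].

Lemma niceQ_consQ m (f : P m.+1 -> R) : niceP f -> niceQ (f \o @consQ R m).
Proof.
move=> [mf f0 [B fB]]; split.
- exact: (measurableT_comp mf (mpres_consQ m).1).
- by move=> q; exact: f0.
exists B => q; have [fB1 fB2] := fB (consQ q); split=> // /fB2[qB xB]; split => //.
  by have := xB 0; rewrite cons_rV0.
by move=> i; have := xB (lift ord0 i); rewrite cons_rVS.
Qed.

(** On nice functions [fine] loses nothing, see [margE]. *)
Definition marg m (k : Q m -> R) (p : P m) : R :=
  fine (\int[leb]_s (k (p.1, (s, p.2)))%:E).

Lemma slice_bound m (k : Q m -> R) B : measurable_fun setT k -> (forall q, 0 <= k q) ->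
  (forall q, k q <= B /\ (k q != 0 -> `|q.2.1| <= B)) ->
  forall p : P m, (\int[leb]_s (k (p.1, (s, p.2)))%:E <= (B * (B + B))%:E)%E.
Proof.
move=> mk k0 kB p.
have B0 : 0 <= B by have [] := kB (0, (0, 0)); move=> /(le_trans (k0 _)).
have mI : measurable (`[- B, B]%classic : set (measurableTypeR R)) by exact: measurable_itv.
have -> : (B * (B + B))%:E = (\int[leb]_s (B%:E * (\1_(`[- B, B]%classic) s)%:E))%E.
  rewrite ge0_integralZl_EFin//; last first.
    by apply/measurable_EFinP; exact: measurable_indic.
  rewrite integral_indic// setIT; have /= -> := lebesgue_measure_itv `[- B, B]; rewrite lte_fin.
  case: ltP => [_|B0']; first by rewrite -EFinD -EFinM opprK.
  have -> : B = 0 by lra.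
  by rewrite mul0r mul0e.
apply: ge0_le_integral => //.
- by move=> s _; rewrite lee_fin.
- by apply/measurable_EFinP; exact: (measurable_slice p mk).
- by apply/measurable_EFinP; apply: measurable_funM => //; exact: measurable_indic.
move=> s _; rewrite -EFinM lee_fin indicE.
have [kB1 kB2] := kB (p.1, (s, p.2)).
have [->|/kB2 /= sB] := eqVneq (k (p.1, (s, p.2))) 0; first by rewrite mulr_ge0.
by rewrite mem_set ?mulr1//= in_itv/= -ler_norml.
Qed.

Lemma margE m (k : Q m -> R) (p : P m) : niceQ k ->
  ((marg k p)%:E = \int[leb]_s (k (p.1, (s, p.2)))%:E)%E.
Proof.
move=> [mk k0 [B kB]]; rewrite fineK// ge0_fin_numE; last first.
  by apply: integral_ge0 => s _; rewrite lee_fin.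
apply: le_lt_trans (slice_bound mk k0 (B := B) _ p) (ltry _) => q.
by have [? kq] := kB q; split=> // /kq[].
Qed.

Lemma niceP_marg m (k : Q m -> R) : niceQ k -> niceP (marg k).
Proof.
move=> nk; have [mk k0 [B kB]] := nk.
have m0 p : 0 <= marg k p.
  by rewrite -lee_fin margE//; apply: integral_ge0 => s _; rewrite lee_fin.
have B0 : 0 <= B by have [] := kB (0, (0, 0)); move=> /(le_trans (k0 _)).
split => //.
  apply/measurable_EFinP; rewrite (_ : _ \o _ = fun p => \int[leb]_s (k (p.1, (s, p.2)))%:E)%E.
    apply: (measurable_slice_integral (K := EFin \o k)); first exact/measurable_EFinP.
    by move=> q; rewrite lee_fin.
  by apply/funext => p; rewrite /= margE.
exists (B + B * (B + B)) => p; split.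
  rewrite -lee_fin margE// (le_trans (slice_bound mk k0 (B := B) _ p))//.
    by move=> q; have [? kq] := kB q; split=> // /kq[].
  by rewrite lee_fin lerDr.
move=> kp; have : ~ forall s, k (p.1, (s, p.2)) = 0.
  move=> ks; move: kp; rewrite /marg (eq_integral (cst 0%E)) ?integral0 ?eqxx//.
  by move=> s _; rewrite ks.
move=> /existsNP[s /eqP /(kB _).2 /= [/andP[p0 pB] _ xB]].
have BB : B <= B + B * (B + B) by rewrite lerDl mulr_ge0// addr_ge0.
by split=> [|i]; [rewrite p0/= (le_trans pB)|exact: le_trans (xB i) BB].
Qed.

Lemma marg_weight m (k : Q m -> R) (w : P m -> R) : niceQ k ->
  measurable_fun setT w -> (forall p, 0 <= w p) ->
  (\int[muP m]_p (marg k p * w p)%:E = \int[muQ m]_q (k q * w (q.1, q.2.2))%:E)%E.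
Proof.
move=> nk mw w0; have [mk k0 _] := nk.
have mwQ : measurable_fun setT (fun q : Q m => w (q.1, q.2.2)).
  apply: (measurableT_comp mw); apply/measurable_fun_pairP.
  by split; [exact: measurableQ1|exact: measurableQ3].
rewrite (tonelliQ (K := fun q => (k q * w (q.1, q.2.2))%:E)); last 2 first.
- by apply/measurable_EFinP; exact: measurable_funM.
- by move=> q; rewrite lee_fin mulr_ge0.
apply: eq_integral => p _ /=; rewrite -surjective_pairing EFinM margE//.
rewrite -ge0_integralZr//.
- by apply/measurable_EFinP; exact: measurable_slice mk.
- by move=> s _; rewrite lee_fin.
- by rewrite lee_fin.
Qed.

Definition posQ m (k : Q m -> R) (q : Q m) : R := k q * (0 < q.2.1)%R%:R.

Lemma measurable_pos : measurable_fun setT (fun s : R => ((0 < s)%R%:R : R)).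
Proof.
rewrite (_ : (fun _ => _) = \1_(`]0, +oo[%classic : set R)).
  by apply: measurable_indic; exact: measurable_itv.
by apply/funext => s; rewrite indicE mem_setE in_itv/= andbT.
Qed.

Lemma integral_pos (h : R -> \bar R) : measurable_fun setT h ->
  (\int[leb]_(z in `]0%R, +oo[) h z = \int[leb]_z (h z * ((0 < z)%R%:R)%:E))%E.
Proof.
move=> mh; rewrite integral_mkcond; apply: eq_integral => z _.
by rewrite patchE mem_setE in_itv/= andbT; case: (0 < z); rewrite ?mule1 ?mule0.
Qed.

Lemma niceQ_posQ m (k : Q m -> R) : niceQ k -> niceQ (posQ k).
Proof.
move=> [mk k0 [B kB]]; split.
- apply: measurable_funM => //.
  exact: (measurableT_comp measurable_pos (@measurableQ2 R m)).
- by move=> q; rewrite mulr_ge0.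
exists B => q; have [kB1 kB2] := kB q; split.
  by apply: le_trans kB1; rewrite ler_piMr// lern1 leq_b1.
by rewrite mulf_eq0 negb_or => /andP[/kB2].
Qed.

Definition m2P m (f : P m -> R) : \bar R := (\int[muP m]_p (f p * p.1 ^+ 2)%:E)%E.

Definition JP m (Om : R -> \bar R) : \bar R :=
  (\int[muP m]_p (Om (bilP p p) * ((Num.max p.1 0) ^+ 2)%:E))%E.

(* [f] integrates every [r * x_j] to [0], stated without subtraction. *)
Definition centeredP m (f : P m -> R) := forall j,
  (\int[muP m]_p (f p * (Num.max p.1 0 * Num.max (p.2 0 j) 0))%:E =
   \int[muP m]_p (f p * (Num.max p.1 0 * Num.max (- p.2 0 j) 0))%:E)%E.

(** [Om] is extended-valued because the induction replaces it by an integral over a half line, which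
    may be infinite. Centering is asked of one function only and everything else is symmetric, which
    permits the exchange of roles. *)
Definition santalo m := forall (f g : P m -> R) (Om : R -> \bar R),
  niceP f -> niceP g -> centeredP f ->
  measurable_fun setT Om -> (forall t, 0 <= Om t)%E ->
  (forall p q, 0 < bilP p q -> ((f p * g q)%:E <= Om (bilP p q) ^+ 2)%E) ->
  (m2P f * m2P g <= JP m Om ^+ 2)%E.

Lemma measurable_bilQ m : measurable_fun setT (fun q : Q m => bilQ q q).
Proof.
apply: measurable_funD; first by apply: measurable_funM; exact: measurableQ1.
apply: measurable_funD; first by apply: measurable_funM; exact: measurableQ2.
by apply: measurable_dotv; exact: measurableQ3.
Qed.

Lemma measurable_max0 : measurable_fun setT (fun s : R => Num.max s 0 ^+ 2).
Proof. by apply: measurable_funX; exact: measurable_maxr. Qed.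

End marginals.

Section half.
Context {R : realType}.
Notation leb := (@lebesgue_measure R).
Notation P m := (measurableTypeR R * 'rV[R]_m)%type.
Notation Q m := (measurableTypeR R * (measurableTypeR R * 'rV[R]_m))%type.

Lemma measurable_posE : measurable_fun setT (fun s : R => (((0 < s)%R%:R : R)%:E)).
Proof. by apply/measurable_EFinP; exact: measurable_pos. Qed.

(** The weights are absorbed into the functions: [s ^ 2 * t ^ 2] is the square of [z ^ 2] at
    [z = Num.sqrt (s * t)], so what [prekopa_geometric] asks for follows from the bound on [f] and
    [g]. *)
Lemma santalo0 : @santalo R 0.
Proof.
move=> f g Om [mf f0 [B fB]] [mg g0 [C gC]] _ mOm Om0 fgOm.
have B0 : 0 <= B by have [+ _] := fB (0, 0); exact: le_trans.
have C0 : 0 <= C by have [+ _] := gC (0, 0); exact: le_trans.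
pose D := B + C.
have BD : B <= D by rewrite lerDl.
have CD : C <= D by rewrite lerDr.
have D0 : 0 <= D by exact: addr_ge0.
have sec (k : P 0 -> R) : measurable_fun setT k ->
    measurable_fun setT (fun s : R => k (s, 0)).
  by move=> mk; exact: (measurableT_comp mk (pair2_measurable _)).
have m2E (k : P 0 -> R) : measurable_fun setT k -> (forall p, 0 <= k p) ->
    (forall p, k p != 0 -> 0 < p.1) ->
    (m2P k = \int[leb]_(s in `]0%R, +oo[) (k (s, 0) * s ^+ 2)%:E)%E.
  move=> mk k0 kpos; rewrite /m2P tonelliP0//=; last 2 first.
  - apply/measurable_EFinP; apply: measurable_funM => //.
    by apply: measurable_funX; exact: measurable_fst.
  - by move=> p; rewrite lee_fin mulr_ge0// sqr_ge0.
  rewrite integral_pos; last first.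
    by apply/measurable_EFinP; apply: measurable_funM; [exact: sec|exact: measurable_funX].
  apply: eq_integral => s _; rewrite -EFinM; congr EFin.
  have [->|/kpos /= ->] := eqVneq (k (s, 0)) 0; first by rewrite !mul0r.
  by rewrite mulr1.
rewrite !m2E//; [|by move=> p /(gC _).2[/andP[]]|by move=> p /(fB _).2[/andP[]]].
pose h (z : R) := (Om (z ^+ 2)%R * (z ^+ 2)%:E)%E.
have mh : measurable_fun setT h.
  apply: emeasurable_funM; last by apply/measurable_EFinP; exact: measurable_funX.
  by apply: (measurableT_comp mOm); exact: measurable_funX.
have h0 z : (0 <= h z)%E by rewrite mule_ge0// lee_fin sqr_ge0.
have -> : (@JP R 0 Om = \int[leb]_(z in `]0%R, +oo[) h z)%E.
  rewrite /JP.
  rewrite tonelliP0; last 2 first.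
  - apply: emeasurable_funM.
      apply: (measurableT_comp mOm); apply: measurable_funD.
        by apply: measurable_funM; exact: measurable_fst.
      by apply: measurable_dotv; exact: measurable_snd.
    apply/measurable_EFinP; apply: (measurableT_comp (@measurable_max0 R)).
    exact: measurable_fst.
  - by move=> p; rewrite mule_ge0// lee_fin sqr_ge0.
  rewrite integral_pos//; apply: eq_integral => z _.
  rewrite /h /bilP/= /dotv big_ord0 addr0 -expr2.
  case: ltP => z0; last by rewrite expr0n/= !mule0.
  by rewrite mule1.
have M0 : 0 <= D * D ^+ 2 by rewrite mulr_ge0// sqr_ge0.
(* One constant has to bound both the values, by [D * D ^ 2], and the support, by [D]; the sum
   does. *)
have bnd (k : P 0 -> R) : (forall p, 0 <= k p) ->
    (forall p, k p <= D /\ (k p != 0 -> 0 < p.1 <= D)) ->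
    (forall s, 0 <= k (s, 0) * s ^+ 2 <= D + D * D ^+ 2) /\
    (forall s, k (s, 0) * s ^+ 2 != 0 -> s <= D + D * D ^+ 2).
  move=> k0 kD; split=> s; last first.
    rewrite mulf_eq0 negb_or => /andP[/(kD _).2/= /andP[_ sD] _].
    by rewrite (le_trans sD)// lerDl.
  rewrite mulr_ge0 ?sqr_ge0//=; have [kD1 kD2] := kD (s, 0).
  have [->|/kD2/= /andP[s0 sD]] := eqVneq (k (s, 0)) 0; first by rewrite mul0r addr_ge0.
  rewrite (@le_trans _ _ (D * D ^+ 2)) ?lerDr// ler_pM ?sqr_ge0//.
  by rewrite lerXn2r ?nnegrE// ltW.
have [fb fs] := bnd f f0 (fun p => conj (le_trans (fB p).1 BD)
  (fun fp => let: conj pB _ := (fB p).2 fp in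
     let: conj p1 p2 := andP pB in introT andP (conj p1 (le_trans p2 BD)))).
have [gb gs] := bnd g g0 (fun p => conj (le_trans (gC p).1 CD)
  (fun fp => let: conj pB _ := (gC p).2 fp in
     let: conj p1 p2 := andP pB in introT andP (conj p1 (le_trans p2 CD)))).
apply: (@prekopa_geometric _ _ _ _ (D + D * D ^+ 2)) => //.
- by apply: measurable_funM; [exact: sec|exact: measurable_funX].
- by apply: measurable_funM; [exact: sec|exact: measurable_funX].
move=> s t s0 t0; rewrite /h sqr_sqrtr; last by rewrite mulr_ge0// ltW.
have bst : bilP (s, 0 : 'rV[R]_0) (t, 0 : 'rV[R]_0) = s * t.
  by rewrite /bilP/= /dotv big_ord0 addr0.
have := fgOm (s, 0) (t, 0); rewrite bst => /(_ (mulr_gt0 s0 t0)) fgst.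
rewrite expe2 muleACA -!expe2 -EFin_expe.
rewrite (_ : _ * _ * (_ * _) = f (s, 0) * g (t, 0) * (s * t) ^+ 2); last by ring.
by rewrite EFinM lee_wpmul2r// lee_fin sqr_ge0.
Qed.

(* One coordinate, restricted to a half line, is integrated out: there the
   pairing is [bilP p q + s t] with [s t > 0], so the one-dimensional
   inequality applies to the marginals, with [Om1] as the new bound. *)
Lemma half_step m (f g : Q m -> R) (Om : R -> \bar R) : @santalo R m ->
  niceQ f -> niceQ g -> centeredP (marg (posQ g)) ->
  measurable_fun setT Om -> (forall t, 0 <= Om t)%E ->
  (forall p q, 0 < bilQ p q -> ((f p * g q)%:E <= Om (bilQ p q) ^+ 2)%E) ->
  ((\int[muQ m]_q (posQ f q * q.1 ^+ 2)%:E) * (\int[muQ m]_q (posQ g q * q.1 ^+ 2)%:E) <=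
   (\int[muQ m]_q (Om (bilQ q q) * ((Num.max q.1 0) ^+ 2)%:E * ((0 < q.2.1)%R%:R)%:E)) ^+ 2)%E.
Proof.
move=> IH nf ng cg mOm Om0 fgOm.
(* On the diagonal [bilQ q q = bilP p p + s ^ 2], so integrating [K] in its second variable turns
   the integral of [Om] over [s > 0] into a diagonal integral of [Om1]. *)
pose K (t z : R) : \bar R := (Om (t + z ^+ 2)%R * ((0 < z)%R%:R)%:E)%E.
have K0 t z : (0 <= K t z)%E by rewrite mule_ge0// lee_fin.
have mK : measurable_fun setT (fun p : R * R => K p.1 p.2).
  apply: emeasurable_funM; last first.
    by apply: (measurableT_comp (@measurable_posE)); exact: measurable_snd.
  apply: (measurableT_comp mOm); apply: measurable_funD; first exact: measurable_fst.
  by apply: measurable_funX; exact: measurable_snd.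
pose Om1 t := (\int[leb]_z K t z)%E.
have mOm1 : measurable_fun setT Om1.
  exact: (measurable_fun_fubini_tonelli_F (m2 := leb) _ mK (fun t => K0 _ _)).
have Om10 t : (0 <= Om1 t)%E by exact: integral_ge0.
have [npf npg] := (niceQ_posQ nf, niceQ_posQ ng).
have m2E (k : Q m -> R) : niceQ k ->
    (\int[muQ m]_q (k q * q.1 ^+ 2)%:E = m2P (marg k))%E.
  move=> nk; rewrite /m2P (marg_weight (w := fun p => p.1 ^+ 2))//.
    by apply: measurable_funX; exact: measurable_fst.
  by move=> p; exact: sqr_ge0.
have -> : (\int[muQ m]_q (Om (bilQ q q) * ((Num.max q.1 0) ^+ 2)%:E * ((0 < q.2.1)%R%:R)%:E) = JP m Om1)%E.
  rewrite tonelliQ; last 2 first.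
  - apply: emeasurable_funM; last exact: (measurableT_comp measurable_posE (@measurableQ2 R m)).
    apply: emeasurable_funM; first exact: (measurableT_comp mOm (@measurable_bilQ R m)).
    by apply/measurable_EFinP; exact: (measurableT_comp (@measurable_max0 R) (@measurableQ1 R m)).
  - by move=> q; rewrite !mule_ge0// lee_fin// sqr_ge0.
  apply: eq_integral => p _ /=; rewrite /Om1 -ge0_integralZr//; last 2 first.
  - exact: (measurableT_comp mK (pair1_measurable _)).
  - by rewrite lee_fin sqr_ge0.
  apply: eq_integral => s _; rewrite /K muleAC; congr (Om _ * _ * _)%E.
  by rewrite /bilQ /bilP/=; ring.
(* The centered marginal is that of [g], so [g] takes the first place in the induction
   hypothesis. *)
rewrite !m2E// muleC; apply: IH => //; try exact: niceP_marg.
move=> q p pq.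
have npos (k : Q m -> R) (e : P m) : niceQ k -> (marg (posQ k) e)%:E =
    (\int[leb]_(s in `]0%R, +oo[) (posQ k (e.1, (s, e.2)))%:E)%E.
  move=> nk; have nk' := niceQ_posQ nk; have [mk' _ _] := nk'.
  rewrite margE// integral_pos; last by apply/measurable_EFinP; exact: measurable_slice mk'.
  apply: eq_integral => s _; rewrite -EFinM; congr EFin.
  by rewrite /posQ/=; case: ltP; rewrite ?mulr1 ?mulr0.
rewrite EFinM (npos f)// (npos g)//.
rewrite /Om1 /K -integral_pos; last first.
  by apply: (measurableT_comp mOm); apply: measurable_funD => //; exact: measurable_funX.
have [[mf f0 [B fB]] [mg g0 [C gC]]] := (npf, npg).
have B0 : 0 <= B by have [+ _] := fB (0, (0, 0)); exact: le_trans.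
have C0 : 0 <= C by have [+ _] := gC (0, (0, 0)); exact: le_trans.
apply: (@prekopa_geometric _ _ _ _ (B + C)).
- exact: (measurable_slice q mg).
- exact: (measurable_slice p mf).
- by apply: (measurableT_comp mOm); apply: measurable_funD => //; exact: measurable_funX.
- by move=> s; rewrite g0/= (le_trans (gC _).1)// lerDr.
- by move=> s; rewrite f0/= (le_trans (fB _).1)// lerDl.
- move=> s /(gC _).2[_ /= sC _]; apply: le_trans (ler_norm s) _.
  by rewrite (le_trans sC)// lerDr.
- move=> s /(fB _).2[_ /= sB _]; apply: le_trans (ler_norm s) _.
  by rewrite (le_trans sB)// lerDl.
- by move=> z; exact: Om0.
move=> s t s0 t0; rewrite sqr_sqrtr; last by rewrite mulr_ge0// ltW.
have st0 : 0 < s * t by exact: mulr_gt0.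
rewrite /posQ/= s0 t0 !mulr1.
have bE : bilQ (p.1, (t, p.2)) (q.1, (s, q.2)) = bilP q p + s * t.
  by rewrite /bilQ /bilP/= dotvC; ring.
rewrite mulrC -bE; apply: fgOm; rewrite bE; exact: addr_gt0.
Qed.
End half.

(** * Moments of nice functions *)

Section moments.
Context {R : realType}.
Notation leb := (@lebesgue_measure R).
Notation P m := (measurableTypeR R * 'rV[R]_m)%type.
Notation Q m := (measurableTypeR R * (measurableTypeR R * 'rV[R]_m))%type.

Lemma integral_split (k : R -> \bar R) : measurable_fun setT k -> (forall s, 0 <= k s)%E ->
  (\int[leb]_s k s = \int[leb]_s (k s * ((0 < s)%R%:R)%:E) + \int[leb]_s (k s * ((0 < - s)%R%:R)%:E))%E.
Proof.
move=> mk k0.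
have mN : measurable_fun setT (fun s : R => ((0 < - s)%R%:R : R)%:E).
  exact: (measurableT_comp (@measurable_posE R) (@oppr_measurable R setT)).
have mP := @measurable_posE R.
rewrite -ge0_integralD//; last 4 first.
- by move=> s _; rewrite mule_ge0// lee_fin.
- exact: emeasurable_funM.
- by move=> s _; rewrite mule_ge0// lee_fin.
- exact: emeasurable_funM.
(* Neither half contains the point 0; it is null and is removed from both sides first. *)
have mD : measurable (setT `\ (0 : R)) by exact: measurableD.
rewrite -[LHS](@integral_setD1 _ _ 0)//; last exact: measurable_funTS.
rewrite -[RHS](@integral_setD1 _ _ 0)//; last first.
  by apply: measurable_funTS; apply: emeasurable_funD; exact: emeasurable_funM.
apply: eq_integral => s; rewrite inE/= => -[_ /eqP s0].
rewrite oppr_gt0; have [sn|sp|s0'] := ltgtP s 0.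
- by rewrite mule0 add0e mule1.
- by rewrite mule0 adde0 mule1.
- by move: s0; rewrite s0' eqxx.
Qed.

Lemma splitQ m (K : Q m -> \bar R) : measurable_fun setT K -> (forall q, 0 <= K q)%E ->
  (\int[muQ m]_q K q = \int[muQ m]_q (K q * ((0 < q.2.1)%R%:R)%:E) +
     \int[muQ m]_q (K (reflQ q) * ((0 < q.2.1)%R%:R)%:E))%E.
Proof.
move=> mK K0.
have mP : measurable_fun setT (fun q : Q m => ((0 < q.2.1)%R%:R : R)%:E).
  exact: (measurableT_comp (@measurable_posE R) (@measurableQ2 R m)).
have mN : measurable_fun setT (fun q : Q m => ((0 < - q.2.1)%R%:R : R)%:E).
  apply: (measurableT_comp (@measurable_posE R)); apply: measurable_funN.
  exact: measurableQ2.
have KP0 q : (0 <= K q * ((0 < q.2.1)%R%:R)%:E)%E by rewrite mule_ge0// lee_fin.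
have KN0 q : (0 <= K q * ((0 < - q.2.1)%R%:R)%:E)%E by rewrite mule_ge0// lee_fin.
have mKP : measurable_fun setT (fun q : Q m => K q * ((0 < q.2.1)%R%:R)%:E)%E.
  exact: emeasurable_funM.
have mKN : measurable_fun setT (fun q : Q m => K q * ((0 < - q.2.1)%R%:R)%:E)%E.
  exact: emeasurable_funM.
have -> : (\int[muQ m]_q (K (reflQ q) * ((0 < q.2.1)%R%:R)%:E) =
    \int[muQ m]_q (K q * ((0 < - q.2.1)%R%:R)%:E))%E.
  rewrite (mpres_integral (@mpres_reflQ R m) mKN KN0).
  by apply: eq_integral => q _; rewrite /= opprK.
rewrite !tonelliQ// -ge0_integralD//; last 4 first.
- by move=> p _; exact: integral_ge0.
- exact: measurable_slice_integral mKP KP0.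
- by move=> p _; exact: integral_ge0.
- exact: measurable_slice_integral mKN KN0.
apply: eq_integral => p _; rewrite integral_split//.
exact: measurable_slice mK.
Qed.

(** Locally bounded weights: they are integrable against nice functions, which have bounded support,
    and they are stable under the operations below, which the tactic [good] chains. *)
Definition goodQ m (w : Q m -> R) := measurable_fun setT w /\
  forall B : R, exists C : R, forall q : Q m, `|q.1| <= B -> `|q.2.1| <= B ->
    (forall i, `|q.2.2 0 i| <= B) -> `|w q| <= C.

Lemma goodQ_cst m c : @goodQ m (fun _ => c).
Proof. by split => // B; exists `|c|. Qed.

Lemma goodQ1 m : @goodQ m (fun q => q.1).
Proof. by split; [exact: measurableQ1|move=> B; exists B]. Qed.

Lemma goodQ2 m : @goodQ m (fun q => q.2.1).
Proof. by split; [exact: measurableQ2|move=> B; exists B]. Qed.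

Lemma goodQ3 m j : @goodQ m (fun q => q.2.2 0 j).
Proof. by split; [exact: measurableQ3j|move=> B; exists B]. Qed.

Lemma goodQD m (w1 w2 : Q m -> R) : goodQ w1 -> goodQ w2 -> goodQ (fun q => w1 q + w2 q).
Proof.
move=> [m1 b1] [m2 b2]; split; first exact: measurable_funD.
move=> B; have [C1 c1] := b1 B; have [C2 c2] := b2 B.
exists (C1 + C2) => q q1 q2 q3; rewrite (le_trans (ler_normD _ _))// lerD//.
  exact: c1.
exact: c2.
Qed.

Lemma goodQM m (w1 w2 : Q m -> R) : goodQ w1 -> goodQ w2 -> goodQ (fun q => w1 q * w2 q).
Proof.
move=> [m1 b1] [m2 b2]; split; first exact: measurable_funM.
move=> B; have [C1 c1] := b1 B; have [C2 c2] := b2 B.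
by exists (C1 * C2) => q q1 q2 q3; rewrite normrM ler_pM//; [exact: c1|exact: c2].
Qed.

Lemma goodQN m (w : Q m -> R) : goodQ w -> goodQ (fun q => - w q).
Proof.
move=> [m1 b1]; split; first exact: measurable_funN.
by move=> B; have [C c] := b1 B; exists C => q q1 q2 q3; rewrite normrN c.
Qed.

Lemma goodQ_sum m n (w : 'I_n -> Q m -> R) : (forall j, goodQ (w j)) ->
  goodQ (fun q => \sum_(j < n) w j q).
Proof.
elim: n w => [|n IH] w gw.
  by under eq_fun do rewrite big_ord0; exact: goodQ_cst.
under eq_fun do rewrite big_ord_recr/=.
by apply: goodQD => //; exact: IH.
Qed.

Lemma goodQ_max m (w : Q m -> R) : goodQ w -> goodQ (fun q => Num.max (w q) 0).
Proof.
move=> [m1 b1]; split; first exact: measurable_maxr.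
move=> B; have [C c] := b1 B; exists C => q q1 q2 q3.
apply: le_trans (c q q1 q2 q3); case: (leP 0 (w q)) => // _.
by rewrite normr0.
Qed.

Lemma goodQ_pos m (w : Q m -> R) : goodQ w -> goodQ (fun q => (0 < w q)%R%:R).
Proof.
move=> [m1 b1]; split; first exact: (measurableT_comp (@measurable_pos R) m1).
by move=> B; exists 1 => q _ _ _; case: (0 < w q); rewrite ?normr1 ?normr0.
Qed.

Definition symI (B : R) : set (measurableTypeR R) := `[- B, B]%classic.

Definition cubeV m (B : R) : set 'rV[R]_m := [set x | forall i, symI B (x 0 i)].
Arguments cubeV m B _ : clear implicits.
Definition cubeP m (B : R) : set (P m) := symI B `*` cubeV m B.
Arguments cubeP m B _ : clear implicits.
Definition cubeQ m (B : R) : set (Q m) := symI B `*` cubeP m B.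
Arguments cubeQ m B _ : clear implicits.

Lemma symIE (B : R) (s : R) : symI B s <-> `|s| <= B.
Proof. by rewrite /symI/= in_itv/= -ler_norml. Qed.

Lemma measurable_symI (B : R) : measurable (symI B).
Proof. exact: measurable_itv. Qed.

Lemma measurable_cubeV m (B : R) : measurable (cubeV m B).
Proof.
rewrite (_ : cubeV m B = \bigcap_(i in [set: 'I_m])
      ((fun x : 'rV[R]_m => x 0 i) @^-1` symI B)).
  apply: fin_bigcap_measurable => // i _; rewrite -[X in measurable X]setTI.
  exact: (measurable_rV_coord i measurableT (measurable_symI B)).
by apply/seteqP; split=> x /= Ax i => [_|]; [exact: Ax|exact: (Ax i I)].
Qed.

Lemma measurable_cubeP m B : measurable (cubeP m B).
Proof. by apply: measurableX; [exact: measurable_symI|exact: measurable_cubeV]. Qed.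

Lemma measurable_cubeQ m B : measurable (cubeQ m B).
Proof. by apply: measurableX; [exact: measurable_symI|exact: measurable_cubeP]. Qed.

Lemma fin_symI B : leb (symI B) \is a fin_num.
Proof.
by have /= -> := lebesgue_measure_itv `[- B, B]; case: ifP => // _; rewrite -EFinB.
Qed.

Lemma fin_cubeP m B : muP m (cubeP m B) \is a fin_num.
Proof.
have -> : (muP m (cubeP m B) = leb (symI B) * \prod_(i < m) leb (symI B))%E.
  rewrite /muP product_measure1E//; [|exact: measurable_symI|exact: measurable_cubeV].
  congr (_ * _)%E; apply: (@lebesgue_rV_box _ _ (fun _ => symI B)) => _.
  exact: measurable_symI.
rewrite fin_numM ?fin_symI//.
by elim/big_ind: _ => // [x y xf yf|_ _]; [rewrite fin_numM|exact: fin_symI].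
Qed.

Lemma fin_cubeQ m B : muQ m (cubeQ m B) \is a fin_num.
Proof.
have -> : (muQ m (cubeQ m B) = leb (symI B) * muP m (cubeP m B))%E.
  rewrite /muQ product_measure1E//; [exact: measurable_symI|exact: measurable_cubeP].
by rewrite fin_numM ?fin_symI ?fin_cubeP.
Qed.

Lemma niceQ_integrable m (g w : Q m -> R) : niceQ g -> goodQ w ->
  (muQ m).-integrable setT (fun q => (g q * w q)%:E).
Proof.
move=> [mg g0 [B gB]] [mw bw].
have mX := @measurable_cubeQ m B.
have fX : (muQ m (cubeQ m B) < +oo)%E by rewrite -ge0_fin_numE// (fin_cubeQ m).
set X := cubeQ m B in mX fX.
have [C wC] := bw B.
have XB q : X q -> [/\ `|q.1| <= B, `|q.2.1| <= B & forall i, `|q.2.2 0 i| <= B].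
  move=> [/= + [/= + +]]; rewrite !symIE => q1 q2 q3; split => // i.
  by have := q3 i; rewrite symIE.
have gX q : g q != 0 -> X q.
  move=> /(gB _).2 [/andP[q0 qB] q2 q3]; split => /=.
    by apply/symIE; rewrite gtr0_norm.
  by split => [|i] /=; exact/symIE.
have mgw : measurable_fun setT (fun q => g q * w q) by exact: measurable_funM.
have : (muQ m).-integrable X (EFin \o (fun q => g q * w q)).
  apply: measurable_bounded_integrable => //; first exact: measurable_funTS.
  exists (B * C); split; first exact: num_real.
  move=> N /ltW BN q Xq /=; apply: le_trans BN; rewrite normrM ler_pM//.
    by rewrite ger0_norm//; have [] := gB q.
  by have [q1 q2 q3] := XB q Xq; exact: wC.
rewrite integrable_mkcond//; congr (_.-integrable _ _).
apply/funext => q; rewrite patchE; case: ifPn => // qX.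
by have [->|/gX/mem_set] := eqVneq (g q) 0; [rewrite mul0r|rewrite (negbTE qX)].
Qed.

(** Moments as real numbers, so that they can be subtracted and divided; for nice [g] and good [w]
    the integral is finite and [fine] is faithful. *)
Definition wint m (g w : Q m -> R) : R := fine (\int[muQ m]_q (g q * w q)%:E)%E.

Lemma wintE m (g w : Q m -> R) : niceQ g -> goodQ w ->
  ((wint g w)%:E = \int[muQ m]_q (g q * w q)%:E)%E.
Proof.
move=> ng gw; rewrite fineK//.
by apply: integrable_fin_num => //; exact: niceQ_integrable.
Qed.

Lemma eq_wint m (g w1 w2 : Q m -> R) : (forall q, g q != 0 -> w1 q = w2 q) -> wint g w1 = wint g w2.
Proof.
move=> w12; congr fine; apply: eq_integral => q _; congr EFin.
by have [->|/w12 ->] := eqVneq (g q) 0; rewrite ?mul0r.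
Qed.

Lemma wintD m (g w1 w2 : Q m -> R) : niceQ g -> goodQ w1 -> goodQ w2 ->
  wint g (fun q => w1 q + w2 q) = wint g w1 + wint g w2.
Proof.
move=> ng g1 g2; apply: EFin_inj; rewrite EFinD !wintE//; last exact: goodQD.
rewrite -integralD//; try exact: niceQ_integrable.
by apply: eq_integral => q _; rewrite -EFinD mulrDr.
Qed.

Lemma wintZ m c (g w : Q m -> R) : niceQ g -> goodQ w -> wint g (fun q => c * w q) = c * wint g w.
Proof.
move=> ng gw; apply: EFin_inj; rewrite EFinM !wintE//; last first.
  by apply: goodQM => //; exact: goodQ_cst.
rewrite -integralZl//; last exact: niceQ_integrable.
by apply: eq_integral => q _; rewrite -EFinM mulrCA.
Qed.

Lemma wintN m (g w : Q m -> R) : niceQ g -> goodQ w -> wint g (fun q => - w q) = - wint g w.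
Proof.
by move=> ng gw; rewrite -mulN1r -wintZ//; apply: eq_wint => q _; rewrite mulN1r.
Qed.

Lemma wint_sum m n (g : Q m -> R) (w : 'I_n -> Q m -> R) : niceQ g ->
  (forall j, goodQ (w j)) -> wint g (fun q => \sum_(j < n) w j q) = \sum_(j < n) wint g (w j).
Proof.
move=> ng; elim: n w => [|n IH] w gw.
  rewrite big_ord0 /wint; under eq_integral do rewrite big_ord0 mulr0.
  by rewrite integral0.
rewrite big_ord_recr/= -IH// -wintD//; last exact: goodQ_sum.
by apply: eq_wint => q _; rewrite big_ord_recr.
Qed.

Lemma le_wint m (g w1 w2 : Q m -> R) : niceQ g -> goodQ w1 -> goodQ w2 ->
  (forall q, g q != 0 -> w1 q <= w2 q) -> wint g w1 <= wint g w2.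
Proof.
move=> ng g1 g2 w12; rewrite -lee_fin !wintE//.
apply: le_integral => //; try exact: niceQ_integrable.
move=> q _; rewrite lee_fin; have [_ g0 _] := ng.
by have [->|/w12] := eqVneq (g q) 0; [rewrite !mul0r|exact: ler_wpM2l].
Qed.

Lemma wint_ge0 m (g w : Q m -> R) : niceQ g -> goodQ w ->
  (forall q, g q != 0 -> 0 <= w q) -> 0 <= wint g w.
Proof.
move=> ng gw w0; have := le_wint ng (goodQ_cst m 0) gw w0.
rewrite (_ : wint g (fun => 0) = 0)// /wint; under eq_integral do rewrite mulr0.
by rewrite integral0.
Qed.

Definition above m c (q : Q m) : R := (0 < q.2.1 - c * q.1)%R%:R.

Definition below m c (q : Q m) : R := (0 < - (q.2.1 - c * q.1))%R%:R.

Let good_height m c : @goodQ m (fun q => q.2.1 - c * q.1).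
Proof.
apply: goodQD; first exact: goodQ2.
by apply: goodQN; apply: goodQM; [exact: goodQ_cst|exact: goodQ1].
Qed.

Lemma good_above m c : goodQ (@above m c).
Proof. by apply: goodQ_pos; exact: good_height. Qed.

Lemma good_below m c : goodQ (@below m c).
Proof. by apply: goodQ_pos; apply: goodQN; exact: good_height. Qed.

End moments.
Arguments cubeV {R} m B _.
Arguments cubeP {R} m B _.
Arguments cubeQ {R} m B _.

Ltac good := repeat first [exact: goodQ1 | exact: goodQ2 | exact: goodQ3 | exact: goodQ_cst
  | assumption | exact: good_above | exact: good_below
  | apply: goodQD | apply: goodQN | apply: goodQM
  | apply: goodQ_pos | apply: goodQ_max | apply: goodQ_sum => ?].

(** * The bisecting hyperplane *)

Section median.
Context {R : realType}.
Notation leb := (@lebesgue_measure R).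
Notation P m := (measurableTypeR R * 'rV[R]_m)%type.
Notation Q m := (measurableTypeR R * (measurableTypeR R * 'rV[R]_m))%type.

Lemma goodQ_dotv m (a : 'rV[R]_m) : goodQ (fun q : Q m => dotv a q.2.2).
Proof. by rewrite /dotv; good. Qed.

(* The convex function [t |-> (max t 0)^2] lies above its tangent line at
   [r > 0], whose linear part integrates to [0] against [f]. *)
Lemma jensen m (f : Q m -> R) (al : 'rV[R]_m) c : niceQ f ->
  (forall j, wint f (fun q => q.1 * q.2.2 0 j) = 0) -> wint f (fun q => q.1 * q.2.1) = 0 ->
  wint f (fun q => q.1 * q.1) <=
  wint f (fun q => Num.max (q.1 + (dotv al q.2.2 + c * q.2.1)) 0 *
                     Num.max (q.1 + (dotv al q.2.2 + c * q.2.1)) 0).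
Proof.
move=> nf fx fs; have gd := goodQ_dotv al.
have -> : wint f (fun q => q.1 * q.1) =
  wint f (fun q => q.1 * q.1 + 2 * (\sum_(j < m) al 0 j * (q.1 * q.2.2 0 j) + c * (q.1 * q.2.1))).
  rewrite wintD//; [|by good|by good].
  rewrite wintZ//; last by good.
  rewrite wintD//; [|by good|by good].
  rewrite wintZ//; last by good.
  rewrite wint_sum//; last by move=> j; good.
  rewrite big1 ?fs ?mulr0 ?addr0 ?mulr0 ?addr0// => j _.
  by rewrite wintZ// ?fx ?mulr0//; good.
apply: le_wint => //; [by good|by good|].
move=> q fq; have [_ _ [B fB]] := nf; have [/andP[r0 _] _ _] := (fB q).2 fq.
have -> : \sum_(j < m) al 0 j * (q.1 * q.2.2 0 j) = q.1 * dotv al q.2.2.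
  by rewrite /dotv mulr_sumr; apply: eq_bigr => j _; rewrite mulrCA.
rewrite (_ : _ + c * (q.1 * q.2.1) = q.1 * (dotv al q.2.2 + c * q.2.1)); last by ring.
by set y := dotv _ _ + _; case: (leP 0) => l0; nra.
Qed.

Lemma niceQ_refl m (g : Q m -> R) : niceQ g -> niceQ (g \o @reflQ R m).
Proof.
move=> [mg g0 [B gB]]; split; [|by move=> q; exact: g0|].
  exact: (measurableT_comp mg (mpres_reflQ m).1).
by exists B => q /=; have [? gB2] := gB (reflQ q); split=> // /gB2; rewrite /= normrN.
Qed.

Lemma wint_mpres m (g w : Q m -> R) (T : Q m -> Q m) :
  mpres (muQ m) (muQ m) T -> niceQ g -> goodQ w ->
  (forall q, g q != 0 -> 0 <= w q) ->
  wint g w = wint (g \o T) (w \o T).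
Proof.
move=> mT [mg g0 _] [mw _] w0; congr fine.
rewrite (mpres_integral (f := fun q => (g q * w q)%:E) mT)//.
  by apply/measurable_EFinP; exact: measurable_funM.
move=> q; rewrite lee_fin; have [->|/w0] := eqVneq (g q) 0; first by rewrite mul0r.
exact: mulr_ge0.
Qed.

Lemma wint_slice_le m (g w : Q m -> R) B C : 0 <= C -> niceQ g -> goodQ w ->
  (forall q, g q != 0 -> 0 <= w q) ->
  (forall p : P m, (\int[leb]_s (g (p.1, (s, p.2)) * w (p.1, (s, p.2)))%:E <=
     (C * \1_(cubeP m B) p)%:E)%E) ->
  wint g w <= C * fine (muP m (cubeP m B)).
Proof.
move=> C0 ng gw w0 gwC; have [mg g0 _] := ng; have [mw _] := gw.
have gw0 q : 0 <= g q * w q.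
  by have [->|/w0] := eqVneq (g q) 0; [rewrite mul0r|exact: mulr_ge0].
have mgw : measurable_fun setT (fun q => (g q * w q)%:E).
  by apply/measurable_EFinP; exact: measurable_funM.
have mI : measurable_fun setT (\1_(cubeP m B) : P m -> R).
  by apply: measurable_indic; exact: measurable_cubeP.
rewrite -lee_fin wintE// (tonelliQ (K := fun q => (g q * w q)%:E))//.
have -> : ((C * fine (muP m (cubeP m B)))%:E = \int[muP m]_p (C * \1_(cubeP m B) p)%:E)%E.
  under eq_integral do rewrite EFinM.
  rewrite ge0_integralZl_EFin//; last exact/measurable_EFinP.
  by rewrite integral_indic ?setIT// ?EFinM ?fineK ?fin_cubeP//; exact: measurable_cubeP.
apply: ge0_le_integral => //.
- by move=> p _; apply: integral_ge0 => s _; rewrite lee_fin.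
- by apply: (measurable_slice_integral (K := fun q => (g q * w q)%:E)) => // q; rewrite lee_fin.
- by apply/measurable_EFinP; exact: measurable_funM.
Qed.

Definition mass_above m (g : Q m -> R) c : R := wint g (fun q => q.1 * q.1 * above c q).

(** On the support [r] and the absolute value of [s] are at most [B], so [s > k * r] forces
    [r < B / k], and the mass is at most [B^2 / k^2] times the integral of [g]. *)
Lemma mass_above_large m (g : Q m -> R) e : niceQ g -> 0 < e ->
  exists2 k, 0 < k & forall k', k <= k' -> mass_above g k' <= e.
Proof.
move=> ng e0; have [mg g0 [B gB]] := ng.
have B0 : 0 <= B by have [+ _] := gB (0, (0, 0)); exact: le_trans.
have ga c := @good_above R m c.
pose D := B * B * wint g (fun _ => 1).
have g1 := goodQ_cst m 1.
have D0 : 0 <= D by rewrite !mulr_ge0// wint_ge0.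
(* A slope [k] that is at least 1 and at least [D / e] gives [D / k^2 <= D / k <= e]. *)
exists (1 + D / e); first by rewrite ltr_wpDr// divr_ge0// ltW.
move=> k kk.
have k1 : 1 <= k by apply: le_trans kk; rewrite lerDl divr_ge0// ltW.
have k0 : 0 < k by exact: lt_le_trans k1.
have DkE : D / (k * k) <= e.
  rewrite ler_pdivrMr ?mulr_gt0//.
  have : D / e <= k by apply: le_trans kk; rewrite lerDr.
  rewrite ler_pdivrMr// => Dk; apply: (le_trans Dk).
  rewrite mulrC; apply: ler_wpM2l; first exact: ltW.
  by rewrite ler_peMr// ltW.
apply: le_trans DkE.
rewrite (_ : D / (k * k) = (B * B / (k * k)) * wint g (fun _ => 1)); last by rewrite /D mulrAC.
rewrite -wintZ//; apply: le_wint => //; [by good|by good|].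
move=> q /(gB _).2 [/andP[r0 rB] sB _]; rewrite mulr1 /above.
case: ltP => [kr|_]; last by rewrite mulr0 divr_ge0// mulr_ge0// ltW.
rewrite mulr1 ler_pdivlMr ?mulr_gt0//.
have krB : q.1 * k <= B.
  rewrite mulrC (le_trans _ (le_trans (ler_norm _) sB))//.
  by move: kr; rewrite subr_gt0 => /ltW.
rewrite (_ : _ * (k * k) = (q.1 * k) * (q.1 * k)); last by ring.
by rewrite ler_pM// mulr_ge0// ltW.
Qed.

(** The difference is the mass of the wedge [c * r < s <= c' * r], whose sections in [s] have length
    [(c' - c) * r]. *)
Lemma mass_above_lipschitz m (g : Q m -> R) : niceQ g ->
  exists2 L, 0 <= L & forall c c', c <= c' ->
    0 <= mass_above g c - mass_above g c' <= L * (c' - c).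
Proof.
move=> ng; have [mg g0 [B gB]] := ng.
have B0 : 0 <= B by have [+ _] := gB (0, (0, 0)); exact: le_trans.
have ga c := @good_above R m c.
pose V := fine (muP m (cubeP m B)).
have V0 : 0 <= V by exact: fine_ge0.
(* The factors bound, in this order, [g], the weight [r ^ 2], the [r] in the length of a section,
   and the volume of the cube that carries [g] once [s] is integrated out. *)
exists (B * (B * B) * B * V); first by rewrite !mulr_ge0.
move=> c c' cc'.
have -> : mass_above g c - mass_above g c' = wint g (fun q => q.1 * q.1 * (above c q - above c' q)).
  rewrite /mass_above -wintN//; last by good.
  rewrite -wintD//; [|by good|by good].
  by apply: eq_wint => q _; rewrite mulrBr.
have gA : goodQ (fun q : Q m => q.1 * q.1 * (above c q - above c' q)) by good.
have aE q : 0 < q.1 -> above c q - above c' q =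
    \1_(`]c * q.1, c' * q.1]%classic : set R) q.2.1.
  move=> r0; rewrite /above !subr_gt0 indicE mem_setE in_itv/=.
  have : c * q.1 <= c' * q.1 by rewrite ler_wpM2r// ltW.
  case: ltP => h1; case: ltP => h2 h3; rewrite ?subrr ?subr0//=; lra.
have aE0 q : g q != 0 -> 0 <= q.1 * q.1 * (above c q - above c' q).
  move=> /(gB _).2 [/andP[r0 _] _ _]; rewrite aE// mulr_ge0//.
  by rewrite mulr_ge0// ltW.
apply/andP; split; first exact: wint_ge0.
rewrite (_ : _ * (c' - c) = B * (B * B) * B * (c' - c) * V); last by ring.
have cc0 : 0 <= c' - c by rewrite subr_ge0.
apply: wint_slice_le => //; first by rewrite !mulr_ge0.
move=> p.
have [gp|] := pselect (forall s, g (p.1, (s, p.2)) = 0).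
  rewrite (eq_integral (cst 0%E)) ?integral0 ?lee_fin ?mulr_ge0//.
  by move=> s _; rewrite gp mul0r.
move=> /existsNP[s0 /eqP /(gB _).2 /= [/andP[r0 rB] _ xB]].
have pB : cubeP m B p.
  by split=> /=; [apply/symIE; rewrite gtr0_norm|move=> i; exact/symIE].
have -> : (\1_(cubeP m B) p : R) = 1 by rewrite indicE mem_set.
pose J : set (measurableTypeR R) := `]c * p.1, c' * p.1]%classic.
have mJ : measurable J by exact: measurable_itv.
apply: (@le_trans _ _ (\int[leb]_s ((B * (B * B))%:E * (\1_J s)%:E))%E).
  apply: ge0_le_integral => //.
  - move=> s _; rewrite lee_fin; have [->|gs] := eqVneq (g (p.1, (s, p.2))) 0; first by rewrite mul0r.
    by apply: mulr_ge0 => //; exact: (aE0 _ gs).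
  - apply/measurable_EFinP.
    by apply: (measurable_slice (K := fun q : Q m => g q * (q.1 * q.1 * (above c q - above c' q))));
      apply: measurable_funM => //; exact: gA.1.
  - by apply/measurable_EFinP; apply: measurable_funM => //; exact: measurable_indic.
  move=> s _; rewrite -EFinM lee_fin aE// mulrA ler_wpM2r// ler_pM//.
  - by rewrite mulr_ge0// ltW.
  - by have [] := gB (p.1, (s, p.2)).
  - by rewrite ler_pM// ltW.
rewrite ge0_integralZl_EFin//; [|by apply/measurable_EFinP; exact: measurable_indic|by rewrite !mulr_ge0].
rewrite integral_indic// setIT.
have /= -> : leb J = (c' * p.1 - c * p.1)%:E.
  have /= -> := lebesgue_measure_itv `]c * p.1, c' * p.1].
  rewrite lte_fin; case: ltP; first by rewrite EFinB.
  have : c * p.1 <= c' * p.1 by rewrite ler_wpM2r// ltW.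
  move=> h1 h2; have -> : c' * p.1 = c * p.1 by lra.
  by rewrite subrr.
rewrite -EFinM lee_fin mulr1 -mulrBl -!mulrA.
do 3 (rewrite ler_wpM2l//).
by rewrite mulrC ler_wpM2r.
Qed.

Lemma mass_above_continuous m (g : Q m -> R) : niceQ g -> continuous (mass_above g).
Proof.
move=> ng; have [L L0 gL] := mass_above_lipschitz ng.
(* [L + 1] is positive, hence a legitimate divisor below, while [L] may be 0. *)
have gL' c c' : `|mass_above g c - mass_above g c'| <= (L + 1) * `|c - c'|.
  wlog cc' : c c' / c <= c'.
    move=> H; case: (leP c c') => [/H//|/ltW/H].
    by rewrite distrC [`|c' - c|]distrC.
  have /andP[h1 h2] := gL c c' cc'.
  rewrite ger0_norm// (le_trans h2)// distrC ger0_norm ?subr_ge0//.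
  by rewrite ler_wpM2r ?subr_ge0// lerDl.
move=> c; apply/cvgrPdist_lt => e e0.
near=> c'; apply: le_lt_trans (gL' c c') _.
rewrite mulrC -ltr_pdivlMr; last by rewrite ltr_wpDl.
near: c'; apply/nbhs_ballP; exists (e / (L + 1)) => //=.
by rewrite divr_gt0// ltr_wpDl.
Unshelve. all: by end_near. Qed.

(** Neither part counts the hyperplane [s = c * r]. A shear straightens it to [s = 0], which is
    negligible by [splitQ]. *)
Lemma wint_above_below m (g : Q m -> R) c : niceQ g ->
  wint g (fun q => q.1 * q.1) = mass_above g c + wint g (fun q => q.1 * q.1 * below c q).
Proof.
move=> ng; have [mg g0 _] := ng.
have gr : goodQ (fun q : Q m => q.1 * q.1) by good.
have [ga gb] := (@good_above R m c, @good_below R m c).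
pose T := @shearT R m c 0 0.
have mT : mpres (muQ m) (muQ m) T by exact: mpres_shearT.
have r0 (q : Q m) : 0 <= q.1 * q.1 by rewrite -expr2 sqr_ge0.
have ngr := niceQ_refl ng.
have mR := @mpres_reflQ R m.
apply: EFin_inj; rewrite EFinD /mass_above !wintE//; [|by good|by good].
pose K q := (g (T q) * ((T q).1 * (T q).1))%:E.
have mK : measurable_fun setT K.
  apply/measurable_EFinP; apply: measurable_funM; first exact: (measurableT_comp mg mT.1).
  exact: (measurableT_comp gr.1 mT.1).
have K0 q : (0 <= K q)%E by rewrite lee_fin mulr_ge0.
have toT (w : Q m -> R) : goodQ w -> (forall q, 0 <= w q) ->
   (\int[muQ m]_q (g q * w q)%:E = \int[muQ m]_q (g (T q) * w (T q))%:E)%E.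
  move=> gw w0; rewrite (mpres_integral (f := fun q => (g q * w q)%:E) mT)//.
    by apply/measurable_EFinP; apply: measurable_funM => //; exact: gw.1.
  by move=> q; rewrite lee_fin mulr_ge0.
rewrite !toT//; [|by good|by move=> q; rewrite mulr_ge0|by good|by move=> q; rewrite mulr_ge0].
rewrite (splitQ mK K0); congr (_ + _)%E.
  apply: eq_integral => q _; rewrite /K -EFinM.
  by rewrite /above /= addrK !mulrA.
pose K2 q := (g (T q) * ((T q).1 * (T q).1 * below c (T q)))%:E.
have mK2 : measurable_fun setT K2.
  apply/measurable_EFinP; apply: measurable_funM; first exact: (measurableT_comp mg mT.1).
  have gw : goodQ (fun q : Q m => q.1 * q.1 * below c q) by good.
  exact: (measurableT_comp gw.1 mT.1).
rewrite (mpres_integral (f := K2) mR)//; last first.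
  by move=> q; rewrite lee_fin; apply: mulr_ge0 => //; exact: mulr_ge0.
apply: eq_integral => q _; rewrite /K2 /K -EFinM.
by rewrite /below /= addrK opprK !mulrA.
Qed.

(** Intermediate value theorem: from slope [- k] to slope [k] the mass above passes from at least
    half of the total to at most half. The bound at [- k] is the one at [k] for the reflected
    function. *)
Lemma median m (g : Q m -> R) : niceQ g ->
  exists c, mass_above g c = wint g (fun q => q.1 * q.1 * below c q).
Proof.
move=> ng.
have gb c := @good_below R m c.
have gr : goodQ (fun q : Q m => q.1 * q.1) by good.
have N0 : 0 <= wint g (fun q => q.1 * q.1) by apply: wint_ge0 => // q _; rewrite -expr2 sqr_ge0.
(* Without mass both sides vanish and any slope will do; otherwise [N / 2] is a positive threshold
   for [mass_above_large]. *)
move: N0; rewrite le_eqVlt => /predU1P[N0|N0].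
  exists 0; have := wint_above_below 0 ng; rewrite -N0.
  have a0 : 0 <= mass_above g 0.
    apply: wint_ge0 => //; first by have := @good_above R m 0; good.
    by move=> q _; rewrite mulr_ge0// -expr2 sqr_ge0.
  have b0 : 0 <= wint g (fun q => q.1 * q.1 * below 0 q).
    apply: wint_ge0 => //; first by have := gb 0; good.
    by move=> q _; rewrite mulr_ge0// -expr2 sqr_ge0.
  by lra.
set N := wint g (fun q => q.1 * q.1) in N0.
have N2 : 0 < N / 2 by rewrite divr_gt0.
have [k1 k10 gk1] := mass_above_large ng N2.
have ngr := niceQ_refl ng.
have [k2 k20 gk2] := mass_above_large ngr N2.
have below_refl c : wint g (fun q => q.1 * q.1 * below c q) = mass_above (g \o @reflQ R m) (- c).
  rewrite (wint_mpres (@mpres_reflQ R m))//; [|by good|].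
    by apply: eq_wint => q _; rewrite /above /below/=; congr (_ * (0 < _)%R%:R); ring.
  by move=> q _; rewrite mulr_ge0// -expr2 sqr_ge0.
pose k := k1 + k2.
have h1 : mass_above g k <= N / 2 by apply: gk1; rewrite /k lerDl ltW.
have h2 : N / 2 <= mass_above g (- k).
  have := wint_above_below (- k) ng; rewrite -/N below_refl opprK => NE.
  have := gk2 k; rewrite {1}/k lerDr ltW// => /(_ isT); lra.
have [] := @IVT R (mass_above g) (- k) k (N / 2).
- by rewrite ge0_cp// ltW// addr_gt0.
- exact: continuous_subspaceT (mass_above_continuous ng).
- by rewrite ge_min h1 orbT /= le_max h2.
move=> c _ cN; exists c; have := wint_above_below c ng; rewrite -/N cN; lra.
Qed.

End median.

(** * The shears that center both halves *)

Section step.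
Context {R : realType}.
Notation leb := (@lebesgue_measure R).
Notation P m := (measurableTypeR R * 'rV[R]_m)%type.
Notation Q m := (measurableTypeR R * (measurableTypeR R * 'rV[R]_m))%type.

(** The second factor is the [j]-th coordinate of [x] after undoing [shearT c al v]. For each [j]
    the two conditions are a linear system in [al 0 j] and [v 0 j] with rows [(mu, hA)] and
    [(mu, hB)]. Its determinant [mu * (hB - hA)] is nonzero, because [s - c * r] is positive on one
    half and negative on the other. *)
Lemma centering m (g : Q m -> R) c : niceQ g -> 0 < mass_above g c ->
  mass_above g c = wint g (fun q => q.1 * q.1 * below c q) ->
  exists al v : 'rV[R]_m, forall j,
    wint g (fun q => q.1 * (q.2.2 0 j - (al 0 j * q.1 + v 0 j * (q.2.1 - c * q.1))) * above c q) = 0 /\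
    wint g (fun q => q.1 * (q.2.2 0 j - (al 0 j * q.1 + v 0 j * (q.2.1 - c * q.1))) * below c q) = 0.
Proof.
move=> ng mu0 mub.
set mu := mass_above g c in mu0 mub.
have [mg g0 [B gB]] := ng.
have gpos q : g q != 0 -> 0 < q.1 by move=> /(gB _).2[/andP[]].
have expand (e : Q m -> R) (x : Q m -> R) a b : goodQ e -> goodQ x ->
    wint g (fun q => q.1 * (x q - (a * q.1 + b * (q.2.1 - c * q.1))) * e q) =
    wint g (fun q => q.1 * x q * e q) - (a * wint g (fun q => q.1 * q.1 * e q) +
      b * wint g (fun q => q.1 * (q.2.1 - c * q.1) * e q)).
  move=> ge gx; rewrite -!wintZ//; [|by good|by good].
  rewrite -wintD//; [|by good|by good].
  rewrite -wintN//; last by good.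
  rewrite -wintD//; [|by good|by good].
  by apply: eq_wint => q _; ring.
pose hA := wint g (fun q => q.1 * (q.2.1 - c * q.1) * above c q).
pose hB := wint g (fun q => q.1 * (q.2.1 - c * q.1) * below c q).
have hB0 : hB <= 0.
  rewrite /hB -oppr_ge0 -wintN//; last by good.
  apply: wint_ge0 => //; first by good.
  move=> q /gpos r0; rewrite /below; case: ltP => h; last by rewrite mulr0 oppr0.
  by rewrite mulr1 -mulrN mulr_ge0 ?ltW// ltW.
have gW : goodQ (fun q : Q m => q.1 * (q.2.1 - c * q.1) * above c q) by good.
have W0 q : g q != 0 -> 0 <= q.1 * (q.2.1 - c * q.1) * above c q.
  move=> /gpos r0; rewrite /above; case: ltP => h; last by rewrite mulr0.
  by rewrite mulr1 mulr_ge0// ltW.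
(* If [hA] were 0, then [g] would vanish almost everywhere above the hyperplane, where the weight is
   positive on the support, and [mu] would be 0. *)
have hA0 : 0 < hA.
  rewrite lt_neqAle wint_ge0// andbT; apply/eqP => hA0.
  have : (\int[muQ m]_q `|(g q * (q.1 * (q.2.1 - c * q.1) * above c q))%:E| = 0)%E.
    rewrite -[RHS]/(0%R%:E) hA0 /hA wintE//; apply: eq_integral => q _.
    rewrite gee0_abs// lee_fin; have [->|/W0] := eqVneq (g q) 0; first by rewrite mul0r.
    exact: mulr_ge0.
  have mW : measurable_fun setT (fun q => (g q * (q.1 * (q.2.1 - c * q.1) * above c q))%:E).
    by apply/measurable_EFinP; apply: measurable_funM => //; exact: gW.1.
  move=> /(ae_eq_integral_abs _ measurableT mW) [N [mN N0 subN]].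
  have gr : goodQ (fun q : Q m => q.1 * q.1 * above c q) by good.
  move: mu0; rewrite /mu -lte_fin wintE//.
  rewrite (ae_eq_integral (cst 0%E)) ?integral0 ?ltxx//.
    by apply/measurable_EFinP; apply: measurable_funM => //; exact: gr.1.
  exists N; split => //; apply: subset_trans subN => q /= + h; apply => _.
  have := h I => -[] /eqP; rewrite !mulf_eq0 => /orP[/eqP->|]; first by rewrite mul0r.
  have [->|/gpos r0] := eqVneq (g q) 0; first by rewrite mul0r.
  rewrite gt_eqF//= /above; case: ltP => // sc; last by rewrite !mulr0.
  by rewrite gt_eqF//= oner_eq0.
have hAB : hA - hB != 0 by rewrite gt_eqF// subr_gt0 (le_lt_trans hB0).
pose MA j := wint g (fun q => q.1 * q.2.2 0 j * above c q).
pose MB j := wint g (fun q => q.1 * q.2.2 0 j * below c q).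
(* The masses of the halves are equal, so subtracting the two equations eliminates [al 0 j]. *)
pose b j := (MA j - MB j) / (hA - hB).
pose a j := (MA j - b j * hA) / mu.
exists (\row_j a j), (\row_j b j) => j; rewrite !mxE.
rewrite !expand//; [|by good|by good|by good|by good].
rewrite -/mu -/hA -/hB -/(MA j) -/(MB j) -mub /a /b.
have mun0 : mu != 0 by rewrite gt_eqF.
by rewrite -/(mass_above g c) -/mu; split; field; rewrite ?mun0 ?hAB.
Qed.

Lemma rV_bound m (a : 'rV[R]_m) : exists2 A, 0 <= A & forall i, `|a 0 i| <= A.
Proof.
exists (\sum_i `|a 0 i|); first by apply: sumr_ge0.
by move=> i; rewrite (bigD1 i)//= lerDl sumr_ge0.
Qed.

Lemma niceQ_shearT m (g : Q m -> R) c al v : niceQ g -> niceQ (g \o shearT c al v).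
Proof.
move=> [mg g0 [B gB]].
have B0 : 0 <= B by have [+ _] := gB (0, (0, 0)); exact: le_trans.
have [A A0 alA] := rV_bound al; have [V V0 vV] := rV_bound v.
split; [exact: (measurableT_comp mg (mpres_shearT c al v).1)|by move=> q; exact: g0|].
(* [S] bounds [s] before the shear, written as [(s + c * r) - c * r]. *)
pose S := B + `|c| * B.
have S0 : 0 <= S by rewrite addr_ge0// mulr_ge0.
exists (B + S + (B * A + S * V)) => q /=; have [gB1 gB2] := gB (shearT c al v q).
have BA0 : 0 <= B * A + S * V by rewrite addr_ge0 ?mulr_ge0.
split; first by rewrite (le_trans gB1)// -addrA lerDl addr_ge0.
move=> /gB2/= [/andP[r0 rB] sB xB].
have sS : `|q.2.1| <= S.
  rewrite (_ : q.2.1 = (q.2.1 + c * q.1) - c * q.1); last by rewrite addrK.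
  rewrite (le_trans (ler_normB _ _))// lerD// normrM ler_wpM2l//.
  by rewrite gtr0_norm.
split; first by rewrite r0/= (le_trans rB)// -addrA lerDl addr_ge0.
  by rewrite (le_trans sS)// [B + S]addrC -addrA lerDl addr_ge0.
move=> i; have := xB i; rewrite !mxE => xBi.
rewrite (_ : q.2.2 0 i = (q.2.2 0 i + (q.1 * al 0 i + q.2.1 * v 0 i)) - (q.1 * al 0 i + q.2.1 * v 0 i)); last first.
  by rewrite addrK.
rewrite (le_trans (ler_normB _ _))// lerD//.
  by rewrite (le_trans xBi)// lerDl.
rewrite (le_trans (ler_normD _ _))// lerD// normrM ler_pM//.
by rewrite gtr0_norm.
Qed.

(** The shear may move mass of [f] to [r <= 0]; it is cut off there so that the result is nice. The
    cut costs nothing, since [jensen] counts only the positive part of the new [r]. *)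
Definition shearedU m (f : Q m -> R) c al v (q : Q m) : R :=
  f (shearU c al v q) * (0 < q.1)%R%:R.

Lemma niceQ_shearU m (f : Q m -> R) c al v : niceQ f -> niceQ (shearedU f c al v).
Proof.
move=> [mf f0 [B fB]].
have B0 : 0 <= B by have [+ _] := fB (0, (0, 0)); exact: le_trans.
have [A A0 alA] := rV_bound al; have [V V0 vV] := rV_bound v.
split.
- apply: measurable_funM; first exact: (measurableT_comp mf (mpres_shearU c al v).1).
  exact: (measurableT_comp (@measurable_pos R) (@measurableQ1 R m)).
- by move=> q; rewrite mulr_ge0.
pose a := m%:R * (A * B); pose b := m%:R * (V * B).
have a0 : 0 <= a by rewrite !mulr_ge0.
have b0 : 0 <= b by rewrite !mulr_ge0.
have cB0 : 0 <= `|c| * B by rewrite mulr_ge0.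
exists (B + (a + `|c| * B) + b) => q; have [fB1 fB2] := fB (shearU c al v q); split.
  rewrite /shearedU (@le_trans _ _ (f (shearU c al v q)))//.
    by rewrite ler_piMr// lern1 leq_b1.
  by rewrite (le_trans fB1)// -addrA lerDl !addr_ge0.
rewrite /shearedU mulf_eq0 negb_or => /andP[/fB2/= [/andP[r0 rB] sB xB]].
case: ltP => [q0 _|]; last by rewrite eqxx.
have dal : `|dotv al q.2.2| <= a by exact: dotv_bound.
have dv : `|dotv v q.2.2| <= b by exact: dotv_bound.
split.
- rewrite /= -[X in X <= _](subrK (dotv al q.2.2 + c * (q.2.1 - dotv v q.2.2))).
  apply: (@le_trans _ _ (B + (a + `|c| * B))); last by rewrite lerDl.
  apply: lerD => //; apply: lerD; first exact: le_trans (ler_norm _) dal.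
  by rewrite (le_trans (ler_norm _))// normrM ler_wpM2l.
- rewrite -[X in `|X| <= _](subrK (dotv v q.2.2)) (le_trans (ler_normD _ _))//.
  by rewrite lerD// (le_trans sB)// lerDl addr_ge0.
- by move=> i; rewrite (le_trans (xB i))// -addrA lerDl !addr_ge0.
Qed.

End step.

(** * The induction on the number of coordinates *)

Section induction.
Context {R : realType}.
Notation leb := (@lebesgue_measure R).
Notation P m := (measurableTypeR R * 'rV[R]_m)%type.
Notation Q m := (measurableTypeR R * (measurableTypeR R * 'rV[R]_m))%type.

Lemma niceQ_gt0 m (g : Q m -> R) q : niceQ g -> g q != 0 -> 0 < q.1.
Proof. by move=> [_ _ [B gB]] /(gB _).2[/andP[]]. Qed.

(** Translates between the signed moments of [centering] and the subtraction-free form of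
    [centeredP], using [r > 0] on the support of [g]. *)
Lemma wint_weight m (g W E : Q m -> R) : niceQ g -> goodQ W -> goodQ E -> (forall q, 0 <= E q) ->
  wint g (fun q => q.1 * W q * E q) =
  wint g (fun q => Num.max q.1 0 * Num.max (W q) 0 * E q) -
  wint g (fun q => Num.max q.1 0 * Num.max (- W q) 0 * E q).
Proof.
move=> ng gW gE E0; rewrite -wintN//; last by good.
rewrite -wintD//; [|by good|by good].
apply: eq_wint => q /(niceQ_gt0 ng) r0; rewrite (max_l (ltW r0)) -mulrBl -mulrBr.
by congr (_ * _ * _); case: (leP 0 (W q)); case: (leP 0 (- W q)); lra.
Qed.

(** Here [E] selects one half of [g], and [T], which is the shear or the shear after a reflection,
    carries [s > 0] to that half. A vanishing moment of the half thus becomes the centering of a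
    marginal. *)
Lemma centered_marg m (g k W E : Q m -> R) (T : Q m -> Q m) (x : P m -> R) :
  niceQ k -> niceQ g -> mpres (muQ m) (muQ m) T -> goodQ W -> goodQ E -> (forall q, 0 <= E q) ->
  measurable_fun setT x ->
  (forall q, posQ k q = g (T q) * E (T q)) -> (forall q, (T q).1 = q.1) ->
  (forall q, W (T q) = x (q.1, q.2.2)) -> wint g (fun q => q.1 * W q * E q) = 0 ->
  (\int[muP m]_p (marg (posQ k) p * (Num.max p.1 0 * Num.max (x p) 0))%:E =
   \int[muP m]_p (marg (posQ k) p * (Num.max p.1 0 * Num.max (- x p) 0))%:E)%E.
Proof.
move=> nk ng mT gW gE E0 mx kE T1 WE WE0.
have key (y : P m -> R) (Y : Q m -> R) : measurable_fun setT y -> goodQ Y ->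
    (forall q, Y (T q) = y (q.1, q.2.2)) ->
    (\int[muP m]_p (marg (posQ k) p * (Num.max p.1 0 * Num.max (y p) 0))%:E =
     (wint g (fun q => Num.max q.1 0 * Num.max (Y q) 0 * E q))%:E)%E.
  move=> my gY YE.
  have max0 (a : R) : 0 <= Num.max a 0 by rewrite le_max lexx orbT.
  rewrite (marg_weight (w := fun p => Num.max p.1 0 * Num.max (y p) 0)); last 3 first.
  - exact: niceQ_posQ.
  - by apply: measurable_funM; apply: measurable_maxr => //; exact: measurable_fst.
  - by move=> p; rewrite mulr_ge0.
  have gw : goodQ (fun q => Num.max q.1 0 * Num.max (Y q) 0 * E q) by good.
  have [mg g0 _] := ng.
  rewrite wintE// (mpres_integral (f := fun q => (g q * _)%:E) mT); last 2 first.
  - by apply/measurable_EFinP; apply: measurable_funM => //; exact: gw.1.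
  - by move=> q; rewrite lee_fin !mulr_ge0.
  by apply: eq_integral => q _; rewrite T1 YE kE/=; congr EFin; ring.
rewrite (key x W)// (key (fun p => - x p) (fun q => - W q)); last 3 first.
- exact: measurable_funN.
- by good.
- by move=> q; rewrite WE.
by move: WE0; rewrite wint_weight// => /eqP; rewrite subr_eq0 => /eqP ->.
Qed.

Lemma m2P_consQ m (f : P m.+1 -> R) : niceP f ->
  m2P f = (wint (f \o @consQ R m) (fun q => q.1 * q.1))%:E.
Proof.
move=> nf; have [mf f0 _] := nf; have nfQ := niceQ_consQ nf.
rewrite wintE//; last by good.
rewrite /m2P (mpres_integral (f := fun p => (f p * p.1 ^+ 2)%:E) (@mpres_consQ R m))//.
  by apply/measurable_EFinP; apply: measurable_funM => //; apply: measurable_funX; exact: measurable_fst.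
by move=> p; rewrite lee_fin mulr_ge0// sqr_ge0.
Qed.

Lemma centered_consQ m (f : P m.+1 -> R) (x : Q m -> R) i : niceP f -> centeredP f ->
  goodQ x -> (forall q, cons_rV q.2 0 i = x q) ->
  wint (f \o @consQ R m) (fun q => q.1 * x q) = 0.
Proof.
move=> nf cf gx xE; have [mf f0 _] := nf; have nfQ := niceQ_consQ nf.
have max0 (a : R) : 0 <= Num.max a 0 by rewrite le_max lexx orbT.
have key (y : P m.+1 -> R) (Y : Q m -> R) : measurable_fun setT y -> goodQ Y ->
    (forall q, y (consQ q) = Y q) ->
    (\int[muP m.+1]_p (f p * (Num.max p.1 0 * Num.max (y p) 0))%:E =
     (wint (f \o @consQ R m) (fun q => Num.max q.1 0 * Num.max (Y q) 0 * 1))%:E)%E.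
  move=> my gY YE; rewrite wintE//; last by good.
  rewrite (mpres_integral (f := fun p => (f p * _)%:E) (@mpres_consQ R m)); last 2 first.
  - apply/measurable_EFinP; apply: measurable_funM => //.
    by apply: measurable_funM; apply: measurable_maxr => //; exact: measurable_fst.
  - by move=> p; rewrite lee_fin !mulr_ge0.
  by apply: eq_integral => q _; rewrite YE mulr1.
have mi : measurable_fun setT (fun p : P m.+1 => p.2 0 i).
  exact: measurableT_comp (measurable_rV_coord i) measurable_snd.
have := cf i; rewrite (key _ x)// (key (fun p => - p.2 0 i) (fun q => - x q)); last 3 first.
- exact: measurable_funN.
- exact: goodQN.
- by move=> q; rewrite /= xE.
move=> e; have := congr1 fine e; rewrite /= => {}e.
  have := wint_weight nfQ gx (goodQ_cst m 1) (fun _ => ler01).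
by rewrite e subrr => <-; apply: eq_wint => q _; rewrite mulr1.
Qed.

Lemma santaloS m : @santalo R m -> @santalo R m.+1.
Proof.
move=> IH f g Om nf ng cf mOm Om0 fgOm.
have [nfQ ngQ] := (niceQ_consQ nf, niceQ_consQ ng).
set fQ := f \o @consQ R m in nfQ; set gQ := g \o @consQ R m in ngQ.
pose Jh := (\int[muQ m]_q (Om (bilQ q q) * ((Num.max q.1 0) ^+ 2)%:E * ((0 < q.2.1)%R%:R)%:E))%E.
have mJ : measurable_fun setT (fun q : Q m => Om (bilQ q q) * ((Num.max q.1 0) ^+ 2)%:E)%E.
  apply: emeasurable_funM; first exact: (measurableT_comp mOm (@measurable_bilQ R m)).
  by apply/measurable_EFinP; exact: (measurableT_comp (@measurable_max0 R) (@measurableQ1 R m)).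
have J0 (q : Q m) : (0 <= Om (bilQ q q) * ((Num.max q.1 0) ^+ 2)%:E)%E.
  by rewrite mule_ge0// lee_fin sqr_ge0.
(* The diagonal pairing is even in [s], so both halves of the integral are equal to [Jh]. *)
have JE : JP m.+1 Om = (2%:E * Jh)%E.
  rewrite /JP (mpres_integral (f := fun p => (Om (bilP p p) * _)%E) (@mpres_consQ R m)); last 2 first.
  - apply: emeasurable_funM.
      apply: (measurableT_comp mOm); apply: measurable_funD.
        by apply: measurable_funM; exact: measurable_fst.
      by apply: measurable_dotv; exact: measurable_snd.
    apply/measurable_EFinP; apply: (measurableT_comp (@measurable_max0 R)).
    exact: measurable_fst.
  - by move=> p; rewrite mule_ge0// lee_fin sqr_ge0.
  under eq_integral do rewrite bilP_consQ.
  rewrite (splitQ mJ J0).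
  under [X in (_ + X)%E]eq_integral do rewrite bilQ_refl.
  by rewrite -/Jh -[X in (X + X)%E]mul1e -ge0_muleDl// -EFinD.
have Jh0 : (0 <= Jh)%E by apply: integral_ge0 => q _; rewrite mule_ge0// lee_fin.
rewrite JE !m2P_consQ// -/fQ -/gQ.
have [c cE] := median ngQ.
have tot := wint_above_below c ngQ.
have mu0 : 0 <= mass_above gQ c.
  apply: wint_ge0 => //; first by good.
  by move=> q _; rewrite mulr_ge0// -expr2 sqr_ge0.
(* If [g] has no mass, the left side is 0; otherwise [centering] has the positive mass that it asks
   for. *)
move: mu0; rewrite le_eqVlt => /predU1P[mu0|mu0].
  by rewrite tot -cE -mu0 addr0 mule0 expe_ge0// mule_ge0// lee_fin.
have [al [v avE]] := centering ngQ mu0 cE.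
pose ft := shearedU fQ c al v; pose gt := gQ \o shearT c al v.
have nft : niceQ ft by exact: niceQ_shearU.
have ngt : niceQ gt by exact: niceQ_shearT.
have mT := @mpres_shearT R m c al v.
have mR := @mpres_reflQ R m.
have ftgt p q : 0 < bilQ p q -> ((ft p * gt q)%:E <= Om (bilQ p q) ^+ 2)%E.
  move=> pq; have := fgOm (consQ (shearU c al v p)) (consQ (shearT c al v q)).
  rewrite bilP_consQ bilQ_shear => /(_ pq); apply: le_trans; rewrite lee_fin.
  have [_ g0 _] := ngQ; have [_ f0 _] := nfQ.
  by rewrite ler_wpM2r//; [exact: g0|rewrite ler_piMr ?lern1 ?leq_b1//; exact: f0].
pose W j (q : Q m) := q.2.2 0 j - (al 0 j * q.1 + v 0 j * (q.2.1 - c * q.1)).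
have gW j : goodQ (W j) by rewrite /W; good.
have mj j : measurable_fun setT (fun p : P m => p.2 0 j).
  exact: measurableT_comp (measurable_rV_coord j) measurable_snd.
have cA : centeredP (marg (posQ gt)).
  move=> j; apply: (@centered_marg m gQ gt (W j) (@above R m c) (shearT c al v) (fun p => p.2 0 j)).
  - exact: ngt.
  - exact: ngQ.
  - exact: mT.
  - exact: gW.
  - exact: good_above.
  - by move=> q.
  - exact: mj.
  - by move=> q; rewrite /posQ /above/= addrK.
  - by [].
  - by move=> q; rewrite /W /= !mxE addrK; ring.
  - by have [] := avE j.
have cB : centeredP (marg (posQ (gt \o @reflQ R m))).
  move=> j; apply: (@centered_marg m gQ (gt \o @reflQ R m) (W j)
    (@below R m c) (shearT c al v \o @reflQ R m) (fun p => p.2 0 j)).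
  - exact: niceQ_refl.
  - exact: ngQ.
  - exact: mpres_comp mR mT.
  - exact: gW.
  - exact: good_below.
  - by move=> q.
  - exact: mj.
  - by move=> q; rewrite /posQ /below/= addrK opprK.
  - by [].
  - by move=> q; rewrite /W /= !mxE addrK; ring.
  - by have [] := avE j.
have hA := half_step IH nft ngt cA mOm Om0 ftgt.
have ftgtR p q : 0 < bilQ p q ->
    (((ft \o @reflQ R m) p * (gt \o @reflQ R m) q)%:E <= Om (bilQ p q) ^+ 2)%E.
  by rewrite -bilQ_refl => /ftgt.
have hB := half_step IH (niceQ_refl nft) (niceQ_refl ngt) cB mOm Om0 ftgtR.
rewrite -/Jh in hA hB.
(* [T] fixes [r], so the shear leaves the moments of the two halves of [g] unchanged. *)
have Y (k E : Q m -> R) (T : Q m -> Q m) : mpres (muQ m) (muQ m) T -> goodQ E ->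
    (forall q, 0 <= E q) -> (forall q, posQ k q = gQ (T q) * E (T q)) ->
    (forall q, (T q).1 = q.1) ->
    (\int[muQ m]_q (posQ k q * q.1 ^+ 2)%:E = (wint gQ (fun q => q.1 * q.1 * E q))%:E)%E.
  move=> mS gE E0 kE T1; have [mg g0 _] := ngQ.
  have gw : goodQ (fun q => q.1 * q.1 * E q) by good.
  rewrite wintE// (mpres_integral (f := fun q => (gQ q * _)%:E) mS).
  - by apply: eq_integral => q _; rewrite T1 kE; congr EFin; ring.
  - by apply/measurable_EFinP; apply: measurable_funM => //; exact: gw.1.
  - by move=> q; rewrite lee_fin -expr2 mulr_ge0// mulr_ge0// sqr_ge0.
rewrite (Y gt (@above R m c) (shearT c al v)) in hA; last 5 first.
- exact: mT.
- exact: good_above.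
- by [].
- by move=> q; rewrite /posQ /above/= addrK.
- by [].
rewrite (Y (gt \o @reflQ R m) (@below R m c) (shearT c al v \o @reflQ R m)) in hB; last 5 first.
- exact: mpres_comp mR mT.
- exact: good_below.
- by [].
- by move=> q; rewrite /posQ /below/= addrK opprK.
- by [].
rewrite -cE in hB.
set X1 := integral _ _ _ in hA; set X2 := integral _ _ _ in hB.
have X10 : (0 <= X1)%E.
  apply: integral_ge0 => q _; have [_ f0 _] := niceQ_posQ nft.
  by rewrite lee_fin mulr_ge0// sqr_ge0.
have X20 : (0 <= X2)%E.
  apply: integral_ge0 => q _; have [_ f0 _] := niceQ_posQ (niceQ_refl nft).
  by rewrite lee_fin mulr_ge0// sqr_ge0.
have X12 : ((wint fQ (fun q => q.1 * q.1))%:E <= X1 + X2)%E.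
  have jen := jensen al c nfQ (fun j => centered_consQ nf cf (@goodQ3 R m j) (fun q => cons_rVS q.2 j))
    (centered_consQ nf cf (@goodQ2 R m) (fun q => cons_rV0 q.2)).
  move: jen; rewrite -lee_fin => jen; apply: le_trans jen _.
  have gl := goodQ_dotv al.
  (* The argument of [M] is the first coordinate of the inverse of [shearU c al v]. In the sheared
     variables [M] is therefore the positive part of [r], and the cut in [shearedU] does not change
     the integral. *)
  pose M (q : Q m) : R := Num.max (q.1 + (dotv al q.2.2 + c * q.2.1)) 0.
  rewrite -[wint _ _]/(wint fQ (fun q => M q * M q)).
  have gM : goodQ (fun q => M q * M q) by rewrite /M; good.
  have [mf f0 _] := nfQ; have [mft ft0 _] := nft.
  have mU := @mpres_shearU R m c al v.
  rewrite wintE// (mpres_integral (f := fun q => (fQ q * (M q * M q))%:E) mU); last 2 first.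
  - by apply/measurable_EFinP; apply: measurable_funM => //; exact: gM.1.
  - by move=> q; rewrite lee_fin -expr2 mulr_ge0// sqr_ge0.
  pose K q := (ft q * q.1 ^+ 2)%:E.
  have -> : (\int[muQ m]_q (fQ (shearU c al v q) * (M (shearU c al v q) * M (shearU c al v q)))%:E =
      \int[muQ m]_q K q)%E.
    apply: eq_integral => q _; rewrite /K /ft /shearedU /M /=.
    rewrite subrK; congr EFin; case: (ltP 0 q.1) => q0; first by rewrite mulr1 expr2.
    by rewrite !mulr0 mul0r.
  rewrite (splitQ (K := K)); last 2 first.
  - apply/measurable_EFinP; apply: measurable_funM => //; apply: measurable_funX.
    exact: measurableQ1.
  - by move=> q; rewrite lee_fin mulr_ge0// sqr_ge0.
  rewrite le_eqVlt; apply/orP; left; apply/eqP; congr (_ + _)%E;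
    by apply: eq_integral => q _; rewrite /K -EFinM /posQ/=; congr EFin; ring.
have muE : mass_above gQ c = wint gQ (fun q => q.1 * q.1 * above c q) by [].
rewrite -muE in hA; move: hA hB X12.
set mu := mass_above gQ c in mu0 tot cE *.
have -> : wint gQ (fun q => q.1 * q.1) = 2 * mu by rewrite tot -cE; ring.
move=> hA hB X12.
apply: (@le_trans _ _ ((X1 + X2) * (2 * mu)%:E)%E).
  by apply: lee_wpmul2r => //; rewrite lee_fin mulr_ge0// ltW.
rewrite EFinM muleCA ge0_muleDl//.
rewrite (_ : (2%:E * Jh) ^+ 2 = 2%:E * (Jh ^+ 2 + Jh ^+ 2))%E; last first.
  rewrite -[X in (X + X)%E]mul1e -ge0_muleDl ?lee_fin// -EFinD -(natrD _ 1 1).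
  by rewrite !expe2 muleACA [in RHS]muleA.
by apply: lee_wpmul2l => //; apply: leeD.
Qed.

Lemma santalo_all m : @santalo R m.
Proof. by elim: m => [|m IH]; [exact: santalo0|exact: santaloS]. Qed.
End induction.

(** * Reduction to the half-space *)

Section rotation.
Context {R : realType}.
Notation leb := (@lebesgue_measure R).
Notation P m := (measurableTypeR R * 'rV[R]_m)%type.
Notation Q m := (measurableTypeR R * (measurableTypeR R * 'rV[R]_m))%type.

Definition unconsQ m (p : P m.+1) : Q m := (p.1, uncons_rV p.2).

Lemma consQK m : cancel (@consQ R m) (@unconsQ m).
Proof. by move=> [r e]; rewrite /unconsQ/= cons_rVK. Qed.

Lemma unconsQK m : cancel (@unconsQ m) (@consQ R m).
Proof. by move=> [r e]; rewrite /consQ/= uncons_rVK. Qed.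

Lemma mpres_unconsQ m : mpres (muP m.+1) (muQ m) (@unconsQ m).
Proof.
apply: mpres_inv (@mpres_consQ R m) _ (@consQK m).
apply/measurable_fun_pairP; split; first exact: measurable_fst.
exact: measurableT_comp (@measurable_uncons_rV R m) measurable_snd.
Qed.

Definition oppP m (p : P m) : P m := (- p.1, - p.2).

Lemma mpres_oppP m : mpres (muP m) (muP m) (@oppP m).
Proof.
pose t1 (p : P m) : P m := (p.1, - p.2).
pose t2 (p : P m) : P m := (- p.1, p.2).
have h2 : measurable_fun setT t2.
  apply/measurable_fun_pairP; split; last exact: measurable_snd.
  by apply: measurable_funN; exact: measurable_fst.
have h1 : measurable_fun setT t1.
  apply/measurable_fun_pairP; split; first exact: measurable_fst.
  exact: measurableT_comp (mpres_rVN m).1 measurable_snd.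
apply: (@mpres_comp _ _ _ _ _ _ _ _ (muP m) _ t2 t1).
  by apply: (@mpres_fiber1 _ _ _ _ _ _ _ leb (lebesgue_rV R m) (lebesgue_rV R m)
    (fun _ => -%R) h1) => _; exact: mpres_rVN.
by apply: (@mpres_fiber2 _ _ _ _ _ _ _ (lebesgue_rV R m) leb leb (fun _ => -%R) h2) => _; exact: mpres_lebN.
Qed.

(* A rotation of the first two coordinates is a product of three shears. *)
Lemma rotQ m (a b : R) : exists (T : Q m -> Q m) W, [/\ mpres (muQ m) (muQ m) T,
  forall p q, bilQ (T p) (T q) = bilQ p q,
  forall q, T (- q.1, (- q.2.1, - q.2.2)) = (- (T q).1, (- (T q).2.1, - (T q).2.2)),
  forall q, (T q).2.2 = q.2.2 &
  (forall q, a * (T q).1 + b * (T q).2.1 = W * q.1) /\ W ^+ 2 = a ^+ 2 + b ^+ 2].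
Proof.
(* Here [W] may be negative; only its square is prescribed. *)
have [->|b0] := eqVneq b 0.
  exists id, a; split; [exact: mpres_id|by []|by []|by []|].
  by split=> [q|]; rewrite ?mul0r ?addr0// expr0n/= addr0.
pose W := Num.sqrt (a ^+ 2 + b ^+ 2).
have W2 : W ^+ 2 = a ^+ 2 + b ^+ 2 by rewrite sqr_sqrtr// addr_ge0 ?sqr_ge0.
have W0 : W != 0.
  rewrite -sqrf_eq0 W2 gt_eqF// ltr_wpDl ?sqr_ge0//.
  by rewrite exprn_even_gt0.
pose c := a / W; pose s := b / W.
have s0 : s != 0 by rewrite mulf_neq0// invr_eq0.
have cs : c ^+ 2 + s ^+ 2 = 1.
  by rewrite !expr_div_n -mulrDl -W2 divff// sqrf_eq0.
(* The tangent of half the angle whose cosine and sine are [c] and [s]. *)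
pose t := (1 - c) / s.
pose T := shearU t 0 0 \o (shearT s 0 0 \o @shearU R m t 0 0).
have TE q : T q = (c * q.1 - s * q.2.1, (s * q.1 + c * q.2.1, q.2.2)).
  have d0 (x : 'rV[R]_m) : dotv 0 x = 0.
    by rewrite /dotv big1// => i _; rewrite mxE mul0r.
  rewrite /T /shearU /shearT/= !d0 !subr0 !add0r !scaler0 !addr0.
  have h1 : q.2.1 + s * (q.1 - t * q.2.1) = s * q.1 + c * q.2.1.
    by rewrite /t; field.
  rewrite h1; congr (_, _); rewrite /t.
  have -> : q.1 - (1 - c) / s * q.2.1 - (1 - c) / s * (s * q.1 + c * q.2.1) =
    c * q.1 - (1 - c ^+ 2) / s * q.2.1 by field.
  by congr (_ - _); rewrite -cs; field.
exists T, W; split.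
- apply: mpres_comp (mpres_shearU t 0 0); apply: mpres_comp (mpres_shearT s 0 0).
  exact: mpres_shearU.
- move=> p q; rewrite !TE /bilQ/=.
  transitivity ((c ^+ 2 + s ^+ 2) * (p.1 * q.1 + p.2.1 * q.2.1) + dotv p.2.2 q.2.2); first by ring.
  by rewrite cs; ring.
- by move=> q; rewrite !TE/=; congr (_, (_, _)); ring.
- by move=> q; rewrite TE.
split=> // q; rewrite TE/=.
have cW : c * W = a by rewrite divfK.
have sW : s * W = b by rewrite divfK.
rewrite -cW -sW; transitivity (W * ((c ^+ 2 + s ^+ 2) * q.1)); first by ring.
by rewrite cs mul1r.
Qed.

(** The tail [u'] is first turned onto the first axis of its own space, with coefficient [b]; a
    planar rotation then turns [(a, b)] into [(W, 0)]. The sign of [w] is left open because the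
    weights involve [w ^ 2] alone. *)
Lemma rotation m (u : 'rV[R]_m.+1) : exists (phi : P m -> 'rV[R]_m.+1) w,
  [/\ mpres (muP m) (lebesgue_rV R m.+1) phi,
      forall p q, dotv (phi p) (phi q) = bilP p q,
      forall p, phi (oppP p) = - phi p,
      forall p, dotv (phi p) u = w * p.1 &
      w ^+ 2 = dotv u u].
Proof.
elim: m u => [|m IH] u.
  exists (@cons_rV R 0), (u 0 0); split.
  - exact: mpres_cons.
  - by move=> p q; rewrite dotv_cons.
  - move=> p; apply/rowP => j; rewrite [RHS]mxE; have [[]//|->] := unliftP ord0 j.
    by rewrite !cons_rV0.
  - by move=> p; rewrite /dotv big_ord_recl big_ord0 cons_rV0 addr0 mulrC.
  - by rewrite /dotv big_ord_recl big_ord0 addr0 expr2.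
have [a [u' ->]] : exists a u', u = cons_rV (a, u').
  by exists (uncons_rV u).1, (uncons_rV u).2; rewrite -surjective_pairing uncons_rVK.
have [phi [b [mphi dphi nphi uphi b2]]] := IH u'.
have [T [W [mT bT nT _ [WT W2]]]] := rotQ m a b.
pose Psi (q : Q m) : 'rV[R]_m.+2 := cons_rV (q.1, phi q.2).
have mPsi : mpres (muQ m) (lebesgue_rV R m.+2) Psi.
  pose S (q : Q m) : P m.+1 := (q.1, phi q.2).
  apply: (@mpres_comp _ _ _ _ _ _ _ _ (muP m.+1) _ (@cons_rV R m.+1) S); last exact: mpres_cons.
  apply: (@mpres_fiber1 _ _ _ _ _ _ _ leb (muP m) (lebesgue_rV R m.+1) (fun _ => phi)).
    apply/measurable_fun_pairP; split; first exact: measurable_fst.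
    exact: measurableT_comp mphi.1 measurable_snd.
  by move=> _.
exists (Psi \o (T \o @unconsQ m)), W; split.
- by apply: mpres_comp mPsi; apply: mpres_comp mT; exact: mpres_unconsQ.
- move=> p q /=; rewrite dotv_cons/= dphi -[RHS]/(bilP p q).
  rewrite -[p in RHS]unconsQK -[q in RHS]unconsQK bilP_consQ -bT.
  by [].
- move=> p /=.
  have -> : unconsQ (oppP p) = (- p.1, (- (unconsQ p).2.1, - (unconsQ p).2.2)).
    congr (_, (_, _)); rewrite /= ?mxE//.
    by apply/rowP => j; rewrite !mxE.
  rewrite (nT (unconsQ p)) /Psi/=.
  have -> : phi (- (T (unconsQ p)).2.1, - (T (unconsQ p)).2.2) = - phi (T (unconsQ p)).2 by exact: nphi.
  apply/rowP => j; rewrite [RHS]mxE; have [i ->|->] := unliftP ord0 j; last by rewrite !cons_rV0.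
  by rewrite !cons_rVS mxE.
- by move=> p /=; rewrite dotv_cons/= uphi -[p.1]/((unconsQ p).1) -WT; ring.
- by rewrite dotv_cons/= -b2 W2 expr2.
Qed.

End rotation.

(** * From the half-space to the whole space *)

Section even.
Context {R : realType}.
Notation leb := (@lebesgue_measure R).
Notation P m := (measurableTypeR R * 'rV[R]_m)%type.

Definition niceV n (h : 'rV[R]_n -> R) := [/\ measurable_fun setT h, forall x, 0 <= h x &
  exists B, forall x, h x <= B /\ (h x != 0 -> forall i, `|x 0 i| <= B)].

Lemma splitP m (K : P m -> \bar R) : measurable_fun setT K -> (forall p, 0 <= K p)%E ->
  (\int[muP m]_p K p = \int[muP m]_p (K p * ((0 < p.1)%R%:R)%:E) +
     \int[muP m]_p (K (oppP p) * ((0 < p.1)%R%:R)%:E))%E.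
Proof.
move=> mK K0.
have m1 : measurable_fun setT (fun p : P m => p.1 : R) by exact: measurable_fst.
have mP : measurable_fun setT (fun p : P m => ((0 < p.1)%R%:R : R)%:E).
  exact: (measurableT_comp (@measurable_posE R) m1).
have mN : measurable_fun setT (fun p : P m => ((0 < - p.1)%R%:R : R)%:E).
  by apply: (measurableT_comp (@measurable_posE R)); exact: measurable_funN.
have KP0 p : (0 <= K p * ((0 < p.1)%R%:R)%:E)%E by rewrite mule_ge0// lee_fin.
have KN0 p : (0 <= K p * ((0 < - p.1)%R%:R)%:E)%E by rewrite mule_ge0// lee_fin.
have mKP : measurable_fun setT (fun p : P m => K p * ((0 < p.1)%R%:R)%:E)%E.
  exact: emeasurable_funM.
have mKN : measurable_fun setT (fun p : P m => K p * ((0 < - p.1)%R%:R)%:E)%E.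
  exact: emeasurable_funM.
have -> : (\int[muP m]_p (K (oppP p) * ((0 < p.1)%R%:R)%:E) =
    \int[muP m]_p (K p * ((0 < - p.1)%R%:R)%:E))%E.
  rewrite (mpres_integral (@mpres_oppP R m) mKN KN0).
  by apply: eq_integral => p _; rewrite /= opprK.
have sec (r : R) : measurable_fun setT (fun x : 'rV[R]_m => K (r, x)).
  exact: (measurableT_comp mK (pair1_measurable r)).
rewrite !tonelliP// integral_split; last 2 first.
- exact: (measurable_fun_fubini_tonelli_F (m2 := lebesgue_rV R m) _ mK K0).
- by move=> r; exact: integral_ge0.
congr (_ + _)%E; apply: eq_integral => r _; rewrite -ge0_integralZr// lee_fin.
Qed.

(** Boundedness of the support survives because [phi] preserves the inner product: the square of
    each coordinate is at most the squared length of [phi p]. *)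
Lemma niceP_rotate m (h : 'rV[R]_m.+1 -> R) (phi : P m -> 'rV[R]_m.+1) : niceV h ->
  measurable_fun setT phi -> (forall p q, dotv (phi p) (phi q) = bilP p q) ->
  niceP (fun p => h (phi p) * (0 < p.1)%R%:R).
Proof.
move=> [mh h0 [B hB]] mphi dphi; split.
- apply: measurable_funM; first exact: (measurableT_comp mh mphi).
  by apply: (measurableT_comp (@measurable_pos R)); exact: measurable_fst.
- by move=> p; rewrite mulr_ge0.
have B0 : 0 <= B by have [+ _] := hB 0; exact: le_trans.
pose D := m.+1%:R * (B * B).
have D0 : 0 <= D by rewrite !mulr_ge0.
(* Turns a bound on the square of a coordinate into one on the coordinate, without a root. *)
have le_sq (a : R) : `|a| <= 1 + a * a.
  have := sqr_ge0 (`|a| - 1); have := normr_ge0 a; rewrite -expr2 -[a ^+ 2]real_normK ?num_real//.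
  nra.
exists (B + (1 + D)) => p; have [hB1 hB2] := hB (phi p); split.
  rewrite (@le_trans _ _ (h (phi p)))//; first by rewrite ler_piMr// lern1 leq_b1.
  by rewrite (le_trans hB1)// lerDl addr_ge0.
rewrite mulf_eq0 negb_or => /andP[/hB2 xB].
case: ltP => [p0 _|]; last by rewrite eqxx.
have bD : bilP p p <= D.
  by rewrite -dphi (le_trans (ler_norm _))//; exact: dotv_bound.
have x0 : 0 <= dotv p.2 p.2 by exact: dotv_ge0.
have p10 : 0 <= p.1 * p.1 by rewrite -expr2 sqr_ge0.
have BD : 1 + D <= B + (1 + D) by rewrite lerDr.
have small (a : R) : a * a <= bilP p p -> `|a| <= B + (1 + D).
  move=> ap; apply: le_trans BD; apply: (le_trans (le_sq a)).
  by rewrite lerD2l (le_trans ap).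
split=> [|i].
  by apply: le_trans (small p.1 _); [exact: ler_norm|rewrite /bilP lerDl].
apply: small; rewrite /bilP (le_trans _ (lerD p10 (lexx _)))// add0r.
rewrite /dotv (bigD1 i)//= lerDl; apply: sumr_ge0 => j _.
by rewrite -expr2 sqr_ge0.
Qed.

(** [G] need not be even. The half-space inequality is applied to [F] with [Gp] and with [Gm], which
    are [G] and its reflection cut to the half-space, and the two are added: up to powers of [w],
    [(2 * A) * (B1 + B2) <= (2 * J)^2]. *)
Lemma santalo_even m (F G : 'rV[R]_m.+1 -> R) (Om : R -> \bar R) (u : 'rV[R]_m.+1) (S : R) :
  niceV F -> niceV G -> (forall x, F (- x) = F x) ->
  (forall th, \int[lebesgue_rV R m.+1]_x (F x * dotv x th ^+ 2)%:E = (dotv th th * S)%:E)%E ->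
  measurable_fun setT Om -> (forall t, 0 <= Om t)%E ->
  (forall x y, 0 < dotv x y -> ((F x * G y)%:E <= Om (dotv x y) ^+ 2)%E) ->
  ((\int[lebesgue_rV R m.+1]_x (F x * dotv x u ^+ 2)%:E) *
   (\int[lebesgue_rV R m.+1]_x (G x * dotv x u ^+ 2)%:E) <=
   (\int[lebesgue_rV R m.+1]_z (Om (dotv z z) * (dotv z u ^+ 2)%:E)) ^+ 2)%E.
Proof.
move=> nF nG evF SF mOm Om0 FG.
have [phi [w [mphi dphi nphi uphi w2]]] := rotation u.
have [[mF F0 _] [mG G0 _]] := (nF, nG).
have m1 : measurable_fun setT (fun p : P m => p.1 : R) by exact: measurable_fst.
have m2 : measurable_fun setT (fun p : P m => p.2) by exact: measurable_snd.
pose Fp p := F (phi p) * (0 < p.1)%R%:R.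
pose Gp p := G (phi p) * (0 < p.1)%R%:R.
pose Gm p := G (- phi p) * (0 < p.1)%R%:R.
have nFp : niceP Fp by exact: niceP_rotate mphi.1 dphi.
have nGp : niceP Gp by exact: niceP_rotate mphi.1 dphi.
have nGm : niceP Gm.
  apply: (niceP_rotate (h := fun x => G (- x))) mphi.1 dphi.
  have [_ _ [B gB]] := nG; split; [|by move=> x; exact: G0|].
    exact: (measurableT_comp mG (mpres_rVN m.+1).1).
  exists B => x; have [g1 g2] := gB (- x); split=> // /g2 xB i.
  by have := xB i; rewrite mxE normrN.
have pull (h : 'rV[R]_m.+1 -> \bar R) : measurable_fun setT h -> (forall x, 0 <= h x)%E ->
    (\int[lebesgue_rV R m.+1]_x h x =
     \int[muP m]_p (h (phi p) * ((0 < p.1)%R%:R)%:E) +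
     \int[muP m]_p (h (- phi p)%R * ((0 < p.1)%R%:R)%:E))%E.
  move=> mh h0; rewrite (mpres_integral mphi)// (splitP (K := h \o phi)); last 2 first.
  - exact: (measurableT_comp mh mphi.1).
  - by move=> p; exact: h0.
  by congr (_ + _)%E; apply: eq_integral => p _; rewrite /= nphi.
have mFp : measurable_fun setT Fp by case: nFp.
have Fp0 p : 0 <= Fp p by case: nFp.
have sq k (e : P m -> 'rV[R]_m.+1) : niceP k -> (forall p, dotv (e p) u ^+ 2 = (w * p.1) ^+ 2) ->
    (\int[muP m]_p ((k p * dotv (e p) u ^+ 2)%:E) = (w ^+ 2)%:E * m2P k)%E.
  move=> [mk k0 _] eE; rewrite /m2P -ge0_integralZl_EFin//; last 3 first.
  - by move=> p _; rewrite lee_fin mulr_ge0// sqr_ge0.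
  - by apply/measurable_EFinP; apply: measurable_funM => //; exact: measurable_funX.
  - exact: sqr_ge0.
  by apply: eq_integral => p _; rewrite eE -EFinM; congr EFin; ring.
have mdot th : measurable_fun setT (fun x : 'rV[R]_m.+1 => dotv x th ^+ 2).
  by apply: measurable_funX; exact: measurable_dotv.
have upos p : dotv (phi p) u ^+ 2 = (w * p.1) ^+ 2 by rewrite uphi.
have uneg p : dotv (- phi p) u ^+ 2 = (w * p.1) ^+ 2 by rewrite dotvNl uphi sqrrN.
have EF : (\int[lebesgue_rV R m.+1]_x (F x * dotv x u ^+ 2)%:E =
    (w ^+ 2)%:E * m2P Fp + (w ^+ 2)%:E * m2P Fp)%E.
  rewrite pull; last 2 first.
  - by apply/measurable_EFinP; exact: measurable_funM.
  - by move=> x; rewrite lee_fin mulr_ge0// sqr_ge0.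
  rewrite -{1}(sq _ phi nFp upos) -(sq _ (fun p => - phi p) nFp uneg); congr (_ + _)%E.
    by apply: eq_integral => p _; rewrite -EFinM /Fp; congr EFin; ring.
  by apply: eq_integral => p _; rewrite -EFinM evF /Fp; congr EFin; ring.
have EG : (\int[lebesgue_rV R m.+1]_x (G x * dotv x u ^+ 2)%:E =
    (w ^+ 2)%:E * m2P Gp + (w ^+ 2)%:E * m2P Gm)%E.
  rewrite pull; last 2 first.
  - by apply/measurable_EFinP; exact: measurable_funM.
  - by move=> x; rewrite lee_fin mulr_ge0// sqr_ge0.
  rewrite -(sq _ phi nGp upos) -(sq _ (fun p => - phi p) nGm uneg); congr (_ + _)%E.
    by apply: eq_integral => p _; rewrite -EFinM /Gp; congr EFin; ring.
  by apply: eq_integral => p _; rewrite -EFinM /Gm; congr EFin; ring.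
have EJ : (\int[lebesgue_rV R m.+1]_z (Om (dotv z z) * (dotv z u ^+ 2)%:E) =
    (w ^+ 2)%:E * JP m Om + (w ^+ 2)%:E * JP m Om)%E.
  have mOd : measurable_fun setT (fun z : 'rV[R]_m.+1 => Om (dotv z z)).
    by apply: (measurableT_comp mOm); exact: measurable_dotv.
  rewrite pull; last 2 first.
  - by apply: emeasurable_funM => //; exact/measurable_EFinP.
  - by move=> x; rewrite mule_ge0// lee_fin sqr_ge0.
  have JE : ((w ^+ 2)%:E * JP m Om = \int[muP m]_p
      (Om (bilP p p) * ((w * p.1) ^+ 2)%:E * ((0 < p.1)%R%:R)%:E))%E.
    rewrite /JP -ge0_integralZl_EFin//; last 3 first.
    - by move=> p _; rewrite mule_ge0// lee_fin sqr_ge0.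
    - apply: emeasurable_funM.
        apply: (measurableT_comp mOm); apply: measurable_funD; first exact: measurable_funM.
        exact: measurable_dotv.
      by apply/measurable_EFinP; exact: (measurableT_comp (@measurable_max0 R) m1).
    - exact: sqr_ge0.
    apply: eq_integral => p _; rewrite muleCA -EFinM -muleA -EFinM; congr (_ * _%:E)%E.
    by case: (ltP 0 p.1) => p0; rewrite ?expr0n/= ?mulr0 ?mulr1 ?exprMn.
  rewrite JE; congr (_ + _)%E; apply: eq_integral => p _.
    by rewrite dphi upos.
  by rewrite dotvNl dotvNr opprK dphi uneg.
(* Polarization: the directions [e b] with [b = 1] and [b = -1] have the same squared length 2, so
   isotropy and evenness give [int Fp (r + b x_j)^2 = S] for both. *)
have cF : centeredP Fp.
  move=> j.
  pose e (b : R) : P m := (1, b *: delta_mx 0 j).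
  have bile b p : bilP p (e b) = p.1 + b * p.2 0 j.
    rewrite /bilP/= mulr1 dotvZr; congr (_ + b * _).
    rewrite /dotv (bigD1 j)//= big1 ?addr0 ?mxE ?eqxx ?mulr1// => i ij.
    by rewrite mxE eqxx (negbTE ij) mulr0.
  have Tb b : b ^+ 2 = 1 -> (\int[muP m]_p (Fp p * (p.1 + b * p.2 0 j) ^+ 2)%:E = S%:E)%E.
    move=> b1; set T := integral _ _ _.
    have := SF (phi (e b)).
    rewrite dphi bile/= !mxE !eqxx/= mulr1 -expr2 b1 pull; last 2 first.
    - by apply/measurable_EFinP; exact: measurable_funM.
    - by move=> x; rewrite lee_fin mulr_ge0// sqr_ge0.
    rewrite (_ : integral _ _ _ = T); last first.
      by apply: eq_integral => p _; rewrite -EFinM dphi bile /Fp; congr EFin; ring.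
    rewrite (_ : integral _ _ (fun p => _) = T); last first.
      apply: eq_integral => p _; rewrite -EFinM dotvNl dphi bile evF /Fp; congr EFin; ring.
    move=> TT; have T0 : (0 <= T)%E.
      by apply: integral_ge0 => p _; rewrite lee_fin mulr_ge0// sqr_ge0.
    have Tf : T \is a fin_num.
      by rewrite ge0_fin_numE// (@le_lt_trans _ _ (T + T)%E) ?leeDl// TT ltry.
    move: TT; rewrite -(fineK Tf) -EFinD => TT; have := congr1 fine TT; rewrite /= => {}TT.
    by congr EFin; lra.
  have max0 (a : R) : 0 <= Num.max a 0 by rewrite le_max lexx orbT.
  have mj : measurable_fun setT (fun p : P m => p.2 0 j).
    exact: measurableT_comp (measurable_rV_coord j) m2.
  have mC (x : P m -> R) : measurable_fun setT x ->
      measurable_fun setT (fun p => (Fp p * (Num.max p.1 0 * Num.max (x p) 0))%:E).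
    move=> mx; apply/measurable_EFinP; apply: measurable_funM => //.
    by apply: measurable_funM; exact: measurable_maxr.
  have mT b : measurable_fun setT (fun p => (Fp p * (p.1 + b * p.2 0 j) ^+ 2)%:E).
    apply/measurable_EFinP; apply: measurable_funM => //; apply: measurable_funX.
    by apply: measurable_funD => //; exact: measurable_funM.
  have mjN : measurable_fun setT (fun p : P m => - p.2 0 j) by exact: measurable_funN.
  set C1 := integral _ _ _; set C2 := integral _ _ _.
  have sum b (x : P m -> R) : b ^+ 2 = 1 -> measurable_fun setT x ->
      (S%:E + 4%:E * \int[muP m]_p (Fp p * (Num.max p.1 0 * Num.max (x p) 0))%:E =
       \int[muP m]_p (Fp p * ((p.1 + b * p.2 0 j) ^+ 2 + 4 * (Num.max p.1 0 * Num.max (x p) 0)))%:E)%E.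
    move=> b1 mx; rewrite -(Tb b b1) -ge0_integralZl_EFin//; last 2 first.
    - by move=> p _; rewrite lee_fin !mulr_ge0.
    - exact: mC.
    rewrite -ge0_integralD//.
    - by apply: eq_integral => p _; rewrite -EFinM -EFinD; congr EFin; ring.
    - by move=> p _; rewrite lee_fin mulr_ge0// sqr_ge0.
    - by move=> p _; rewrite mule_ge0// lee_fin !mulr_ge0.
    - by apply: emeasurable_funM => //; exact: mC.
  (* For [r > 0], [(r - x)^2 + 4 r max(x, 0) = (r + x)^2 + 4 r max(-x, 0)]. Integrating this
     compares the two signed parts without a subtraction, and the finite number [S] then cancels. *)
  have CC : (S%:E + 4%:E * C1 = S%:E + 4%:E * C2)%E.
    rewrite (sum (-1) (fun p => p.2 0 j))//; last by rewrite sqrrN expr1n.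
    rewrite (sum 1 (fun p => - p.2 0 j))//; last by rewrite expr1n.
    apply: eq_integral => p _; congr EFin; rewrite /Fp.
    case: (ltP 0 p.1) => p0; last by rewrite !mulr0 !mul0r.
    congr (_ * _).
    by case: (leP 0 (p.2 0 j)); case: (leP 0 (- p.2 0 j)); nra.
  have {}CC : (4%:E * C1 = 4%:E * C2)%E.
    by have := congr1 (fun z => z - S%:E)%E CC; rewrite ![(S%:E + _)%E]addeC !addeK.
  have := congr1 (fun z => (4^-1)%:E * z)%E CC.
  by rewrite !muleA -!EFinM mulVf// !mul1e.
have neg_bil p q : bilP (oppP p) (oppP q) = bilP p q.
  by rewrite /bilP/= mulrNN dotvNl dotvNr opprK.
have hp : (m2P Fp * m2P Gp <= JP m Om ^+ 2)%E.
  apply: santalo_all => // p q pq; rewrite -dphi.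
  apply: le_trans (FG _ _ _); last by rewrite dphi.
  by rewrite lee_fin ler_pM// ?mulr_ge0// ler_piMr// lern1 leq_b1.
have hm : (m2P Fp * m2P Gm <= JP m Om ^+ 2)%E.
  apply: santalo_all => // p q pq.
  have pqN : dotv (- phi p) (- phi q) = bilP p q by rewrite dotvNl dotvNr opprK dphi.
  rewrite -pqN; apply: le_trans (FG _ _ _); last by rewrite pqN.
  by rewrite lee_fin evF ler_pM// ?mulr_ge0// ler_piMr// lern1 leq_b1.
rewrite EF EG EJ.
set A := m2P Fp in hp hm *; set B1 := m2P Gp in hp *; set B2 := m2P Gm in hm *.
set J := JP m Om in hp hm *.
have nn k : niceP k -> (0 <= m2P k)%E.
  by move=> [_ k0 _]; apply: integral_ge0 => p _; rewrite lee_fin mulr_ge0// sqr_ge0.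
have [A0 B10 B20] : [/\ 0 <= A, 0 <= B1 & 0 <= B2]%E by split; exact: nn.
have J0 : (0 <= J)%E.
  by apply: integral_ge0 => p _; rewrite mule_ge0// lee_fin sqr_ge0.
have c0 : (0 <= (w ^+ 2)%:E)%E by rewrite lee_fin sqr_ge0.
rewrite -!ge0_muleDr//; set c := (w ^+ 2)%:E in c0 *.
rewrite expe2 muleACA [leRHS]muleACA; apply: lee_wpmul2l; first exact: mule_ge0.
have AJ : (A * (B1 + B2) <= J * (J + J))%E.
  by rewrite ge0_muleDr// [leRHS]ge0_muleDr// -expe2; apply: leeD.
by rewrite ge0_muleDl// [leRHS]ge0_muleDl//; apply: leeD.
Qed.

End even.

(** * Truncations *)

Section levels.
Context {R : realType}.
Notation leb := (@lebesgue_measure R).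

Lemma ae_between (p : R -> Prop) (a b : R) : {ae leb, forall r, p r} -> a < b ->
  exists r, [/\ a < r, r < b & p r].
Proof.
move=> [N [mN N0 sub]] ab; apply: contrapT => np.
have : (leb `]a, b[%classic <= leb N)%E.
  apply: le_measure; rewrite ?inE//.
  move=> r /=; rewrite in_itv/= => /andP[ar rb]; apply: sub => pr; apply: np.
  by exists r.
rewrite N0; have /= -> := lebesgue_measure_itv `]a, b[.
by rewrite lte_fin ab -EFinB lee_fin subr_le0 leNgt ab.
Qed.

(** Multiplication by [b = +oo] is not continuous at 0; in that case either [c = +oo] or every
    [a_ i] vanishes. *)
Lemma cvg_le_mulr (a_ : nat -> \bar R) (a b c : \bar R) : a_ @ \oo --> a ->
  (forall i, 0 <= a_ i)%E -> (0 <= b)%E -> (forall i, a_ i * b <= c)%E -> (a * b <= c)%E.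
Proof.
move=> aa a0 b0 ac.
have [bf|/eqP boo] := boolP (b \is a fin_num).
  have := cvgeZr bf aa; move/cvge_to_le; apply.
  by apply: nearW => i; exact: ac.
have {}boo : b = +oo%E by case: b b0 ac boo => [r|//|] //; rewrite fin_numE.
have [c0|c0] := leP +oo%E c; first by rewrite (le_trans (leey _)).
have a_0 i : a_ i = 0%E.
  have [ai|ai] := leP (a_ i) 0%E; first by apply/eqP; rewrite eq_le ai a0.
  by have := ac i; rewrite boo gt0_muley// leNgt c0.
have -> : a = 0%E.
  by apply: cvg_unique aa _ => //; rewrite (_ : a_ = cst 0%E); [exact: cvg_cst|exact/funext].
by rewrite mul0e (le_trans _ (ac 0%N))// a_0 mul0e.
Qed.

Context {n : nat}.
Notation lam := (lebesgue_rV R n).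

Lemma cvg_integral_weight (h_ : nat -> 'rV[R]_n -> R) (h w : 'rV[R]_n -> R) :
  (forall i, measurable_fun setT (h_ i)) -> (forall i x, 0 <= h_ i x) ->
  (forall x, {homo h_^~ x : i j / (i <= j)%N >-> i <= j}) ->
  (forall x, h_ i x @[i --> \oo] --> h x) ->
  measurable_fun setT w -> (forall x, 0 <= w x) ->
  (\int[lam]_x (h_ i x * w x)%:E @[i --> \oo] --> \int[lam]_x (h x * w x)%:E)%E.
Proof.
move=> mh h0 hnd hcvg mw w0.
rewrite [X in _ --> X](_ : _ = \int[lam]_x limn (fun i => (h_ i x * w x)%:E))%E; last first.
  apply: eq_integral => x _; apply/esym/cvg_lim => //.
  by apply: cvg_EFin; [exact: nearW|apply: cvgM => //; exact: cvg_cst].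
apply: cvg_monotone_convergence => //.
- by move=> i; apply/measurable_EFinP; exact: measurable_funM.
- by move=> i x _; rewrite lee_fin mulr_ge0.
- by move=> x _ i j ij; rewrite lee_fin ler_wpM2r// hnd.
Qed.

Lemma dotv_eq0 (x : 'rV[R]_n) : dotv x x = 0 -> x = 0.
Proof.
move=> x0; apply/rowP => i; rewrite mxE; apply/eqP; rewrite -sqrf_eq0 eq_le sqr_ge0 andbT.
rewrite -x0 /dotv (bigD1 i)//= -expr2 lerDl; apply: sumr_ge0 => j _.
by rewrite -expr2 sqr_ge0.
Qed.

Lemma isotropicZ (K : set 'rV[R]_n) th : measurable K -> isotropic_convex_body K ->
  (\int[lam]_(x in K) (dotv x th ^+ 2)%:E =
   (dotv th th / n%:R)%:E * \int[lam]_(x in K) (dotv x x)%:E)%E.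
Proof.
move=> mK [_ _ _ _ iK].
have -> : (\int[lam]_(x in K) (dotv x x)%:E = \int[lam]_(x in K) (enorm x ^+ 2)%:E)%E.
  by apply: eq_integral => x _; rewrite enorm_sqr.
have [th0|th0] := eqVneq (dotv th th) 0.
  rewrite th0 mul0r mul0e integral0_eq// => x _.
  by rewrite (dotv_eq0 th0) -(scale0r 0) dotvZr mul0r expr0n.
have d0 : 0 < dotv th th by rewrite lt_def th0 dotv_ge0.
have N0 : enorm th != 0 by rewrite -sqrf_eq0 enorm_sqr.
have := iK ((enorm th)^-1 *: th).
rewrite {1}/enorm dotvZl dotvZr mulrA -expr2 exprVn enorm_sqr mulVf// sqrtr1 => /(_ erefl) iK1.
rewrite EFinM -muleA -iK1 -ge0_integralZl_EFin//; last 3 first.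
- by move=> x _; rewrite lee_fin sqr_ge0.
- apply/measurable_EFinP; apply: measurable_funTS; apply: measurable_funX.
  exact: measurable_dotv.
- exact: ltW.
apply: eq_integral => x _; rewrite dotvZr -EFinM exprMn exprVn enorm_sqr.
by rewrite mulrA mulfV// mul1r.
Qed.

Lemma niceV_integrable (h : 'rV[R]_n -> R) : niceV h ->
  lam.-integrable setT (fun x => (h x * dotv x x)%:E).
Proof.
move=> [mh h0 [B hB]].
have B0 : 0 <= B by have [+ _] := hB 0; exact: le_trans.
have mX : measurable (cubeV n B) := @measurable_cubeV R n B.
have fX : (lam (cubeV n B) < +oo)%E.
  rewrite /cubeV (@lebesgue_rV_box R n (fun _ => symI B)); last by move=> i; exact: measurable_symI.
  rewrite -ge0_fin_numE; last by apply: prode_ge0 => i _; exact: measure_ge0.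
  by elim/big_ind: _ => // [x y xf yf|_ _]; [rewrite fin_numM|exact: fin_symI].
have hX x : h x != 0 -> cubeV n B x by move=> /(hB _).2 xB i; exact/symIE.
have mhd : measurable_fun setT (fun x : 'rV[R]_n => h x * dotv x x).
  by apply: measurable_funM => //; exact: measurable_dotv.
have : lam.-integrable (cubeV n B) (EFin \o (fun x => h x * dotv x x)).
  apply: measurable_bounded_integrable => //; first exact: measurable_funTS.
  exists (B * (n%:R * (B * B))); split; first exact: num_real.
  move=> N /ltW BN x Xx /=; apply: le_trans BN; rewrite normrM ler_pM//.
    by rewrite ger0_norm//; have [] := hB x.
  by apply: dotv_bound => // i; exact/symIE.
rewrite integrable_mkcond//; congr (_.-integrable _ _).
apply/funext => x; rewrite patchE; case: ifPn => // xX.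
by have [->|/hX/mem_set] := eqVneq (h x) 0; [rewrite mul0r|rewrite (negbTE xX)].
Qed.

Section truncation.
Variables (f : 'rV[R]_n -> R) (e c : R).
Hypotheses (mf : measurable_fun setT f) (e0 : 0 < e).

(** The length of the set of heights [t] in []e, c[] with [t <= f x]. The cut at [e > 0] puts the
    support inside one isotropic level, which is compact; [c] will be at most the essential
    supremum, beyond which the levels are not controlled. *)
Definition trunc x := Num.max (Num.min (f x) c - e) 0.

Lemma measurable_trunc : measurable_fun setT trunc.
Proof.
apply: measurable_maxr => //; apply: measurable_funB => //.
exact: measurable_minr.
Qed.

Lemma trunc_ge0 x : 0 <= trunc x. Proof. by rewrite /trunc le_max lexx orbT. Qed.

Let E := [set q : 'rV[R]_n * measurableTypeR R | [/\ e < q.2, q.2 < c & q.2 <= f q.1]].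

Let mE : measurable E.
Proof.
have m1 : measurable_fun setT (fun q : 'rV[R]_n * measurableTypeR R => f q.1).
  exact: measurableT_comp mf measurable_fst.
have m2 : measurable_fun setT (fun q : 'rV[R]_n * measurableTypeR R => q.2 : R).
  exact: measurable_snd.
have -> : E = [set q | e < q.2] `&` ([set q | q.2 < c] `&` [set q | q.2 <= f q.1]).
  by apply/seteqP; split=> q /=; [case|case=> ? []].
apply: measurableI; last apply: measurableI; rewrite -[X in measurable X]setTI.
- rewrite (_ : [set q | _] = [set q | (e%:E < q.2%:E)%E]).
    by apply: measurable_lte => //; exact/measurable_EFinP.
  by apply/seteqP; split=> q /=; rewrite lte_fin.
- rewrite (_ : [set q | _] = [set q | (q.2%:E < c%:E)%E]).
    by apply: measurable_lte => //; exact/measurable_EFinP.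
  by apply/seteqP; split=> q /=; rewrite lte_fin.
- rewrite (_ : [set q | _] = [set q | (q.2%:E <= (f q.1)%:E)%E]).
    by apply: measurable_lee => //; exact/measurable_EFinP.
  by apply/seteqP; split=> q /=; rewrite lee_fin.
Qed.

Let H (w : 'rV[R]_n -> R) t := (\int[lam]_x (w x * \1_E (x, t))%:E)%E.

Let mwE (w : 'rV[R]_n -> R) : measurable_fun setT w ->
  measurable_fun setT (fun q : 'rV[R]_n * measurableTypeR R => (w q.1 * \1_E q)%:E).
Proof.
move=> mw; apply/measurable_EFinP; apply: measurable_funM.
  exact: measurableT_comp mw measurable_fst.
exact: measurable_indic.
Qed.

Let mH (w : 'rV[R]_n -> R) : measurable_fun setT w -> (forall x, 0 <= w x) -> measurable_fun setT (H w).
Proof.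
move=> mw w0; apply: (measurable_fun_fubini_tonelli_G (m1 := lam) _ (mwE mw)) => q.
by rewrite lee_fin mulr_ge0.
Qed.

(** The layer cake with closed levels, because these are the sets assumed to be isotropic. *)
Let layers (w : 'rV[R]_n -> R) : measurable_fun setT w -> (forall x, 0 <= w x) ->
  (\int[lam]_x (trunc x * w x)%:E = \int[leb]_t H w t)%E.
Proof.
move=> mw w0.
rewrite -(fubini_tonelli (m1 := lam) (m2 := leb) _ (mwE mw)) => [|q]; last first.
  by rewrite lee_fin mulr_ge0.
apply: eq_integral => x _.
rewrite (_ : (fun _ => _) = fun t => (w x)%:E * (\1_E (x, t))%:E)%E; last exact/funext.
rewrite ge0_integralZl_EFin//; last first.
  apply/measurable_EFinP.
  exact: (measurableT_comp (measurable_indic mE) (pair1_measurable x)).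
rewrite EFinM muleC; congr (_ * _)%E.
transitivity (leb (xsection E x)); last first.
  have mEx : measurable (xsection E x) by exact: measurable_xsection.
  have := integral_indic leb measurableT mEx; rewrite setIT => <-.
  by apply: eq_integral => t _; rewrite !indicE mem_xsection.
have [fc|cf] := ltP (f x) c; rewrite /trunc.
  rewrite (_ : xsection E x = `]e, f x]%classic).
    have /= -> := lebesgue_measure_itv `]e, f x].
    rewrite lte_fin; case: (ltP e (f x)) => efx; rewrite (min_idPl (ltW fc)).
      by rewrite -EFinB max_l// subr_ge0 ltW.
    by rewrite max_r// subr_le0.
  apply/seteqP; split=> t; rewrite /xsection/= inE/= in_itv/=.
    by move=> [-> _ ->].
  by move=> /andP[et tf]; split => //; exact: le_lt_trans fc.
rewrite (_ : xsection E x = `]e, c[%classic).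
  have /= -> := lebesgue_measure_itv `]e, c[.
  rewrite lte_fin; case: (ltP e c) => ec; rewrite (min_idPr cf).
    by rewrite -EFinB max_l// subr_ge0 ltW.
  by rewrite max_r// subr_le0.
apply/seteqP; split=> t; rewrite /xsection/= inE/= in_itv/=.
  by move=> [-> -> _].
by move=> /andP[et tc]; split => //; exact: le_trans (ltW tc) cf.
Qed.

Hypothesis levels_iso : {ae leb, forall r, 0 < r -> r < c -> isotropic_convex_body [set x | r <= f x]}.

(** If [trunc (- y) < trunc y], there is a height between the two, raised by [e], whose level is
    isotropic; it contains [y] but not [- y], although it is symmetric. So evenness holds at every
    point, not only almost everywhere. *)
Lemma truncN x : trunc (- x) = trunc x.
Proof.
suff le y : trunc y <= trunc (- y).
  by apply/eqP; rewrite eq_le le andbT -{2}[x]opprK le.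
rewrite leNgt; apply/negP => lt.
have lte : trunc (- y) + e < trunc y + e by rewrite ltrD2r.
have [r [ar rb]] := ae_between levels_iso lte.
have a0 : 0 <= trunc (- y) by exact: trunc_ge0.
have r0 : 0 < r by apply: lt_trans ar; rewrite ltr_wpDl.
have b0 : 0 < trunc y by exact: le_lt_trans lt.
have yE : trunc y = Num.min (f y) c - e.
  by move: b0; rewrite /trunc lt_max ltxx orbF => b0; rewrite max_l// ltW.
have : r < Num.min (f y) c by lra.
rewrite lt_min => /andP[rf rc] /(_ r0 rc)[symK _ _ _ _].
have : [set x | r <= f x] (- y) by rewrite -symK; exists y => //=; exact: ltW.
move=> /= rNy; suff : r <= Num.min (f (- y)) c.
  have : Num.min (f (- y)) c - e <= trunc (- y) by rewrite /trunc le_max lexx.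
  by lra.
by rewrite le_min rNy ltW.
Qed.

Lemma niceV_trunc : niceV trunc.
Proof.
split; [exact: measurable_trunc|exact: trunc_ge0|].
have tc x : trunc x <= `|c|.
  rewrite /trunc ge_max normr_ge0 andbT lerBlDr (le_trans _ (lerD (ler_norm c) (ltW e0)))//.
  by rewrite addr0 ge_min lexx orbT.
have [ce|ec] := leP c e.
  exists `|c| => x; split=> //; rewrite /trunc max_r ?eqxx//.
  by rewrite subr_le0 (le_trans _ ce)// ge_min lexx orbT.
(* A compact level at some height [r < e] contains the support of [trunc]. *)
have [r [r0 re /(_ r0 (lt_trans re ec))[_ _ cK _ _]]] := ae_between levels_iso e0.
have [M [Mr MK]] := compact_bounded cK.
exists (`|c| + (`|M| + 1)) => x; split.
  by rewrite (le_trans (tc x))// lerDl addr_ge0.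
move=> tx i.
have Kx : r <= f x.
  have : 0 < trunc x by rewrite lt_def tx trunc_ge0.
  rewrite /trunc lt_max ltxx orbF subr_gt0 lt_min => /andP[ef _].
  exact: ltW (lt_trans re ef).
apply: (@le_trans _ _ `|x|).
  rewrite [leRHS]/Num.norm /= mx_normrE; apply/bigmax_geP; right.
  by exists (0, i).
apply: (MK (`|c| + (`|M| + 1))) Kx.
by rewrite ltr_wpDl// (le_lt_trans (ler_norm M))// ltrDl.
Qed.

(** Almost every layer satisfies [isotropicZ], and the identity is linear in the layers. [S] is
    finite because [trunc] is bounded with bounded support. *)
Lemma trunc_isotropic : exists S, forall th,
  (\int[lam]_x (trunc x * dotv x th ^+ 2)%:E = (dotv th th * S)%:E)%E.
Proof.
have mdd : measurable_fun setT (fun x : 'rV[R]_n => dotv x x) by exact: measurable_dotv.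
have Sfin : (\int[lam]_x (trunc x * dotv x x)%:E)%E \is a fin_num.
  apply: integrable_fin_num => //; exact: (niceV_integrable niceV_trunc).
exists (n%:R^-1 * fine (\int[lam]_x (trunc x * dotv x x)%:E)%E) => th.
have mdth : measurable_fun setT (fun x : 'rV[R]_n => dotv x th ^+ 2).
  by apply: measurable_funX; exact: measurable_dotv.
rewrite mulrA EFinM fineK// !layers//; last 2 first.
- by move=> x; exact: dotv_ge0.
- by move=> x; exact: sqr_ge0.
rewrite -ge0_integralZl_EFin//; last 3 first.
- by move=> t _; apply: integral_ge0 => x _; rewrite lee_fin mulr_ge0// dotv_ge0.
- by apply: mH => // x; exact: dotv_ge0.
- by rewrite mulr_ge0// dotv_ge0.
apply: ge0_ae_eq_integral => //.
- by apply: mH => // x; exact: sqr_ge0.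
- by apply: emeasurable_funM => //; apply: mH => // x; exact: dotv_ge0.
- by move=> t _; apply: integral_ge0 => x _; rewrite lee_fin mulr_ge0// sqr_ge0.
- move=> t _; rewrite mule_ge0// ?lee_fin ?mulr_ge0 ?dotv_ge0//.
  by apply: integral_ge0 => x _; rewrite lee_fin mulr_ge0// dotv_ge0.
have [N [mN N0 sub]] := levels_iso.
exists N; split=> // t nt; apply: sub => tiso; apply: nt => _ /=.
have mK : measurable [set x | t <= f x].
  rewrite (_ : [set x | _] = setT `&` f @^-1` `[t, +oo[%classic).
    by apply: mf => //; exact: measurable_itv.
  by rewrite setTI; apply/seteqP; split=> x /=; rewrite in_itv/= andbT.
have [/andP[et tc]|etc] := boolP ((e < t) && (t < c)).
  have HE (w : 'rV[R]_n -> R) : H w t = (\int[lam]_(x in [set x | (t <= f x)%R]) (w x)%:E)%E.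
    rewrite [RHS]integral_mkcond; apply: eq_integral => x _.
    rewrite patchE indicE; case: ifPn; rewrite !(inE, notin_setE) => tx.
      by rewrite mem_set ?mulr1.
    by rewrite memNset ?mulr0// => -[].
  by rewrite !HE isotropicZ//; exact: tiso (lt_trans e0 et) tc.
have H0 w : H w t = 0%E.
  apply: integral0_eq => x _; rewrite indicE memNset ?mulr0// => -[/= et tc _].
  by rewrite et tc in etc.
by rewrite !H0 mule0.
Qed.

End truncation.

Lemma trunc_cvg (f : 'rV[R]_n -> R) (c : nat -> R) x (l : R) : 0 <= f x -> (forall j, 0 <= c j) ->
  (fun j => Num.min (f x) (c j)) @ \oo --> l ->
  (fun j => trunc f (harmonic j) (c j) x) @ \oo --> l.
Proof.
move=> f0 c0 fl; apply: (squeeze_cvgr (f := fun j => Num.min (f x) (c j) - harmonic j)); last exact: fl.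
  apply: nearW => j; rewrite /trunc le_max lexx/= ge_max lerBlDr lerDl invr_ge0 ler0n/=.
  by rewrite le_min f0 c0.
by rewrite -[l]subr0; apply: cvgB => //; exact: cvg_harmonic.
Qed.

Lemma trunc_nondecreasing (f : 'rV[R]_n -> R) (c : nat -> R) x :
  {homo c : i j / (i <= j)%N >-> i <= j} ->
  {homo (fun j => trunc f (harmonic j) (c j) x) : i j / (i <= j)%N >-> i <= j}.
Proof.
move=> cnd i j ij; rewrite /trunc le_max2// lerB//; first by rewrite le_min2// cnd.
by rewrite lef_pV2 ?posrE// ler_nat.
Qed.

(** [f] may exceed its essential supremum on a null set. If the supremum is finite, [c] is constant
    and [h] is [f] cut at that height; otherwise [c j] is [j] and [h] is [f]. *)
Lemma ess_levels (f : 'rV[R]_n -> R) : measurable_fun setT f -> (forall x, 0 <= f x) ->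
  exists c h, [/\ measurable_fun setT h, {ae lam, forall x, f x = h x},
    forall j, 0 <= c j /\ ((c j)%:E <= 'N[lam]_+oo[EFin \o f])%E,
    {homo c : i j / (i <= j)%N >-> i <= j} &
    forall x, (fun j => Num.min (f x) (c j)) @ \oo --> h x].
Proof.
move=> mf f0; have := Lnorm_ge0 lam +oo%E (EFin \o f).
have leM : {ae lam, forall x, ((f x)%:E <= 'N[lam]_+oo[EFin \o f])%E}.
  (* The norm is defined by cases; if the whole space has measure 0, everything holds almost
     everywhere. *)
  rewrite unlock/=; case: ltP => [_|mu0].
    have [N [mN N0 sub]] := ess_sup_ge lam (abse \o (EFin \o f)).
    exists N; split=> // x nx; apply: sub => le; apply: nx.
    by apply: le_trans le; rewrite /= lee_fin ler_norm.
  exists setT; split=> //; apply/eqP; rewrite eq_le mu0/=; exact: measure_ge0.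
move: leM; case: ('N[lam]_+oo[EFin \o f])%E => [r leM r0|_ _|//].
  exists (cst r), (fun x => Num.min (f x) r); split=> //.
  - exact: measurable_minr.
  - have [N [mN N0 sub]] := leM; exists N; split=> // x nx; apply: sub => le; apply: nx.
    by apply/esym/min_idPl; rewrite -lee_fin.
  - by move=> x; apply: cvg_near_cst; exact: nearW.
exists (fun j => j%:R), f; split=> //.
- exact: aeW.
- by move=> j; rewrite leey.
- by move=> i j ij; rewrite ler_nat.
- move=> x; apply: cvg_near_cst; near=> j; apply/min_idPl.
  near: j; exact: nbhs_infty_ger.
Unshelve. all: by end_near.
Qed.

End levels.

(** * Passage to the limit *)

Lemma capped_nice (R : realType) n (g : 'rV[R]_n -> R) : measurable_fun setT g ->
  (forall y, 0 <= g y) ->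
  exists g_ : nat -> 'rV[R]_n -> R, [/\ forall j, niceV (g_ j), forall j y, g_ j y <= g y,
    forall y, {homo g_^~ y : i j / (i <= j)%N >-> i <= j} &
    forall y, (fun j => g_ j y) @ \oo --> g y].
Proof.
move=> mg g0.
pose g_ j y := Num.min (g y) j%:R * \1_(cubeV n (j%:R : R)) y.
have gm0 j y : 0 <= Num.min (g y) j%:R by rewrite le_min g0/=.
have i01 (A : set 'rV[R]_n) y : \1_A y <= 1 :> R by rewrite indicE lern1 leq_b1.
exists g_; split.
- move=> j; split.
  + apply: measurable_funM; first exact: measurable_minr.
    by apply: measurable_indic; exact: measurable_cubeV.
  + by move=> y; rewrite mulr_ge0.
  + exists j%:R => y; split.
      by rewrite /g_ (le_trans (ler_piMr _ _))// ge_min lexx orbT.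
    rewrite /g_ indicE; case: (boolP (y \in _)) => [/set_mem yj _ i|_]; last by rewrite mulr0 eqxx.
    exact/symIE.
- by move=> j y; rewrite /g_ (le_trans (ler_piMr _ _))// ge_min lexx.
- move=> y i j ij; have ijR : i%:R <= j%:R :> R by rewrite ler_nat.
  rewrite /g_ ler_pM// ?le_min2//.
  rewrite !indicE ler_nat; case: (boolP (y \in _)) => // /set_mem yi.
  by rewrite mem_set// => k; apply/symIE; apply: le_trans ijR; exact/symIE.
- move=> y; apply: cvg_near_cst.
  have [A A0 yA] := rV_bound y.
  near=> j; rewrite /g_ indicE mem_set ?mulr1; last first.
    move=> i; apply/symIE; rewrite (le_trans (yA i))//.
    near: j; exact: nbhs_infty_ger.
  apply/min_idPl; near: j; exact: nbhs_infty_ger.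
Unshelve. all: by end_near.
Qed.

(** The truncations increase to [h] and [g] and stay below [f] and [g], so the pairing bound holds
    for them with the same [Om]. Monotone convergence, one factor at a time, removes them. *)
Lemma santalo_isotropic (R : realType) n (f g : 'rV[R]_n.+1 -> R) (Om : R -> \bar R) u :
  isotropic_level_fun f -> measurable_fun setT g -> (forall y, 0 <= g y) ->
  measurable_fun setT Om -> (forall t, 0 <= Om t)%E ->
  (forall x y, 0 < dotv x y -> ((f x * g y)%:E <= Om (dotv x y) ^+ 2)%E) ->
  ((\int[lebesgue_rV R n.+1]_x (f x * dotv x u ^+ 2)%:E) *
   (\int[lebesgue_rV R n.+1]_y (g y * dotv y u ^+ 2)%:E) <=
   (\int[lebesgue_rV R n.+1]_z (Om (dotv z z) * (dotv z u ^+ 2)%:E)) ^+ 2)%E.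
Proof.
move=> [mf f0 fiso] mg g0 mOm Om0 fg.
have mdu : measurable_fun setT (fun x : 'rV[R]_n.+1 => dotv x u ^+ 2).
  by apply: measurable_funX; exact: measurable_dotv.
have du0 (x : 'rV[R]_n.+1) : 0 <= dotv x u ^+ 2 by exact: sqr_ge0.
have int0 (h : 'rV[R]_n.+1 -> R) : (forall x, 0 <= h x) ->
    (0 <= \int[lebesgue_rV R n.+1]_x (h x * dotv x u ^+ 2)%:E)%E.
  by move=> h0; apply: integral_ge0 => x _; rewrite lee_fin mulr_ge0.
have [c [h [mh [N [mN N0 sub]] cM cnd fh]]] := ess_levels mf f0.
have c0 j : 0 <= c j by have [] := cM j.
have h0 x : 0 <= h x.
  by apply: (cvgr_to_ge (fh x)); apply: nearW => j; rewrite le_min f0 c0.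
have [g_ [nG gle gnd gcvg]] := capped_nice mg g0.
pose F j := trunc f (harmonic j) (c j).
have F0 j x : 0 <= F j x by exact: trunc_ge0.
have e0 j : 0 < harmonic j :> R by rewrite /= invr_gt0.
have Fle j x : F j x <= f x.
  rewrite /F /trunc ge_max f0 andbT lerBlDr (@le_trans _ _ (f x))//; last by rewrite lerDl ltW.
  by rewrite ge_min lexx.
have lev j : {ae @lebesgue_measure R, forall r, 0 < r -> r < c j ->
    isotropic_convex_body [set x | r <= f x]}.
  have [L [mL L0 subL]] := fiso; exists L; split=> // r nr; apply: subL => riso; apply: nr.
  move=> r0 rc; apply: riso => //; apply: lt_le_trans (cM j).2.
  by rewrite lte_fin.
have nF j : niceV (F j) by apply: niceV_trunc.
rewrite (_ : \int[_]_x (f x * _)%:E = \int[lebesgue_rV R n.+1]_x (h x * dotv x u ^+ 2)%:E)%E; last first.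
  apply: ge0_ae_eq_integral => //.
  - by apply/measurable_EFinP; exact: measurable_funM.
  - by apply/measurable_EFinP; exact: measurable_funM.
  - by move=> x _; rewrite lee_fin mulr_ge0.
  - by move=> x _; rewrite lee_fin mulr_ge0.
  - by exists N; split=> // x nx; apply: sub => fhx; apply: nx => _; rewrite fhx.
have cF : (\int[lebesgue_rV R n.+1]_x (F j x * dotv x u ^+ 2)%:E @[j --> \oo] -->
    \int[lebesgue_rV R n.+1]_x (h x * dotv x u ^+ 2)%:E)%E.
  apply: cvg_integral_weight => //.
  - by move=> j; case: (nF j).
  - by move=> x; exact: trunc_nondecreasing.
  - by move=> x; exact: trunc_cvg.
have cG : (\int[lebesgue_rV R n.+1]_x (g_ j x * dotv x u ^+ 2)%:E @[j --> \oo] -->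
    \int[lebesgue_rV R n.+1]_x (g x * dotv x u ^+ 2)%:E)%E.
  apply: cvg_integral_weight => //.
  - by move=> j; case: (nG j).
  - by move=> j x; case: (nG j).
apply: (cvg_le_mulr cF) => [i||i]; [exact: int0|exact: int0|].
rewrite muleC; apply: (cvg_le_mulr cG) => [j||j]; [|exact: int0|].
  by apply: int0 => x; case: (nG j).
rewrite muleC; have [S isoS] := trunc_isotropic mf (e0 i) (lev i).
apply: (santalo_even u (nF i) (nG j) (truncN (e0 i) (lev i)) isoS) => //.
move=> x y xy; apply: le_trans (fg x y xy); rewrite lee_fin ler_pM//.
by case: (nG j).
Qed.

(* Only the values of Omega on ]0, +oo[ matter: in the last integral the point
   z = 0, where Omega is evaluated outside its domain, has integrand 0. *)
Theorem theorem1p4 (R : realType) (n : nat) (u : 'rV[R]_n)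
    (f : 'rV[R]_n -> R) (f_iso : isotropic_level_fun f)
    (g : 'rV[R]_n -> R)
    (g_meas : measurable_fun [set: 'rV[R]_n] g)
    (g_ge0 : forall y, 0 <= g y)
    (Omega : R -> R)
    (Omega_meas : measurable_fun [set t : R | 0 < t] Omega)
    (Omega_gt0 : forall t : R, 0 < t -> 0 < Omega t)
    (Omega_noninc : forall s t : R, 0 < s -> s <= t -> Omega t <= Omega s)
    (fg_le : forall x y : 'rV[R]_n, 0 < dotv x y ->
      f x * g y <= Omega (dotv x y) ^+ 2) :
  ((\int[lebesgue_rV R n]_x (f x * dotv x u ^+ 2)%:E) *
   (\int[lebesgue_rV R n]_y (g y * dotv y u ^+ 2)%:E) <=
   (\int[lebesgue_rV R n]_z (Omega (enorm z ^+ 2) * dotv z u ^+ 2)%:E) ^+ 2)%E.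
Proof.
(* In dimension 0 there is no axis to turn [u] onto, but all inner products vanish. *)
case: n u f f_iso g g_meas g_ge0 fg_le => [|n] u f f_iso g g_meas g_ge0 fg_le.
  rewrite [X in (X * _)%E]integral0_eq => [|x _]; last by rewrite /dotv big_ord0 expr0n mulr0.
  by rewrite mul0e expe2; exact: sqre_ge0.
pose D : set R := [set t : R | 0 < t].
pose Om : R -> \bar R := (fun t => (Omega t)%:E) \_ D.
have mD : measurable D.
  by rewrite (_ : D = `]0, +oo[%classic)//; apply/seteqP; split=> t /=; rewrite in_itv/= andbT.
have mOm : measurable_fun setT Om.
  by apply/(measurable_restrictT _ mD)/measurable_EFinP.
have OmE t : 0 < t -> Om t = (Omega t)%:E by move=> t0; rewrite /Om patchE mem_set.
have Om0 t : (0 <= Om t)%E.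
  rewrite /Om patchE; case: ifPn => // /set_mem t0.
  by rewrite lee_fin ltW// Omega_gt0.
rewrite [X in (_ <= X ^+ 2)%E](_ : _ =
    \int[lebesgue_rV R n.+1]_z (Om (dotv z z) * (dotv z u ^+ 2)%:E))%E; last first.
  apply: eq_integral => z _; rewrite enorm_sqr.
  have [z0|z0] := eqVneq (dotv z z) 0.
    suff -> : dotv z u = 0 by rewrite expr0n/= mulr0 mule0.
    by rewrite (dotv_eq0 z0) /dotv big1// => i _; rewrite mxE mul0r.
  by rewrite OmE ?EFinM// lt_def z0 dotv_ge0.
apply: santalo_isotropic => // x y xy.
by rewrite OmE// -EFin_expe lee_fin fg_le.
Qed.
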